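(* Let $\Gamma$ be a sofic group and let $S$ be a finite generating set of $\Gamma$. Let $Q_1,Q_2$ be operators with $0\le Q_1\le Q_2\le I$, either both in $R(\Gamma)$ or both in $R(\Gamma,S)$. Then there exists a $\Gamma$-invariant (sofic) monotone coupling of the determinantal probability measures $\mathbf P^{Q_1}$ and $\mathbf P^{Q_2}$.
   Context: Generating sets are always assumed symmetric: $S=S^{-1}$. $o$ is the identity of $\Gamma$. The Cayley diagram $\mathrm{Cay}(\Gamma,S)$ is the oriented labelled graph with vertex set $\Gamma$ and, for each $\gamma\in\Gamma$, $s\in S$, an oriented edge $(\gamma,\gamma s)$ labelled $s$; its edge set $\mathsf E$ is identified with $\Gamma\times S$. $\Gamma$ acts by left translation on $\Gamma$ and on $\mathsf E$, hence unitarily (by $\lambda$) on $\ell^2\Gamma$ and $\ell^2\mathsf E$. $R(\Gamma)=\{T\in B(\ell^2\Gamma): \lambda(g)T=T\lambda(g)\ \forall g\in\Gamma\}$ and $R(\Gamma,S)=\{T\in B(\ell^2\mathsf E): \lambda(g)T=T\lambda(g)\ \forall g\in\Gamma\}$. $\Gamma$ is sofic if there are finite oriented graphs $G_n$ with edges labelled by elements of $S$ such that for every $r>0$ the law of the rooted labelled isomorphism class of the ball of radius $r$ about a uniformly random vertex of $G_n$ converges to the point mass at the class of the ball of radius $r$ about $o$ in $\mathrm{Cay}(\Gamma,S)$ (this does not depend on the finite generating set $S$). For a countable set $E$ and a positive contraction $Q$ on $\ell^2(E)$ (i.e. $0\le\langle Qu,u\rangle\le\langle u,u\rangle$ for all $u$),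 $\mathbf P^Q$ is the unique probability measure on $2^E=\{0,1\}^E$ (subsets of $E$) such that the random subset $\mathfrak S$ satisfies $\mathbf P^Q[A\subset\mathfrak S]=\det(Q\restriction A)$ for all finite $A\subset E$, where $Q\restriction A$ is the submatrix (in the standard orthonormal basis) with rows and columns indexed by $A$. Here $E=\Gamma$ if $Q_i\in R(\Gamma)$ and $E=\mathsf E$ if $Q_i\in R(\Gamma,S)$. A coupling of $\mathbf P^1,\mathbf P^2$ on $2^E$ is a probability measure on $2^E\times2^E$ with these coordinate marginals; it is monotone if it gives probability 1 to $\{(A_1,A_2): A_1\subset A_2\}$; it is $\Gamma$-invariant if it is invariant under the diagonal action of $\Gamma$. It is sofic if the law of the rooted network obtained from $(\mathrm{Cay}(\Gamma,S),o)$ by adding to vertices (resp. edges) the random $\{0,1\}^2$-marks given by the coupling is a random weak limit of finite networks, i.e. the weak limit of the laws of finite labelled and marked graphs seen from a uniformly random root (convergence in law of the rooted labelled marked balls of every radius). *)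

(* Defs.v *)
From HB Require Import structures.
From mathcomp Require Import all_boot all_order all_algebra finmap.
From mathcomp Require Import complex ring.
From mathcomp Require Import all_classical all_reals all_analysis.

Set Implicit Arguments.
Unset Strict Implicit.
Unset Printing Implicit Defensive.

Import Order.TTheory GRing.Theory Num.Theory.
Import numFieldNormedType.Exports.
Import Normc.

Local Open Scope classical_set_scope.
Local Open Scope complex_scope.
Local Open Scope ring_scope.

Section Groups.
Variable Gam : groupType.

Definition symmetric_set (S : {fset Gam}) :=
  forall s, s \in S -> (s^-1)%g \in S.

Definition generating (S : {fset Gam}) :=
  forall g : Gam, exists2 w : seq Gam,
    {subset w <= S} & g = (\prod_(x <- w) x)%g.

Record gaction (X : Type) := GAction {
  gact :> Gam -> X -> X;
  gact1 : forall x, gact 1%g x = x;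
  gactM : forall g h x, gact g (gact h x) = gact (g * h)%g x
}.

Definition vact : gaction Gam := GAction (@mul1g Gam) (@mulgA Gam).

Variable S : {fset Gam}.

Lemma eact_proof1 (e : Gam * S) : ((1 * e.1)%g, e.2) = e.
Proof. by case: e => g s /=; rewrite mul1g. Qed.

Lemma eact_proofM (g h : Gam) (e : Gam * S) :
  ((g * (h * e.1))%g, e.2) = ((g * h * e.1)%g, e.2).
Proof. by rewrite mulgA. Qed.

(* The edge (g, g s) of the Cayley diagram is encoded as (g, s). *)
Definition eact : gaction (Gam * S)%type :=
  @GAction _ (fun g e => ((g * e.1)%g, e.2)) eact_proof1 eact_proofM.

End Groups.

Lemma gact_bij (Gam : groupType) X (a : gaction Gam X) g : bijective (a g).
Proof.
by exists (a g^-1%g) => x; rewrite gactM ?mulVg ?mulgV gact1.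
Qed.

Section L2.
Variables (R : realType) (X : choiceType).

Definition sqnorm (u : X -> R[i]) : \bar R :=
  \esum_(x in [set: X]) ((normc (u x)) ^+ 2)%:E.

Definition l2_pred : {pred (X -> R[i]^o)} :=
  [pred u : X -> R[i]^o | (sqnorm u < +oo)%E].

Lemma sqnorm_ge0 u : (0 <= sqnorm u)%E.
Proof. by apply: esum_ge0 => x _; rewrite lee_fin sqr_ge0. Qed.

Lemma normcE (z : R[i]) : (normc z)%:C = `|z|.
Proof. by case: z. Qed.

Lemma normc_ge0 (z : R[i]) : 0 <= normc z.
Proof. by case: z => a b; exact: sqrtr_ge0. Qed.

Lemma normcD (a b : R[i]) : normc (a + b) <= normc a + normc b.
Proof.
have := ler_normD a b.
by rewrite -!normcE -rmorphD /= lecR.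
Qed.

Lemma l2_submod_closed : submod_closed l2_pred.
Proof.
split.
  rewrite inE /sqnorm esum1 ?ltry// => x _.
  by rewrite [X in normc X](_ : _ = 0%C) // normc0 expr0n.
move=> a u v; rewrite !inE => hu hv.
set c : R := normc a.
have fu : sqnorm u \is a fin_num by rewrite ge0_fin_numE// sqnorm_ge0.
have fv : sqnorm v \is a fin_num by rewrite ge0_fin_numE// sqnorm_ge0.
set n := Num.truncn (2 * c ^+ 2).
have hn : 2 * c ^+ 2 <= n.+1%:R.
  by apply: ltW; apply: truncnS_gt.
have le x : (((normc ((a *: u + v) x)) ^+ 2)%:E <=
    \sum_(i < n.+1) ((normc (u x)) ^+ 2)%:E +
    \sum_(i < 2) ((normc (v x)) ^+ 2)%:E)%E.
  rewrite !sumEFin !sumr_const !card_ord -EFinD lee_fin.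
  have /(lerXn2r 2) h : normc ((a *: u + v) x) <= c * normc (u x) + normc (v x).
    by apply: (le_trans (normcD _ _)); rewrite normcM.
  apply: (le_trans (h _ _)).
  - by rewrite nnegrE normc_ge0.
  - by rewrite nnegrE addr_ge0 ?mulr_ge0 ?normc_ge0.
  set p := normc (u x); set q := normc (v x).
  apply: (@le_trans _ _ (2 * c ^+ 2 * p ^+ 2 + q ^+ 2 *+ 2)).
    rewrite -subr_ge0 (_ : _ - _ = (c * p - q) ^+ 2) ?sqr_ge0//.
    by rewrite mulr2n; ring.
  by rewrite lerD2r -[leRHS]mulr_natl ler_wpM2r// sqr_ge0.
apply: le_lt_trans (le_esum (fun x _ => le x)) _.
rewrite esumD; last 2 first.
- by move=> x _; apply: sume_ge0 => i _; rewrite lee_fin sqr_ge0.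
- by move=> x _; apply: sume_ge0 => i _; rewrite lee_fin sqr_ge0.
rewrite !esum_sum; last 2 first.
- by move=> x i _ _; rewrite lee_fin sqr_ge0.
- by move=> x i _ _; rewrite lee_fin sqr_ge0.
by apply: lte_add_pinfty; apply: lte_sum_pinfty.
Qed.

HB.instance Definition _ :=
  GRing.isSubmodClosed.Build R[i] (X -> R[i]^o) l2_pred l2_submod_closed.

Record l2 := L2 { l2_fun :> X -> R[i]^o; l2P : l2_fun \in l2_pred }.

HB.instance Definition _ := [isSub for l2_fun].
HB.instance Definition _ := [Choice of l2 by <:].
HB.instance Definition _ := [SubChoice_isSubLmodule of l2 by <:].

End L2.
Arguments l2_pred R X : clear implicits.

Section Operators.
Variables (R : realType) (X : choiceType).
Local Notation H := (l2 R X).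

Definition rsum (f : X -> R) : R :=
  fine (esum [set: X] (EFin \o f)^\+ - esum [set: X] (EFin \o f)^\-)%E.

(* Unordered sum of an absolutely summable complex family. *)
Definition csum (f : X -> R[i]) : R[i] :=
  rsum (fun x => complex.Re (f x)) +i* rsum (fun x => complex.Im (f x)).

Definition inner (u v : H) : R[i] := csum (fun x => u x * conjc (v x)).

Definition l2norm (u : H) : R := Num.sqrt (fine (sqnorm u)).

Definition bounded_op (T : H -> H) :=
  exists M : R, forall u, l2norm (T u) <= M * l2norm u.

(* On [R[i]], [z <= w] means that [w - z] is real and nonnegative. *)
Definition ople (T1 T2 : H -> H) :=
  forall u, inner (T1 u) u <= inner (T2 u) u.

Lemma delta_proof (y : X) : (fun x => (x == y)%:R : R[i]^o) \in l2_pred R X.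
Proof.
rewrite inE /= /sqnorm (esumID [set y]); last first.
  by move=> x _; rewrite lee_fin sqr_ge0.
rewrite setTI esum_set1 ?lee_fin ?sqr_ge0// esum1 ?adde0 ?ltry// => x [_ xy].
rewrite (_ : (x == y) = false); last by apply/eqP.
by rewrite [X in normc X](_ : _ = 0%C) // normc0 expr0n.
Qed.

Definition delta (y : X) : H := L2 (delta_proof y).

Definition op_submx (Q : H -> H) (A : {fset X}) : 'M[R[i]]_#|{: A}| :=
  \matrix_(i, j) Q (delta (fsval (enum_val j))) (fsval (enum_val i)).

Section Equivariance.
Variables (Gam : groupType) (a : gaction Gam X).

Lemma translate_proof (g : Gam) (u : H) :
  (fun x => u (a g^-1%g x)) \in l2_pred R X.
Proof.
have := l2P u; rewrite !inE /= /sqnorm.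
rewrite (@reindex_esum R X X [set: X] [set: X] (a g^-1%g)) //.
by rewrite setTT_bijective; exact: gact_bij.
Qed.

Definition translate (g : Gam) (u : H) : H := L2 (translate_proof g u).

Definition in_commutant (T : {linear H -> H}) :=
  bounded_op T /\ forall g u, T (translate g u) = translate g (T u).

End Equivariance.
End Operators.

Section Configurations.
Variable X : choiceType.

Definition cylinders : set (set (X -> bool)) :=
  [set [set w : X -> bool | w x] | x in [set: X]].

Definition config := g_sigma_algebraType cylinders.

Variable R : realType.

Definition is_determinantal (Q : l2 R X -> l2 R X)
    (P : probability config R) :=
  forall A : {fset X},
    (fine (P [set w : config | forall x, x \in A -> w x]))%:C = \det (op_submx Q A).

Definition is_coupling (P1 P2 : probability config R)
    (mu : probability (config * config)%type R) :=
  forall B : set config, measurable B ->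
    mu (B `*` setT) = P1 B /\ mu (setT `*` B) = P2 B.

Definition monotone_coupling (mu : probability (config * config)%type R) :=
  mu [set w : config * config | forall x, w.1 x -> w.2 x] = 1%E.

Variables (Gam : groupType) (a : gaction Gam X).

Definition cshift (g : Gam) (w : config) : config := fun x => w (a g^-1%g x).

Definition diag_invariant (mu : probability (config * config)%type R) :=
  forall (g : Gam) (B : set (config * config)), measurable B ->
    mu [set w : config * config | B (cshift g w.1, cshift g w.2)] = mu B.

End Configurations.
Arguments cylinders X : clear implicits.

(* Oriented multigraphs with marks in [A] on vertices and in [B] on edges;
   edge labels are part of the edge marks. *)
Section Networks.
Variables A B : Type.

Record rnet := RNet {
  vert : Type;
  edge : Type;
  src : edge -> vert;
  tgt : edge -> vert;
  vmark : vert -> A;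
  emark : edge -> B;
  base : vert
}.

Record finnet := FinNet {
  fvert : finType;
  fedge : finType;
  fsrc : fedge -> fvert;
  ftgt : fedge -> fvert;
  fvmark : fvert -> A;
  femark : fedge -> B;
  fvert_gt0 : (0 < #|fvert|)%N
}.

Definition rooted_at (G : finnet) (v : fvert G) : rnet :=
  RNet (@fsrc G) (@ftgt G) (@fvmark G) (@femark G) v.

Definition riso (N N' : rnet) := exists (f : vert N -> vert N')
    (h : edge N -> edge N'), [/\ bijective f, bijective h,
  f (base N) = base N',
  forall e, src (h e) = f (src e) /\ tgt (h e) = f (tgt e) &
  (forall v, vmark (f v) = vmark v) /\ (forall e, emark (h e) = emark e)].

(* Vertices at distance at most [r] from the root, ignoring orientations. *)
Fixpoint within (N : rnet) (r : nat) (v : vert N) : Prop :=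
  if r is r'.+1 then
    within r' v \/ exists e : edge N,
      (within r' (src e) /\ tgt e = v) \/ (within r' (tgt e) /\ src e = v)
  else v = base N.

Lemma within_base (N : rnet) r : within r (base N).
Proof. by elim: r => [|r IH] //=; left. Qed.

Definition nball (N : rnet) (r : nat) : rnet := @RNet
  {v : vert N | within r v}
  {e : edge N | within r (src e) /\ within r (tgt e)}
  (fun e => exist _ (src (sval e)) (proj1 (svalP e)))
  (fun e => exist _ (tgt (sval e)) (proj2 (svalP e)))
  (fun v => vmark (sval v))
  (fun e => emark (sval e))
  (exist _ (base N) (within_base N r)).

(* Probability that the ball of radius [r] about a uniform vertex of [G] lies
   in the rooted isomorphism class of [N]. *)
Definition ball_freq (R : realType) (G : finnet) (r : nat) (N : rnet) : R :=
  #|[pred v : fvert G | `[< riso (nball (rooted_at v) r) N >]]|%:R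
    / #|fvert G|%:R.

(* The rooted isomorphism classes of finite balls form a countable discrete
   space, on which convergence in law is convergence of all point masses. *)
Definition is_random_weak_limit (R : realType) d (T : measurableType d)
    (mu : probability T R) (N : T -> rnet) :=
  exists G : nat -> finnet, forall (r : nat) (K : finnet) (k : fvert K),
    (fun n => ball_freq R (G n) r (rooted_at k)) @ \oo -->
      fine (mu [set t | riso (nball (N t) r) (rooted_at k)]).

End Networks.

Section Cayley.
Variables (Gam : groupType) (S : {fset Gam}).

Definition cayley (A B : Type) (vm : Gam -> A) (em : Gam * S -> B) : rnet A B :=
  @RNet A B Gam (Gam * S)%type (fun e => e.1) (fun e => (e.1 * fsval e.2)%g)
    vm em 1%g.

Definition cay : rnet unit S := cayley (fun=> tt) (fun e => e.2).

Definition sofic_for (R : realType) := exists G : nat -> finnet unit S,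
  forall r : nat, (fun n => ball_freq R (G n) r (nball cay r)) @ \oo --> (1 : R).

Definition cay_vmarked (w : config Gam * config Gam) : rnet (bool * bool) S :=
  cayley (fun g => (w.1 g, w.2 g)) (fun e => e.2).

Definition cay_emarked (w : config (Gam * S)%type * config (Gam * S)%type) :
    rnet unit (S * (bool * bool)) :=
  cayley (fun=> tt) (fun e => (e.2, (w.1 e, w.2 e))).

End Cayley.

(* Soficity does not depend on the finite generating set; [R] only serves as
   the field in which frequencies converge. *)
Definition sofic (R : realType) (Gam : groupType) :=
  exists S : {fset Gam},
    [/\ symmetric_set S, generating S & sofic_for S R].

(* Main.v *)
Require Import Defs.
From HB Require Import structures.
From mathcomp Require Import all_boot all_order all_algebra.
From mathcomp Require Import ring lra zify boolp complex.

(* Applied to the three positive operators Q1, Q2 - Q1 and 1 - Q2, the recursion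
   T_0 = T, T_(k+1) = T_k - T_k^2 gives T = sum_k T_k^2 strongly. Hence the
   truncated vectors T_k delta_x, transported to a finite sofic approximation of
   Gam, are almost the columns of an isometry whose rows are divided into three
   classes. The Cayley transform of the skew-Hermitian matrix built on them is
   an exact unitary U close to it, and the compressions of U to the rows of the
   first class and of the first two classes give finite kernels Qn1 <= Qn2 which
   look like Q1 and Q2 around most vertices.

   The law of the finite determinantal process with kernel sum_l conj(U l) (U l)
   over a set of rows is the squared modulus of the Slater state of these rows in
   the fermionic Fock space. Creation by a unit vector is a contraction
   compatible with the restriction to a down-set, so that more rows mean a
   stochastically larger set, and Strassen's theorem provides a monotone coupling
   on each finite approximation.

   This coupling need not be invariant, but seen from a uniform root it becomes
   invariant in the limit. An ultrafilter limit of the laws seen from the root is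
   finitely additive on all events; nested intervals realise its values on
   cylinders by a probability on pairs of configurations. Finitely many copies of
   the approximations, marked by samples of the finite couplings, converge to it
   as networks. *)

Set Implicit Arguments.
Unset Strict Implicit.
Unset Printing Implicit Defensive.
Import Order.TTheory GRing.Theory Num.Theory.

Local Open Scope ring_scope.

(** * Fermionic Fock space *)

(** The obstacle is the order: cutting [Q1] and [Q2] down to finite windows and carrying them to a
    finite graph need not respect [Q1 <= Q2] or [Q2 <= 1], and a kernel that leaves the positive
    contractions has no determinantal measure to couple. An exact unitary removes the difficulty:
    the kernels attached to two nested sets of rows are ordered whatever the quality of the
    approximation, and closeness to [Q1] and [Q2] is only needed on average over the vertices.

    The recursion by squares stands in for a square root and needs only the algebra of operators:
    pairing the telescoping sum with u bounds the sum of the squared norms of T_k u by <Tu, u>.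

    The Cayley transform comes from the remark that Y^2 e = -e implies (1 - Y) Y e = (1 + Y) e, so
    that the transform sends e to Y e. For the off-diagonal skew matrix built on a map W, Y^2 is
    minus the Gram operator of W on the source space, so the condition says that W is isometric
    there. *)

Section Fock.
Variables (C : numClosedFieldType) (F : finType).
Local Notation fock := {ffun {set F} -> C^o}.
Implicit Types (e f : F) (S T A : {set F}) (phi psi : fock) (u v w : F -> C).

Definition before e f := (enum_rank e < enum_rank f)%N.

(** The Jordan-Wigner sign, which makes creations at distinct sites anticommute. *)
Definition jw_sign S e : C := (-1) ^+ #|[set x in S | before x e]|.

Definition create e phi : fock :=
  [ffun S : {set F} => if e \in S then jw_sign S e * phi (S :\ e) else 0].

Definition annih e phi : fock :=
  [ffun S : {set F} => if e \in S then 0 else jw_sign S e * phi (e |: S)].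

Definition creator v phi : fock := \sum_e v e *: create e phi.

Definition annihilator v phi : fock := \sum_e (v e)^* *: annih e phi.

Lemma before_neq e f : e != f -> before f e = ~~ before e f.
Proof.
move=> nef; rewrite /before -leqNgt ltn_neqAle -[RHS]andTb; congr andb.
by apply: contra nef => /eqP/val_inj/enum_rank_inj ->.
Qed.

Lemma before_irr e : before e e = false. Proof. exact: ltnn. Qed.

Lemma jw_signU S e f :
  f \notin S -> jw_sign (f |: S) e = jw_sign S e * (-1) ^+ before f e.
Proof.
move=> fS; rewrite /jw_sign -exprD addnC; congr (_ ^+ _).
have -> : [set x in f |: S | before x e] =
    (if before f e then f |: [set x in S | before x e]
     else [set x in S | before x e]).
  apply/setP=> x; case: ifP => bfe; rewrite !inE; case: eqP => // ->;
  by rewrite ?bfe ?andbT ?andbF ?(negbTE fS).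
by case: ifP => bfe //; rewrite cardsU1 !inE (negbTE fS).
Qed.

Lemma jw_signD S e f :
  f \in S -> jw_sign S e = jw_sign (S :\ f) e * (-1) ^+ before f e.
Proof. by move=> fS; rewrite -jw_signU ?setD1K// !inE eqxx. Qed.

Lemma jw_sign_sq S e : jw_sign S e * jw_sign S e = 1.
Proof. by rewrite -expr2 sqrr_sign. Qed.

Lemma jw_sign_conj S e : (jw_sign S e)^* = jw_sign S e.
Proof. by rewrite rmorphXn rmorphN1. Qed.

Lemma jw_sign_norm S e : `|jw_sign S e| = 1.
Proof. by rewrite normrX normrN1 expr1n. Qed.

Lemma annih_annih e f phi : annih e (annih f phi) = - annih f (annih e phi).
Proof.
apply/ffunP => S; rewrite !ffunE !inE.
have [<-|nef] := eqVneq e f; first by rewrite ?eqxx /= mulr0 !if_same oppr0.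
case eS: (e \in S); case fS: (f \in S); rewrite /= ?mulr0 ?oppr0 ?subr0//.
rewrite (jw_signU _ (negbT eS)) (jw_signU _ (negbT fS)) (before_neq nef).
rewrite setUCA; by case: before => /=; ring.
Qed.

Lemma create_create e f phi : create e (create f phi) = - create f (create e phi).
Proof.
apply/ffunP => S; rewrite !ffunE !inE.
have [<-|nef] := eqVneq e f; first by rewrite ?eqxx /= mulr0 !if_same oppr0.
case eS: (e \in S); case fS: (f \in S); rewrite /= ?mulr0 ?oppr0 ?subr0//.
rewrite (jw_signD e fS) (jw_signD f eS) (before_neq nef).
rewrite setDDl setUC -setDDl; by case: before => /=; ring.
Qed.

(** The canonical anticommutation relation: for distinct sites, exchanging the two maps changes
    exactly one of the two signs, since exactly one of [e] and [f] precedes the other. *)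
Lemma annih_create e f phi :
  annih e (create f phi) = (e == f)%:R *: phi - create f (annih e phi).
Proof.
apply/ffunP => S; rewrite !ffunE !inE.
have [<-|nef] /= := eqVneq e f.
  rewrite scale1r; case eS: (e \in S) => /=.
    by rewrite (jw_signD e eS) before_irr mulr1 mulrA jw_sign_sq mul1r setD1K// subrr.
  rewrite setU1K ?eS// (jw_signU _ (negbT eS)) before_irr mulr1 mulrA.
  by rewrite jw_sign_sq mul1r subr0.
rewrite scale0r add0r.
case eS: (e \in S); case fS: (f \in S); rewrite /= ?mulr0 ?oppr0 ?subr0//.
rewrite (jw_signU _ (negbT eS)) (jw_signD e fS) (before_neq nef).
have -> : (e |: S) :\ f = e |: (S :\ f).
  by apply/setP=> x; rewrite !inE; case: (eqVneq x e) => [->|//]; rewrite nef.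
by case: before => /=; ring.
Qed.

Lemma create_is_linear e : linear (create e).
Proof.
move=> a phi psi; apply/ffunP => S; rewrite !ffunE.
by case: ifP => _; rewrite ?scaler0 ?addr0// mulrDr scalerAr.
Qed.
HB.instance Definition _ e := GRing.isLinear.Build C fock fock _ (create e) (create_is_linear e).

Lemma annih_is_linear e : linear (annih e).
Proof.
move=> a phi psi; apply/ffunP => S; rewrite !ffunE.
by case: ifP => _; rewrite ?scaler0 ?addr0// mulrDr scalerAr.
Qed.
HB.instance Definition _ e := GRing.isLinear.Build C fock fock _ (annih e) (annih_is_linear e).

Lemma creator_is_linear v : linear (creator v).
Proof.
move=> a phi psi; rewrite /creator scaler_sumr -big_split /=; apply: eq_bigr => e _.
by rewrite linearP scalerDr !scalerA mulrC.
Qed.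
HB.instance Definition _ v := GRing.isLinear.Build C fock fock _ (creator v) (creator_is_linear v).

Lemma annihilator_is_linear v : linear (annihilator v).
Proof.
move=> a phi psi; rewrite /annihilator scaler_sumr -big_split /=; apply: eq_bigr => e _.
by rewrite linearP scalerDr !scalerA mulrC.
Qed.
HB.instance Definition _ v := GRing.isLinear.Build C fock fock _ (annihilator v) (annihilator_is_linear v).

Lemma annih_creator e v phi :
  annih e (creator v phi) = v e *: phi - creator v (annih e phi).
Proof.
rewrite linear_sum /creator /=.
under eq_bigr do rewrite linearZ/= annih_create scalerBr scalerA.
rewrite sumrB -scaler_suml (bigD1 e)//= eqxx mulr1 big1 ?addr0// => f nfe.
by rewrite eq_sym (negbTE nfe) mulr0.
Qed.

Lemma creator_creator u v phi :
  creator u (creator v phi) = - creator v (creator u phi).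
Proof.
rewrite /creator -sumrN.
under eq_bigr do rewrite linear_sum scaler_sumr.
under [RHS]eq_bigr do rewrite linear_sum scaler_sumr -sumrN.
rewrite exchange_big; apply: eq_bigr => e _; apply: eq_bigr => f _ /=.
by rewrite !linearZ/= create_create !scalerN !scalerA mulrC.
Qed.

Lemma annihilator_creator u v phi :
  annihilator u (creator v phi) =
  (\sum_e (u e)^* * v e) *: phi - creator v (annihilator u phi).
Proof.
rewrite /annihilator scaler_suml (linear_sum (creator v)) -sumrB; apply: eq_bigr => e _ /=.
by rewrite annih_creator linearZ/= scalerBr scalerA.
Qed.

Lemma annih_creator_swap e v phi :
  creator v (annih e phi) = v e *: phi - annih e (creator v phi).
Proof. by rewrite annih_creator opprB addrC subrK. Qed.

Lemma annih_annihilator e u phi :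
  annih e (annihilator u phi) = - annihilator u (annih e phi).
Proof.
rewrite linear_sum /= /annihilator -sumrN; apply: eq_bigr => f _.
by rewrite linearZ/= annih_annih scalerN.
Qed.

Definition dot phi psi : C := \sum_S phi S * (psi S)^*.

Lemma dotDl phi1 phi2 psi : dot (phi1 + phi2) psi = dot phi1 psi + dot phi2 psi.
Proof. by rewrite -big_split /=; apply: eq_bigr => S _; rewrite ffunE mulrDl. Qed.

Lemma dotZl a phi psi : dot (a *: phi) psi = a * dot phi psi.
Proof. by rewrite mulr_sumr; apply: eq_bigr => S _; rewrite ffunE mulrA. Qed.

Lemma dotC phi psi : dot phi psi = (dot psi phi)^*.
Proof. by rewrite rmorph_sum; apply: eq_bigr => S _; rewrite rmorphM /= conjCK mulrC. Qed.

Lemma dotZr a phi psi : dot phi (a *: psi) = a^* * dot phi psi.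
Proof. by rewrite mulr_sumr; apply: eq_bigr => S _; rewrite ffunE rmorphM/=; ring. Qed.

Lemma dot_suml (I : Type) (r : seq I) (P : pred I) (E : I -> fock) psi :
  dot (\sum_(i <- r | P i) E i) psi = \sum_(i <- r | P i) dot (E i) psi.
Proof.
rewrite exchange_big; apply: eq_bigr => S _ /=.
by rewrite sum_ffunE mulr_suml.
Qed.

Lemma dot_sumr (I : Type) (r : seq I) (P : pred I) (E : I -> fock) phi :
  dot phi (\sum_(i <- r | P i) E i) = \sum_(i <- r | P i) dot phi (E i).
Proof.
by rewrite dotC dot_suml rmorph_sum; apply: eq_bigr => i _ /=; rewrite -dotC.
Qed.

Lemma dot_annih e phi psi : dot (annih e phi) psi = dot phi (create e psi).
Proof.
rewrite /dot [LHS](bigID (fun S => e \in S)) /= [RHS](bigID (fun S => e \in S)) /=.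
rewrite big1 ?add0r; last by move=> S eS; rewrite ffunE eS mul0r.
rewrite [X in _ = _ + X]big1 ?addr0; last first.
  by move=> S eS; rewrite ffunE (negbTE eS) conjC0 mulr0.
rewrite (reindex_onto (fun S => S :\ e) (fun S => e |: S)) /=; last first.
  by move=> S eS; rewrite setU1K.
apply: eq_big => [S|S].
  rewrite !inE eqxx /=; apply/eqP/idP => [<-|eS]; last by rewrite setD1K.
  by rewrite !inE eqxx.
move=> /andP[_ /eqP eS]; have {}eS : e \in S by rewrite -eS !inE eqxx.
rewrite !ffunE !inE eqxx eS /= setD1K// rmorphM/= jw_sign_conj.
by rewrite (jw_signD e eS) before_irr mulr1; ring.
Qed.

Lemma dot_annihilator v phi psi :
  dot (annihilator v phi) psi = dot phi (creator v psi).
Proof.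
rewrite dot_suml dot_sumr; apply: eq_bigr => e _.
by rewrite dotZl dotZr dot_annih.
Qed.

Lemma dot_ge0 phi : 0 <= dot phi phi.
Proof. by apply: sumr_ge0 => S _; rewrite mul_conjC_ge0. Qed.

(** The anticommutation relation paired with [phi]. The subtracted term being nonnegative, creation
    by a unit vector is a contraction. *)
Lemma dot_creator v phi : dot (creator v phi) (creator v phi) =
  (\sum_e (v e)^* * v e) * dot phi phi - dot (annihilator v phi) (annihilator v phi).
Proof.
rewrite -dot_annihilator annihilator_creator -scaleN1r dotDl !dotZl mulN1r.
by rewrite [X in _ - X]dotC -dot_annihilator -dotC.
Qed.

Definition vacuum : fock := [ffun S => (S == set0)%:R].

Lemma annihilator_vacuum u : annihilator u vacuum = 0.
Proof.
apply: big1 => e _; rewrite [annih e _](_ : _ = 0) ?scaler0//.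
apply/ffunP => S; rewrite !ffunE; case: ifP => // _.
by rewrite (_ : _ == _ = false) ?mulr0//; apply/eqP/setP => /(_ e); rewrite !inE eqxx.
Qed.

Lemma dot_vacuum : dot vacuum vacuum = 1.
Proof.
rewrite /dot (bigD1 set0)//= ffunE eqxx conjC1 mulr1 big1 ?addr0// => S /negbTE nS.
by rewrite ffunE nS mul0r.
Qed.

(* The operator monotonicity of determinantal measures rests on this: for a
   down-set [D], the values of [creator v phi] on [D] only depend on the values
   of [phi] on [D], and [creator v] is a contraction when [v] is a unit vector. *)
Lemma creator_downset (D : pred {set F}) v phi :
  (forall S T, S \subset T -> D T -> D S) ->
  \sum_(S | D S) `|creator v phi S| ^+ 2 <=
  (\sum_e (v e)^* * v e) * \sum_(S | D S) `|phi S| ^+ 2.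
Proof.
move=> downD; pose psi : fock := [ffun S => if D S then phi S else 0].
have -> : \sum_(S | D S) `|creator v phi S| ^+ 2 = \sum_(S | D S) `|creator v psi S| ^+ 2.
  apply: eq_bigr => S DS; congr (`|_| ^+ 2).
  rewrite !sum_ffunE; apply: eq_bigr => e _; rewrite !ffunE; case: ifP => // eS.
  by rewrite (downD _ S)// subsetDl.
have dotE chi : dot chi chi = \sum_S `|chi S| ^+ 2 by apply: eq_bigr => S _; rewrite normCK.
apply: (@le_trans _ _ (dot (creator v psi) (creator v psi))).
  rewrite dotE [leRHS](bigID D)/= lerDl sumr_ge0// => S _.
  by rewrite exprn_ge0.
rewrite dot_creator [dot psi psi]dotE.
have -> : \sum_S `|psi S| ^+ 2 = \sum_(S | D S) `|phi S| ^+ 2.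
  rewrite [RHS]big_mkcond; apply: eq_bigr => S _.
  by rewrite ffunE; case: ifP => // _; rewrite normr0 expr0n.
by rewrite gerDl oppr_le0 dot_ge0.
Qed.

Section Slater.
Variables (I : eqType) (b : I -> F -> C).
Hypothesis orthb : forall i j, \sum_e (b i e)^* * b j e = (i == j)%:R.
Implicit Types s t : seq I.

Definition slater s : fock := foldr (fun i => creator (b i)) vacuum s.

Lemma annihilator_slater u s :
  (forall i, i \in s -> \sum_e (u e)^* * b i e = 0) -> annihilator u (slater s) = 0.
Proof.
elim: s => [|i s IHs] us /=; first exact: annihilator_vacuum.
rewrite annihilator_creator us ?mem_head// scale0r add0r IHs ?linear0 ?oppr0// => j js.
by apply: us; rewrite inE js orbT.
Qed.

(** Pauli exclusion: a creator anticommutes with itself, so twice its square is zero; the factors in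
    between only change the sign. *)
Lemma creator_slater_mem i s : i \in s -> creator (b i) (slater s) = 0.
Proof.
elim: s => [//|j s IHs] /=; rewrite inE; case: eqVneq => [<- _|_ /= /IHs eq0].
  apply/eqP; have : (2 : C) *: creator (b i) (slater (i :: s)) == 0.
    by rewrite scaler_nat mulr2n {1}[slater _]/= {1}creator_creator addNr.
  by rewrite scaler_eq0 pnatr_eq0.
by rewrite creator_creator eq0 linear0 oppr0.
Qed.

Lemma creator_slater_span u s (c : I -> C) :
  (forall e, u e = \sum_(i <- s) c i * b i e) -> creator u (slater s) = 0.
Proof.
move=> uE; have -> : creator u (slater s) = \sum_(i <- s) c i *: creator (b i) (slater s).
  rewrite /creator; under [RHS]eq_bigr do rewrite scaler_sumr.
  rewrite exchange_big /=; apply: eq_bigr => e _; rewrite uE scaler_suml.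
  by apply: eq_bigr => i _; rewrite scalerA.
by rewrite big_seq big1// => i /creator_slater_mem ->; rewrite scaler0.
Qed.

Lemma dot_slater s : uniq s -> dot (slater s) (slater s) = 1.
Proof.
elim: s => [_|i s IHs /andP[nis us]] /=; first exact: dot_vacuum.
rewrite dot_creator orthb eqxx mul1r IHs// annihilator_slater ?/dot.
  by rewrite big1 ?subr0// => S _; rewrite ffunE mul0r.
by move=> j js; rewrite orthb; case: eqVneq nis => // ->; rewrite js.
Qed.

(** Annihilations at the sites [g i], that of [g ord0] outermost. For injective [g] this reads
    [phi], up to sign, at sets enlarged by all these sites, which turns inclusion probabilities into
    squared norms. *)
Fixpoint annih_word m : ('I_m -> F) -> fock -> fock :=
  if m is m'.+1 then
    fun g phi => annih (g ord0) (annih_word (fun i => g (lift ord0 i)) phi)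
  else fun _ phi => phi.

Lemma annih_wordS m (g : 'I_m.+1 -> F) phi :
  annih_word g phi = annih (g ord0) (annih_word (fun i => g (lift ord0 i)) phi).
Proof. by []. Qed.

Lemma annihilator_word m (g : 'I_m -> F) u phi :
  annihilator u phi = 0 -> annihilator u (annih_word g phi) = 0.
Proof.
move=> eq0; elim: m g => [|m IHm] g //=.
by apply: oppr_inj; rewrite -annih_annihilator IHm linear0 oppr0.
Qed.

(** Moving the creator inwards leaves one term per site, with alternating signs; the term in which
    it reaches [phi] vanishes. This is the shape of a Laplace expansion. *)
Lemma creator_word m (g : 'I_m.+1 -> F) u phi : creator u phi = 0 ->
  creator u (annih_word g phi) =
  \sum_(j < m.+1) ((-1) ^+ j * u (g j)) *: annih_word (fun i => g (lift j i)) phi.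
Proof.
move=> eq0; elim: m g => [|m IHm] g.
  by rewrite big_ord1 /= expr0 mul1r annih_creator_swap eq0 linear0 subr0.
rewrite big_ord_recl expr0 mul1r [in LHS]annih_wordS annih_creator_swap.
rewrite IHm linear_sum -sumrN; congr (_ + _); apply: eq_bigr => j _.
rewrite linearZ -scaleNr exprS mulN1r mulNr annih_wordS; congr (_ *: annih _ _).
  by congr g; apply/val_inj.
congr (annih_word _ _); apply/funext => i.
by congr g; apply/val_inj; rewrite /= /bump /=; lia.
Qed.

(** For distinct indices, the kernel of the orthogonal projection onto the span of the [b i], [i] in
    [s]. *)
Definition gram s e f := \sum_(i <- s) b i e * (b i f)^*.

(** The point mass at [e] minus its projection onto the span is orthogonal to every [b i], so its
    annihilator kills the Slater state and, by anticommutation, the whole word. The point mass may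
    be replaced by its projection, whose creator also kills the state. *)
Lemma annih_slater s m (g : 'I_m -> F) e : uniq s ->
  annih e (annih_word g (slater s)) =
  annihilator (fun f => gram s f e) (annih_word g (slater s)).
Proof.
move=> us; apply/eqP; rewrite -subr_eq0; apply/eqP.
have -> : annih e (annih_word g (slater s)) =
    annihilator (fun f => (f == e)%:R) (annih_word g (slater s)).
  rewrite /annihilator (bigD1 e)//= eqxx conjC1 scale1r big1 ?addr0// => f /negbTE ->.
  by rewrite conjC0 scale0r.
rewrite -sumrB; under eq_bigr do rewrite -scalerBl -rmorphB.
change (annihilator (fun f => (f == e)%:R - gram s f e) (annih_word g (slater s)) = 0).
apply: annihilator_word; apply: annihilator_slater => i si.
under eq_bigr do rewrite rmorphB/= mulrBl.
rewrite sumrB (bigD1 e)//= eqxx conjC1 mul1r big1 ?addr0; last first.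
  by move=> f /negbTE ->; rewrite conjC0 mul0r.
rewrite /gram; under eq_bigr do rewrite rmorph_sum mulr_suml.
rewrite exchange_big (bigD1_seq i)//= [X in _ - (X + _)](_ : _ = b i e).
  rewrite big1 ?addr0 ?subrr// => j /negbTE ji.
  transitivity (b j e * \sum_f (b j f)^* * b i f); last by rewrite orthb ji mulr0.
  by rewrite mulr_sumr; apply: eq_bigr => f _; rewrite rmorphM/= conjCK; ring.
transitivity (b i e * \sum_f (b i f)^* * b i f); last by rewrite orthb eqxx mulr1.
by rewrite mulr_sumr; apply: eq_bigr => f _; rewrite rmorphM/= conjCK; ring.
Qed.

(* Wick's theorem, by Laplace expansion along the first row. *)
Lemma dot_word m (g h : 'I_m -> F) s : uniq s ->
  dot (annih_word g (slater s)) (annih_word h (slater s)) =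
  \det (\matrix_(i, j) gram s (g i) (h j)).
Proof.
move=> us; elim: m g h => [|m IHm] g h; first by rewrite det_mx00 dot_slater.
rewrite [annih_word g _]annih_wordS annih_slater// dot_annihilator.
rewrite creator_word; last first.
  by apply: (@creator_slater_span _ s (fun i => (b i (g ord0))^*)) => e; apply: eq_bigr => i _; rewrite mulrC.
rewrite dot_sumr (expand_det_row _ ord0); apply: eq_bigr => j _.
rewrite dotZr IHm mxE /cofactor add0n rmorphM rmorphXn rmorphN1 /=.
rewrite [X in _ * X * _](_ : _ = gram s (g ord0) (h j)); last first.
  by rewrite rmorph_sum; apply: eq_bigr => i _; rewrite rmorphM/= conjCK mulrC.
rewrite mulrAC mulrC; congr (_ * (_ * \det _)).
by apply/matrixP => i k; rewrite !mxE.
Qed.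

Lemma normr_annih_word m (g : 'I_m -> F) phi S : injective g ->
  `|annih_word g phi S| =
  if [forall i, g i \notin S] then `|phi (S :|: [set g i | i in 'I_m])| else 0.
Proof.
elim: m g phi S => [|m IHm] g phi S injg.
  rewrite /= ifT; last by apply/forallP => -[].
  by rewrite (_ : [set g i | i in 'I_0] = set0) ?setU0//; apply/setP=> x; rewrite inE; apply/imsetP => -[[]].
rewrite [LHS]/= ffunE; case: ifP => gS.
  by rewrite normr0 ifF//; apply/negbTE; rewrite negb_forall; apply/existsP; exists ord0; rewrite gS.
rewrite normrM jw_sign_norm mul1r IHm; last by move=> i j /injg /lift_inj.
have -> : [forall i, g (lift ord0 i) \notin g ord0 |: S] = [forall i, g i \notin S].
  apply/forallP/forallP => [H i|H i].
    by case: (unliftP ord0 i) => [j ->|->]; [have := H j; rewrite !inE negb_or => /andP[]|rewrite gS].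
  by rewrite !inE negb_or H andbT (inj_eq injg) eq_sym neq_lift.
case: ifP => // _; congr `|phi _|; apply/setP => x; rewrite !inE.
rewrite -orbA orbCA; congr orb.
apply/idP/imsetP => [/predU1P[->|/imsetP[i _ ->]]|[i _ ->]].
- by exists ord0.
- by exists (lift ord0 i).
case: (unliftP ord0 i) => [j ->|->]; last by rewrite eqxx.
by apply/orP; right; apply/imsetP; exists j.
Qed.

(** Removing the sites [g i] is a bijection from the sets that contain them to the sets that avoid
    them, and the annihilation word reads the state through it; the left side is thus the squared
    norm computed by [dot_word]. *)
Lemma slater_inclusion m (g : 'I_m -> F) s : uniq s -> injective g ->
  \sum_(S : {set F} | [forall i, g i \in S]) `|slater s S| ^+ 2 =
  \det (\matrix_(i, j) gram s (g i) (g j)).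
Proof.
move=> us injg; rewrite -dot_word//.
pose G := [set g i | i in 'I_m].
have gG i : g i \in G by apply/imsetP; exists i.
transitivity (\sum_S `|annih_word g (slater s) S| ^+ 2); last first.
  by apply: eq_bigr => S _; rewrite normCK.
rewrite [RHS](bigID (fun S => [forall i, g i \notin S]))/= [X in _ = _ + X]big1 ?addr0; last first.
  by move=> S /negbTE nS; rewrite normr_annih_word// nS expr0n.
rewrite [RHS](reindex_onto (fun S => S :\: G) (fun S => S :|: G)) /=; last first.
  move=> S /forallP HS; apply/setP => x; rewrite !inE.
  case xG: (x \in G) => /=; last by rewrite orbF.
  by case/imsetP: xG => i _ ->; rewrite (negbTE (HS i)).
apply: eq_big => [S|S /forallP HS].
  apply/forallP/andP => [H|[_ /eqP <- i]]; last by rewrite inE gG orbT.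
  split; first by apply/forallP => i; rewrite !inE gG.
  apply/eqP/setP => x; rewrite !inE.
  case xG: (x \in G) => /=; last by rewrite orbF.
  by case/imsetP: xG => i _ ->; rewrite (H i).
rewrite normr_annih_word// ifT; last by apply/forallP => i; rewrite !inE gG.
congr (`|slater s _| ^+ 2); apply/setP => x; rewrite -/G !inE.
case xG: (x \in G) => /=; last by rewrite orbF.
by case/imsetP: xG => i _ ->; rewrite (HS i).
Qed.

Lemma slater_sum s : uniq s -> \sum_(S : {set F}) `|slater s S| ^+ 2 = 1.
Proof.
by move=> us; rewrite -[RHS](dot_slater us); apply: eq_bigr => S _; rewrite normCK.
Qed.

(** Each vector of [t] is created on top of the previous state, and [creator_downset] says that no
    mass is gained on [D]. *)
Lemma slater_downset (D : pred {set F}) s t :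
  (forall S T, S \subset T -> D T -> D S) ->
  \sum_(S | D S) `|slater (t ++ s) S| ^+ 2 <= \sum_(S | D S) `|slater s S| ^+ 2.
Proof.
move=> downD; elim: t => [//|i t IHt] /=.
apply: le_trans IHt; apply: le_trans (creator_downset _ _ downD) _.
by rewrite orthb eqxx mul1r.
Qed.
End Slater.
End Fock.

(** * Strassen's theorem on finite sets *)

Section Transport.
Variables (R : realFieldType) (X Y : finType) (r : X -> Y -> bool).

Definition nbhd (U : {set X}) : {set Y} := [set y | [exists x in U, r x y]].

Lemma nbhdU (U V : {set X}) : nbhd (U :|: V) = nbhd U :|: nbhd V.
Proof.
apply/setP => y; rewrite !inE; apply/existsP/orP => [[x /andP[]]|].
  by rewrite inE => /orP[] xU xy; [left|right]; apply/existsP; exists x; rewrite xU.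
by case=> /existsP[x /andP[xU xy]]; exists x; rewrite inE xU ?orbT.
Qed.

Lemma nbhd_sub (U V : {set X}) : U \subset V -> nbhd U \subset nbhd V.
Proof. by move=> /setUidPr <-; rewrite nbhdU subsetUl. Qed.

Lemma sum_point (Z : finType) (A : {set Z}) z (c : R) :
  \sum_(t in A) (t == z)%:R * c = (z \in A)%:R * c.
Proof.
rewrite -mulr_suml; congr (_ * _); case: (boolP (z \in A)) => zA.
  by rewrite (bigD1 z)//= eqxx big1 ?addr0// => t /andP[_ /negbTE ->].
by rewrite big1// => t tA; case: eqVneq zA => // <-; rewrite tA.
Qed.

Lemma sum_restrict (Z : finType) (A B : {set Z}) (f : Z -> R) :
  \sum_(z in A) (z \in B)%:R * f z = \sum_(z in A :&: B) f z.
Proof.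
rewrite [RHS]big_mkcond [LHS]big_mkcond; apply: eq_bigr => z _; rewrite inE.
by case: (z \in A) => //=; case: (z \in B); rewrite /= ?mul1r ?mul0r.
Qed.

Lemma sum_subset_le (Z : finType) (A B : {set Z}) (f : Z -> R) :
  (forall z, 0 <= f z) -> A \subset B -> \sum_(z in A) f z <= \sum_(z in B) f z.
Proof.
move=> f0 /setIidPr AB; rewrite -AB -sum_restrict; apply: ler_sum => z _.
by case: (z \in A); rewrite /= ?mul1r ?mul0r.
Qed.

Definition hall_cond (a : X -> R) (b : Y -> R) :=
  forall U : {set X}, \sum_(x in U) a x <= \sum_(y in nbhd U) b y.

(** The second marginal is only bounded, as in Hall's condition; [finite_strassen] recovers equality
    from equal total masses. *)
Definition transportable (a : X -> R) (b : Y -> R) :=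
  exists p : X -> Y -> R, [/\ forall x y, 0 <= p x y,
    forall x y, p x y != 0 -> r x y,
    forall x, \sum_y p x y = a x & forall y, \sum_x p x y <= b y].

Let supp (a : X -> R) (b : Y -> R) :=
  addn #|[pred x | a x != 0]| #|[pred y | b y != 0]|.

Lemma supp_lt (a a' : X -> R) (b b' : Y -> R) :
  (forall x, a x = 0 -> a' x = 0) -> (forall y, b y = 0 -> b' y = 0) ->
  (exists2 x, a x != 0 & a' x = 0) \/ (exists2 y, b y != 0 & b' y = 0) ->
  (supp a' b' < supp a b)%N.
Proof.
move=> ha hb; have la : leq #|[pred x | a' x != 0]| #|[pred x | a x != 0]|.
  by apply/subset_leq_card/subsetP => x; rewrite !inE; apply: contra => /eqP/ha ->.
have lb : leq #|[pred x | b' x != 0]| #|[pred x | b x != 0]|.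
  by apply/subset_leq_card/subsetP => x; rewrite !inE; apply: contra => /eqP/hb ->.
case=> -[z z1 z2]; rewrite /supp.
  rewrite -addSn leq_add//; apply/proper_card/properP; split.
    by apply/subsetP => x; rewrite !inE; apply: contra => /eqP/ha ->.
  by exists z; rewrite !inE ?z2 ?eqxx.
rewrite -addnS leq_add//; apply/proper_card/properP; split.
  by apply/subsetP => x; rewrite !inE; apply: contra => /eqP/hb ->.
by exists z; rewrite !inE ?z2 ?eqxx.
Qed.

(* Induction on the number of vertices of nonzero weight: push as much mass as
   possible along one edge; either a vertex is exhausted, or Hall's condition
   becomes tight for some set, and the problem splits in two. *)
Theorem hall_transport a b :
  (forall x, 0 <= a x) -> (forall y, 0 <= b y) -> hall_cond a b -> transportable a b.
Proof.
have [n] := ubnP (supp a b); elim: n a b => // n IHn a b ltn a0 b0 hab.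
have [x ax|alla0] := pickP [pred x | a x != 0]; last first.
  exists (fun _ _ => 0); split=> // [x y|x|y]; first by rewrite eqxx.
    by rewrite big1//; have /negbFE/eqP := alla0 x.
  by rewrite big1.
have {ax} ax : 0 < a x by rewrite lt_def (ax : a x != 0) a0.
have [y xy by0] : exists2 y, r x y & 0 < b y.
  apply: contrapT => H; have := hab [set x]; rewrite big_set1 leNgt => /negP; apply.
  rewrite big1// => y; rewrite inE => /existsP[x' /andP[]]; rewrite inE => /eqP -> xy.
  by apply/eqP/negPn/negP => by0; apply: H; exists y; rewrite // lt_def by0 b0.
pose gap U := \sum_(y in nbhd U) b y - \sum_(x in U) a x.
(* Pushing mass along the edge from [x] to [y] lowers [gap U] only if [U] misses [x] while its
   neighbourhood contains [y]. *)
pose bad := [pred U : {set X} | (x \notin U) && (y \in nbhd U)].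
pose a' e x' := a x' - (x' == x)%:R * e; pose b' e y' := b y' - (y' == y)%:R * e.
have push e : 0 <= e -> e <= a x -> e <= b y -> (forall U, bad U -> e <= gap U) ->
    [/\ forall x', 0 <= a' e x', forall y', 0 <= b' e y' & hall_cond (a' e) (b' e)].
  move=> e0 ea eb eU; split=> [x'|y'|U]; rewrite /a' /b'.
  - by case: eqVneq => [->|_]; rewrite ?mul1r ?mul0r ?subr0 ?subr_ge0.
  - by case: eqVneq => [->|_]; rewrite ?mul1r ?mul0r ?subr0 ?subr_ge0.
  rewrite !sumrB !sum_point; have := hab U; have := eU U; rewrite /bad /gap /=.
  case: (boolP (x \in U)) => xU /=.
    suff -> : y \in nbhd U by move=> _ h; rewrite !mul1r; lra.
    by rewrite inE; apply/existsP; exists x; rewrite xU.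
  by case: (y \in nbhd U) => /= [/(_ isT) h1|_] h2; rewrite ?mul0r ?mul1r; lra.
have recombine e p : 0 <= e -> (forall x y, 0 <= p x y) ->
    (forall x y, p x y != 0 -> r x y) -> (forall x', \sum_y p x' y = a' e x') ->
    (forall y', \sum_x p x y' <= b' e y') -> transportable a b.
  move=> e0 p0 pr pa pb.
  exists (fun x' y' => p x' y' + (x' == x)%:R * ((y' == y)%:R * e)); split.
  - by move=> x' y'; rewrite addr_ge0 ?mulr_ge0 ?ler0n.
  - move=> x' y'; case: (eqVneq x' x) => [->|_]; last by rewrite mul0r addr0; apply: pr.
    case: (eqVneq y' y) => [->//|_]; rewrite mul0r mulr0 addr0; apply: pr.
  - move=> x'; rewrite big_split/= pa -mulr_sumr -mulr_suml.
    have -> : \sum_(i : Y) (i == y)%:R = 1 :> R.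
      by rewrite (bigD1 y)//= eqxx big1 ?addr0// => i /negbTE ->.
    by rewrite mul1r /a' subrK.
  - move=> y'; rewrite big_split/= -mulr_suml.
    have -> : \sum_(i : X) (i == x)%:R = 1 :> R.
      by rewrite (bigD1 x)//= eqxx big1 ?addr0// => i /negbTE ->.
    by have := pb y'; rewrite /b' mul1r lerBrDr.
pose e0 := Num.min (a x) (b y).
have [e0a e0b] : e0 <= a x /\ e0 <= b y by rewrite /e0 !ge_min !lexx orbT.
have e0_gt0 : 0 < e0 by rewrite /e0 lt_min ax.
(* If no slack is exhausted before [x] or [y] is, the full push removes one of them from the
   support. *)
have [/forallP big_gap|] := boolP [forall U, bad U ==> (e0 <= gap U)].
  have [a'0 b'0 h'] := push e0 (ltW e0_gt0) e0a e0b (fun U => implyP (big_gap U)).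
  have [|p [p0 pr pa pb]] := IHn (a' e0) (b' e0) _ a'0 b'0 h'; last exact: (recombine e0 p (ltW e0_gt0)).
  apply: (@leq_trans (supp a b)) => //; apply: supp_lt => [x' ax'|y' by'|].
  - by rewrite /a' ax'; case: eqVneq ax ax' => [->|_ _ _]; [lra|rewrite mul0r subr0].
  - by rewrite /b' by'; case: eqVneq by0 by' => [->|_ _ _]; [lra|rewrite mul0r subr0].
  have : e0 = a x \/ e0 = b y by rewrite /e0; case: leP; [left|right].
  case=> e0E; [left; exists x|right; exists y]; rewrite ?gt_eqF// /a' /b' eqxx mul1r e0E; ring.
(* Otherwise a bad set [U] of least slack becomes tight after a push of [gap U]. The problem splits
   into [U] with its neighbourhood, where [x] is missing, and the two complements, where [y] is
   missing. *)
rewrite negb_forall => /existsP[U0]; rewrite negb_imply -ltNge => /andP[badU0 gapU0].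
have [U badU minU] := arg_minP gap badU0.
have gapU : gap U < e0 by apply: le_lt_trans gapU0; apply: minU.
have gapU_ge0 : 0 <= gap U by rewrite subr_ge0 hab.
have ga : gap U <= a x by apply: ltW; apply: lt_le_trans gapU e0a.
have gb : gap U <= b y by apply: ltW; apply: lt_le_trans gapU e0b.
have [a'0 b'0 h'] := push _ gapU_ge0 ga gb minU.
move: (badU) => /andP[xU yU].
have tight : \sum_(y in nbhd U) b' (gap U) y = \sum_(x in U) a' (gap U) x.
  by rewrite !sumrB !sum_point (negbTE xU) yU /= /gap; ring.
set e := gap U in gapU_ge0 ga gb a'0 b'0 h' tight.
have ltx0 : a x != 0 by rewrite gt_eqF.
have lty0 : b y != 0 by rewrite gt_eqF.
have za x' : a x' = 0 -> a' e x' = 0.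
  by rewrite /a'; case: (eqVneq x' x) => [->/eqP|_ ->]; [rewrite (negbTE ltx0)|rewrite mul0r subr0].
have zb y' : b y' = 0 -> b' e y' = 0.
  by rewrite /b'; case: (eqVneq y' y) => [->/eqP|_ ->]; [rewrite (negbTE lty0)|rewrite mul0r subr0].
have [||||p1 [p10 p1r p1a p1b]] := IHn (fun x => (x \in U)%:R * a' e x) (fun y => (y \in nbhd U)%:R * b' e y).
- apply: (@leq_trans (supp a b)) => //; apply: supp_lt => [x' /za ->|y' /zb ->|]; rewrite ?mulr0//.
  by left; exists x; rewrite // (negbTE xU) mul0r.
- by move=> x'; rewrite mulr_ge0 ?ler0n.
- by move=> y'; rewrite mulr_ge0 ?ler0n.
- move=> T; rewrite !sum_restrict; apply: le_trans (h' _) _; apply: sum_subset_le => //.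
  by rewrite subsetI !nbhd_sub ?subsetIl ?subsetIr.
have [||||p2 [p20 p2r p2a p2b]] := IHn (fun x => (x \in ~: U)%:R * a' e x) (fun y => (y \in ~: nbhd U)%:R * b' e y).
- apply: (@leq_trans (supp a b)) => //; apply: supp_lt => [x' /za ->|y' /zb ->|]; rewrite ?mulr0//.
  by right; exists y; rewrite // inE yU mul0r.
- by move=> x'; rewrite mulr_ge0 ?ler0n.
- by move=> y'; rewrite mulr_ge0 ?ler0n.
(* Hall's condition on the complements is the one for [T :|: U] minus the equality that holds for
   [U]. *)
- move=> T; rewrite !sum_restrict -!setDE; have := h' (T :|: U).
  have splitU (Z : finType) (A B : {set Z}) (f : Z -> R) :
      \sum_(z in A :|: B) f z = \sum_(z in B) f z + \sum_(z in A :\: B) f z.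
    rewrite (big_setID B)/=; congr (_ + _); apply: eq_bigl => z; rewrite !inE.
      by case: (z \in A); case: (z \in B).
    by case: (z \in A); case: (z \in B).
  by rewrite nbhdU !splitU tight lerD2l.
apply: (recombine e (fun x y => p1 x y + p2 x y)) => // [x' y'|x' y'|x'|y'].
- by rewrite addr_ge0.
- by rewrite paddr_eq0// negb_and => /orP[/p1r|/p2r].
- by rewrite big_split /= p1a p2a inE; case: (x' \in U); rewrite /= ?mul1r ?mul0r ?addr0 ?add0r.
- rewrite big_split /=; apply: le_trans (lerD (p1b y') (p2b y')) _.
  by rewrite in_setC; case: (y' \in _); rewrite /= ?mul1r ?mul0r ?addr0 ?add0r.
Qed.

End Transport.

(** Inclusion is transitive, so the neighbourhood of [U] is an up-set, and it contains [U]; the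
    domination of its complement, a down-set, gives Hall's condition. *)
Theorem finite_strassen (R : realFieldType) (F : finType) (a b : {set F} -> R) :
  (forall S, 0 <= a S) -> (forall S, 0 <= b S) ->
  \sum_S a S = \sum_S b S ->
  (forall D : pred {set F}, (forall S T : {set F}, S \subset T -> D T -> D S) ->
    \sum_(S | D S) b S <= \sum_(S | D S) a S) ->
  exists p : {set F} -> {set F} -> R, [/\ forall S T, 0 <= p S T,
    forall S T : {set F}, p S T != 0 -> S \subset T,
    forall S, \sum_T p S T = a S & forall T, \sum_S p S T = b T].
Proof.
move=> a0 b0 ab dom.
have [//|//||p [p0 pr pa pb]] := @hall_transport R _ _ (fun S T : {set F} => S \subset T) a b.
  move=> U; set N := nbhd _ U.
  have sub : U \subset N.
    by apply/subsetP => S SU; rewrite inE; apply/existsP; exists S; rewrite SU subxx.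
  apply: le_trans (sum_subset_le a0 sub) _.
  have := dom (fun S => S \notin N).
  have split (f : {set F} -> R) : \sum_S f S = \sum_(S in N) f S + \sum_(S | S \notin N) f S.
    by rewrite (bigID (mem N)).
  move: ab; rewrite !split => ab H.
  suff down : forall S T : {set F}, S \subset T -> T \notin N -> S \notin N by have := H down; lra.
  move=> S T ST; apply: contra; rewrite !inE => /existsP[V /andP[VU VS]].
  by apply/existsP; exists V; rewrite VU (subset_trans VS).
exists p; split=> // T; apply/eqP; move: T; apply/forallP.
have : \sum_T (b T - \sum_S p S T) == 0.
  by rewrite sumrB [X in _ - X]exchange_big/= [X in _ - X](eq_bigr a)// ab subrr.
rewrite psumr_eq0 => [/allP H|T _]; last by rewrite subr_ge0.
by apply/forallP => T; rewrite eq_sym -subr_eq0; have /implyP := H T (mem_index_enum T); apply.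
Qed.

(** * Cayley transform *)

Section CayleyTransform.
Variable C : numClosedFieldType.

Local Notation adj M := (map_mx Num.conj M^T).

Lemma adjM m n p (M : 'M[C]_(m, n)) (N : 'M_(n, p)) : adj (M *m N) = adj N *m adj M.
Proof. by rewrite trmx_mul map_mxM. Qed.

Lemma adjK m n (M : 'M[C]_(m, n)) : adj (adj M) = M.
Proof. by apply/matrixP => i j; rewrite !mxE conjCK. Qed.

Definition sqn n (v : 'cV[C]_n) : C := \sum_i `|v i 0| ^+ 2.

Lemma sqnE n (v : 'cV[C]_n) : sqn v = (adj v *m v) 0 0.
Proof. by rewrite mxE; apply: eq_bigr => i _; rewrite !mxE normCK mulrC. Qed.

Lemma sqn_ge0 n (v : 'cV[C]_n) : 0 <= sqn v.
Proof. by apply: sumr_ge0 => i _; rewrite exprn_ge0. Qed.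

Lemma sqn_eq0 n (v : 'cV[C]_n) : sqn v = 0 -> v = 0.
Proof.
move=> /eqP; rewrite psumr_eq0 => [/allP H|i _]; last by rewrite exprn_ge0.
apply/colP => i; rewrite mxE; apply/eqP.
by have := H i (mem_index_enum i); rewrite expf_eq0 normr_eq0.
Qed.

Lemma normB_sq_le (a b : C) : `|a - b| ^+ 2 <= 2 * `|a| ^+ 2 + 2 * `|b| ^+ 2.
Proof.
have -> : 2 * `|a| ^+ 2 + 2 * `|b| ^+ 2 = `|a - b| ^+ 2 + `|a + b| ^+ 2.
  by rewrite !normCK !rmorphB !rmorphD /=; ring.
by rewrite lerDl exprn_ge0.
Qed.

Section Skew.
Variables (n : nat) (Y : 'M[C]_n).
Hypothesis skewY : adj Y = - Y.

(** Because (1 + Y)(1 - Y) = 1 - Y^2, and -Y^2 is the Gram matrix of [Y]. Hence 1 - Y is injective,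
    and its inverse and [Y] times its inverse are contractions. *)
Lemma sqn_skew (v : 'cV_n) : sqn ((1%:M - Y) *m v) = sqn v + sqn (Y *m v).
Proof.
rewrite !sqnE adjM -!mulmxA [adj (Y *m v)]adjM skewY.
have -> : adj (1%:M - Y) = 1%:M + Y.
  by rewrite linearB map_mxB/= trmx1 map_mx1 skewY opprK.
rewrite mulmxBl mul1mx !mulmxDl !mul1mx !mulmxDr !mulmxN ?mulNmx !mulmxA.
by rewrite addrA subrK mxE.
Qed.

Lemma skew_unit : (1%:M - Y) \in unitmx.
Proof.
rewrite -unitmx_tr -row_free_unit; apply: inj_row_free => v vA.
have Av : (1%:M - Y) *m v^T = 0 by apply: trmx_inj; rewrite trmx_mul trmxK vA trmx0.
have := sqn_skew v^T; rewrite Av {1}/sqn big1; last by move=> i _; rewrite mxE normr0 expr0n.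
move=> /esym/eqP; rewrite paddr_eq0 ?sqn_ge0// => /andP[/eqP/sqn_eq0 v0 _].
by rewrite -[v]trmxK v0 trmx0.
Qed.

End Skew.

(* [U] is the Cayley transform (1 + Y)(1 - Y)^-1. The last hypothesis says
   (1 + Y^2) e = t - Y z, so [Y e] is close to [U e] when [t] and [z] are small. *)
Lemma cayley_transform (F : finType) (y : F -> F -> C) :
  (forall a b, y a b = - (y b a)^*) ->
  exists U : F -> F -> C, [/\
    forall a b, \sum_c U a c * (U b c)^* = (a == b)%:R,
    forall a b, \sum_c (U c a)^* * U c b = (a == b)%:R &
    forall e (t z : F -> C),
      (forall a, (a == e)%:R + \sum_b y a b * y b e = t a - \sum_b y a b * z b) ->
      \sum_a `|U a e - y a e| ^+ 2 <=
      2 * (\sum_a `|t a| ^+ 2) + 2 * (\sum_a `|z a| ^+ 2)].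
Proof.
move=> skewy; pose n := #|F|.
pose mx (f : F -> F -> C) : 'M[C]_n := \matrix_(i, j) f (enum_val i) (enum_val j).
pose cv (f : F -> C) : 'cV[C]_n := \col_i f (enum_val i).
have sumF (f : F -> C) : \sum_a f a = \sum_(i < n) f (enum_val i).
  by rewrite (reindex (@enum_val F predT)) //=; apply: onW_bij; apply: enum_val_bij.
pose Y := mx y.
have skewY : adj Y = - Y.
  by apply/matrixP => i j; rewrite !mxE [y (enum_val i) _]skewy opprK.
have Au := skew_unit skewY.
pose A := 1%:M - Y; pose B := 1%:M + Y.
have AB : A *m B = B *m A.
  rewrite /B mulmxDr mulmx1 mulmxDl mul1mx; congr (_ + _).
  by rewrite /A mulmxBl mul1mx mulmxBr mulmx1.
have adjA : adj A = B by rewrite linearB map_mxB/= trmx1 map_mx1 skewY opprK.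
have adjB : adj B = A by rewrite -adjA adjK.
have AY : A *m Y = Y *m A by rewrite /A mulmxBl mul1mx mulmxBr mulmx1.
have Bu : B \in unitmx by rewrite -adjA map_unitmx unitmx_tr.
pose U := invmx A *m B.
have UE : U = B *m invmx A.
  by rewrite /U -[RHS]mul1mx -(mulVmx Au) -!mulmxA [A *m (B *m _)]mulmxA AB -mulmxA mulmxV// mulmx1.
have adj_inv : adj (invmx A) = invmx B by rewrite trmx_inv map_invmx/= adjA.
have adjU : adj U = invmx B *m A.
  by rewrite UE adjM adj_inv adjB.
have UU : U *m adj U = 1%:M.
  by rewrite adjU /U mulmxA -(mulmxA (invmx A)) mulmxV// mulmx1 mulVmx.
have VU : adj U *m U = 1%:M by apply: mulmx1C.
exists (fun a b => U (enum_rank a) (enum_rank b)); split=> [a b|a b|e t z H].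
- have := congr1 (fun M : 'M_n => M (enum_rank a) (enum_rank b)) UU.
  rewrite !mxE (inj_eq enum_rank_inj) => <-; rewrite sumF; apply: eq_bigr => i _.
  by rewrite !mxE enum_valK.
- have := congr1 (fun M : 'M_n => M (enum_rank a) (enum_rank b)) VU.
  rewrite !mxE (inj_eq enum_rank_inj) => <-; rewrite sumF; apply: eq_bigr => i _.
  by rewrite !mxE enum_valK.
pose E : 'cV[C]_n := cv (fun a => (a == e)%:R).
have colE (M : 'M[C]_n) i : (M *m E) i 0 = M i (enum_rank e).
  rewrite mxE (bigD1 (enum_rank e))//= big1 ?addr0 => [|j /negbTE je].
    by rewrite mxE enum_rankK eqxx mulr1.
  by rewrite mxE -(inj_eq enum_rank_inj) enum_valK je mulr0.
have HE : E + Y *m (Y *m E) = cv t - Y *m cv z.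
  apply/colP => i; have := H (enum_val i).
  have mulY (f : F -> C) (v : 'cV[C]_n) : v = cv f ->
      (Y *m v) i 0 = \sum_b y (enum_val i) b * f b.
    by move=> ->; rewrite mxE sumF; apply: eq_bigr => j _; rewrite !mxE.
  rewrite !mxE -[\sum_b y _ b * y b e](mulY _ (Y *m E)); last first.
    by apply/colP => j; rewrite colE !mxE enum_rankK.
  by rewrite -[\sum_b _ * z b](mulY _ (cv z))// !mxE.
(* With [A] = 1 - Y one has U - Y = A^-1 (1 + Y^2), and the hypothesis rewrites (1 + Y^2) E;
   [sqn_skew] then bounds the two terms. *)
have key : U *m E - Y *m E = invmx A *m cv t - Y *m (invmx A *m cv z).
  have AiY : Y *m invmx A = invmx A *m Y.
    by rewrite -[LHS]mul1mx -(mulVmx Au) -!mulmxA [A *m (Y *m _)]mulmxA AY -mulmxA mulmxV// mulmx1.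
  rewrite [Y *m (_ *m _)]mulmxA AiY -(mulmxA (invmx A) Y) -mulmxBr -HE /U -mulmxA.
  rewrite -[X in _ - X = _](mulKmx Au) -mulmxBr; congr (_ *m _).
  rewrite /A /B mulmxDl mul1mx mulmxBl mul1mx opprB addrA.
  by rewrite [E + _ + _]addrAC addrK.
have le1 (v : 'cV[C]_n) : sqn v <= sqn (A *m v) /\ sqn (Y *m v) <= sqn (A *m v).
  by rewrite (sqn_skew skewY) lerDl lerDr !sqn_ge0.
have sqncv (f : F -> C) : \sum_a `|f a| ^+ 2 = sqn (cv f).
  by rewrite sumF; apply: eq_bigr => i _; rewrite mxE.
rewrite !sqncv; apply: (@le_trans _ _ (2 * sqn (invmx A *m cv t) + 2 * sqn (Y *m (invmx A *m cv z)))).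
  rewrite /sqn !mulr_sumr -big_split /=; apply: ler_sum => i _.
  apply: le_trans (normB_sq_le _ _); have := congr1 (fun v : 'cV_n => v i 0) key.
  have subE (p q : 'cV[C]_n) : (p - q) i 0 = p i 0 - q i 0 by rewrite !mxE.
  by rewrite !subE !colE [cv _ i 0]mxE enum_valK [Y i _]mxE enum_rankK => ->.
rewrite lerD// ler_pM2l ?ltr0n//.
  by have [+ _] := le1 (invmx A *m cv t); rewrite mulmxA mulmxV// mul1mx.
by have [_] := le1 (invmx A *m cv z); rewrite [X in _ <= sqn X]mulmxA mulmxV// mul1mx.
Qed.
End CayleyTransform.

(** * Coupling of nested determinantal processes on a finite set *)

Local Open Scope complex_scope.

(** The squared modulus as an element of [R], so that estimates take place in a totally ordered
    field and involve no square root. *)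
Definition csq (R : rcfType) (z : R[i]) : R := complex.Re z ^+ 2 + complex.Im z ^+ 2.

Lemma csqE (R : rcfType) (z : R[i]) : (csq z)%:C = `|z| ^+ 2.
Proof. exact: add_Re2_Im2. Qed.

Lemma csq_ge0 (R : rcfType) (z : R[i]) : 0 <= csq z.
Proof. by rewrite addr_ge0 ?sqr_ge0. Qed.

Lemma conjcE (R : rcfType) (z : R[i]) : z^*%R = conjc z.
Proof. by []. Qed.

Lemma sum_csqE (R : rcfType) (I : finType) (P : pred I) (f : I -> R[i]) :
  (\sum_(i | P i) csq (f i))%:C = \sum_(i | P i) `|f i| ^+ 2.
Proof. by rewrite rmorph_sum; apply: eq_bigr => i _; rewrite /= csqE. Qed.

(** The Slater state of the rows in [K2] arises from that of the rows in [K1] by further creations,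
    so its law gives less mass to every down-set and Strassen's theorem applies. *)
Lemma determinantal_coupling (R : rcfType) (F : finType) (U : F -> F -> R[i]) (K1 K2 : pred F) :
  (forall a b, \sum_c U a c * (U b c)^*%R = (a == b)%:R) ->
  (forall x, K1 x -> K2 x) ->
  exists p : {set F} -> {set F} -> R, [/\ forall S T, 0 <= p S T,
    forall S T : {set F}, p S T != 0 -> S \subset T, \sum_S \sum_T p S T = 1,
    forall m (g : 'I_m -> F), injective g ->
      (\sum_(S : {set F} | [forall i, g i \in S]) \sum_T p S T)%:C =
      \det (\matrix_(i, j) \sum_(l | K1 l) (U l (g i))^*%R * U l (g j)) &
    forall m (g : 'I_m -> F), injective g ->
      (\sum_(T : {set F} | [forall i, g i \in T]) \sum_S p S T)%:C =
      \det (\matrix_(i, j) \sum_(l | K2 l) (U l (g i))^*%R * U l (g j))].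
Proof.
move=> orthU K12.
(* Conjugated rows, because [gram] conjugates its second factor and the kernel of the statement its
   first. *)
pose b i e := (U i e)^*%R.
have orthb i j : \sum_e (b i e)^*%R * b j e = (i == j)%:R.
  by rewrite -orthU; apply: eq_bigr => e _; rewrite /b conjCK.
pose s := enum K1; pose t := enum [pred x | K2 x && ~~ K1 x].
have us : uniq s by apply: enum_uniq.
have uts : uniq (t ++ s).
  rewrite cat_uniq !enum_uniq andbT/=; apply/hasPn => x.
  by rewrite [x \in s]mem_enum [x \in t]mem_enum inE /= => xK; rewrite negb_and negbK [K1 x]xK orbT.
have gramE r (P : pred F) e f : uniq r -> r =i P ->
    gram b r e f = \sum_(l | P l) (U l e)^*%R * U l f.
  move=> ur rP; rewrite /gram (big_uniq _ ur)/=.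
  by apply: eq_big => [x|x _]; [rewrite rP|rewrite /b conjCK].
have sK1 : s =i K1 by move=> x; rewrite mem_enum.
have tsK2 : t ++ s =i K2.
  move=> x; rewrite mem_cat !mem_enum !inE -!topredE /=.
  by case k1: (K1 x); rewrite ?orbT ?(K12 _ k1)// andbT orbF.
have incl r (P : pred F) m (g : 'I_m -> F) : uniq r -> r =i P -> injective g ->
    (\sum_(S : {set F} | [forall i, g i \in S]) csq (slater b r S))%:C =
    \det (\matrix_(i, j) \sum_(l | P l) (U l (g i))^*%R * U l (g j)).
  move=> ur rP gi; rewrite sum_csqE slater_inclusion//.
  by congr (\det _); apply/matrixP => i j; rewrite !mxE (gramE _ P).
have one r : uniq r -> \sum_(S : {set F}) csq (slater b r S) = 1.
  by move=> ur; apply: complexI; rewrite sum_csqE slater_sum.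
have [|||D downD|p [p0 psub pa pb]] := @finite_strassen R F (fun S => csq (slater b s S))
    (fun S => csq (slater b (t ++ s) S)).
- by move=> S; apply: csq_ge0.
- by move=> S; apply: csq_ge0.
- by rewrite !one.
- by rewrite -lecR !sum_csqE; apply: slater_downset.
exists p; split=> //.
- by rewrite -(one s us); apply: eq_bigr => S _; rewrite pa.
- move=> m g gi; rewrite -(incl s K1)//; congr (_%:C).
  by apply: eq_bigr => S _; rewrite pa.
- move=> m g gi; rewrite -(incl (t ++ s) K2)//; congr (_%:C).
  by apply: eq_bigr => S _; rewrite pb.
Qed.

(** * Sums of square-summable families *)

From mathcomp Require Import finmap fingroup perm.
From mathcomp Require Import all_classical all_reals all_analysis.

Import Order.TTheory GRing.Theory Num.Theory.
Import numFieldNormedType.Exports.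
Import Normc.

Local Open Scope classical_set_scope.
Local Open Scope complex_scope.
Local Open Scope ring_scope.

Section SignedSums.
Variables (R : realType) (X : choiceType).
Implicit Types f g p q : X -> R.

Definition asum f := (\esum_(x in [set: X]) `|f x|%:E < +oo)%E.

Definition psum f : R := fine (\esum_(x in [set: X]) (f x)%:E).

Lemma esum_EFin_ge0 p : (forall x, 0 <= p x) -> (0 <= \esum_(x in [set: X]) (p x)%:E)%E.
Proof. by move=> p0; apply: esum_ge0 => x _; rewrite lee_fin. Qed.

Lemma asum_le f p : (forall x, `|f x| <= p x) ->
  (\esum_(x in [set: X]) (p x)%:E < +oo)%E -> asum f.
Proof. by move=> fp; apply: le_lt_trans; apply: le_esum => x _; rewrite lee_fin. Qed.

Lemma psumE p : (forall x, 0 <= p x) -> asum p ->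
  (psum p)%:E = \esum_(x in [set: X]) (p x)%:E.
Proof.
move=> p0 sp; rewrite fineK// ge0_fin_numE ?esum_EFin_ge0//.
by move: sp; rewrite /asum; under eq_esum do rewrite ger0_norm//.
Qed.

Lemma psumD p q : (forall x, 0 <= p x) -> (forall x, 0 <= q x) -> asum p -> asum q ->
  psum (fun x => p x + q x) = psum p + psum q.
Proof.
move=> p0 q0 sp sq; rewrite /psum; under eq_esum do rewrite EFinD.
rewrite esumD; [|by move=> x _; rewrite lee_fin..].
by rewrite -!psumE.
Qed.

Lemma asumD f g : asum f -> asum g -> asum (fun x => f x + g x).
Proof.
move=> sf sg; apply: (asum_le (p := fun x => `|f x| + `|g x|)); first by move=> x; rewrite ler_normD.
under eq_esum do rewrite EFinD.
by rewrite esumD ?lte_add_pinfty// => x _; rewrite lee_fin.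
Qed.

Lemma eq_asum f g : (forall x, `|f x| = `|g x|) -> asum f -> asum g.
Proof. by move=> fg; rewrite /asum; under eq_esum do rewrite fg. Qed.

Lemma esumZ (c : R) p : 0 < c -> (forall x, 0 <= p x) ->
  (\esum_(x in [set: X]) (c * p x)%:E = c%:E * \esum_(x in [set: X]) (p x)%:E)%E.
Proof.
move=> c0 p0.
have le (d : R) (r : X -> R) : 0 < d -> (forall x, 0 <= r x) ->
    (\esum_(x in [set: X]) (d * r x)%:E <= d%:E * \esum_(x in [set: X]) (r x)%:E)%E.
  move=> d0 r0; apply: ub_ereal_sup => _ [A [finA _] <-].
  rewrite fsbig_finite//=; under eq_bigr do rewrite EFinM.
  rewrite -ge0_sume_distrr => [|x _]; last by rewrite lee_fin.
  rewrite lee_pmul2l//.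
  by apply: esum_ge; exists A => //; rewrite fsbig_finite.
apply/eqP; rewrite eq_le le//= -(@lee_pmul2l _ (c^-1)%:E) ?lte_fin ?invr_gt0//.
rewrite muleA -EFinM mulVf ?gt_eqF// mul1e.
apply: le_trans _ (le c^-1 (fun x => c * p x) _ _); last 2 first.
- by rewrite invr_gt0.
- by move=> x; rewrite mulr_ge0// ltW.
by apply: le_esum => x _; rewrite mulrA mulVf ?gt_eqF// mul1r.
Qed.

Lemma asumZ c f : asum f -> asum (fun x => c * f x).
Proof.
have [->|c0] := eqVneq c 0.
  by move=> _; rewrite /asum esum1 ?ltry// => x _; rewrite mul0r normr0.
move=> sf; apply: (asum_le (p := fun x => `|c| * `|f x|)); first by move=> x; rewrite normrM.
by rewrite esumZ ?normr_gt0// lte_mul_pinfty// lee_fin.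
Qed.

Lemma psumZ c p : 0 <= c -> (forall x, 0 <= p x) -> asum p ->
  psum (fun x => c * p x) = c * psum p.
Proof.
rewrite le_eqVlt => /predU1P[<- p0 _|c0 p0 sp].
  by rewrite /psum mul0r esum1// => x _; rewrite mul0r.
by rewrite /psum esumZ// -psumE.
Qed.

Lemma psum_ge0 p : (forall x, 0 <= p x) -> 0 <= psum p.
Proof. by move=> p0; apply/fine_ge0/esum_EFin_ge0. Qed.

(** Any decomposition into summable nonnegative parts computes [rsum], since p - q = f+ - f- can be
    rearranged into the equality f+ + q = f- + p of nonnegative functions. Linearity follows by
    choosing convenient parts. *)
Lemma rsumE f p q : (forall x, f x = p x - q x) ->
  (forall x, 0 <= p x) -> (forall x, 0 <= q x) -> asum p -> asum q ->
  rsum f = psum p - psum q.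
Proof.
move=> fpq p0 q0 sp sq.
pose fp x := Num.max (f x) 0; pose fn x := Num.max (- f x) 0.
have fp0 x : 0 <= fp x by rewrite le_max lexx orbT.
have fn0 x : 0 <= fn x by rewrite le_max lexx orbT.
have sfp : asum fp.
  apply: (asum_le (p := p)) => [x|]; last by rewrite -psumE// ltry.
  by rewrite ger0_norm// ge_max p0 fpq gerBl q0.
have sfn : asum fn.
  apply: (asum_le (p := q)) => [x|]; last by rewrite -psumE// ltry.
  by rewrite ger0_norm// ge_max q0 fpq opprB gerBl p0.
have -> : rsum f = psum fp - psum fn.
  rewrite /rsum (_ : \esum_(x in _) _ = (psum fp)%:E); last first.
    by rewrite psumE//; apply: eq_esum => x _; rewrite funeposE EFin_max.
  rewrite (_ : (esum [set: X] (EFin \o f)^\-)%E = (psum fn)%:E) //.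
  by rewrite psumE//; apply: eq_esum => x _; rewrite funenegE EFin_max.
have : psum fp + psum q = psum fn + psum p.
  rewrite -!psumD//; congr psum; apply/funext => x.
  rewrite /fp /fn fpq; case: (leP (p x - q x) 0) => h.
    by rewrite max_l; lra.
  by rewrite max_r; lra.
by lra.
Qed.

Lemma rsum_decomp f : asum f -> exists pq : (X -> R) * (X -> R),
  [/\ forall x, f x = pq.1 x - pq.2 x, forall x, 0 <= pq.1 x,
      forall x, 0 <= pq.2 x, asum pq.1 & asum pq.2].
Proof.
move=> sf; exists (fun x => Num.max (f x) 0, fun x => Num.max (- f x) 0) => /=.
have le (g : X -> R) : (forall x, `|g x| = `|f x|) -> asum (fun x => Num.max (g x) 0).
  move=> gf; apply: (asum_le (p := fun x => `|f x|)) => // x.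
  by rewrite -gf ger0_norm ?le_max ?lexx ?orbT// ge_max ler_norm normr_ge0.
split.
- move=> x; case: (leP (f x) 0) => h; first by rewrite max_l; lra.
  by rewrite max_r; lra.
- by move=> x; rewrite le_max lexx orbT.
- by move=> x; rewrite le_max lexx orbT.
- exact: le.
- by apply: le => x; rewrite normrN.
Qed.

Lemma rsumD f g : asum f -> asum g -> rsum (fun x => f x + g x) = rsum f + rsum g.
Proof.
move=> /rsum_decomp[[p q] /= [fE p0 q0 sp sq]] /rsum_decomp[[p' q'] /= [gE p'0 q'0 sp' sq']].
rewrite (rsumE fE)// (rsumE gE)//.
rewrite (@rsumE _ (fun x => p x + p' x) (fun x => q x + q' x)).
- by rewrite !psumD//; ring.
- by move=> x; rewrite fE gE; ring.
- by move=> x; rewrite addr_ge0.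
- by move=> x; rewrite addr_ge0.
- exact: asumD.
- exact: asumD.
Qed.

Lemma rsumN f : asum f -> rsum (fun x => - f x) = - rsum f.
Proof.
move=> /rsum_decomp[[p q] /= [fE p0 q0 sp sq]].
by rewrite (rsumE fE)// (@rsumE _ q p)// ?opprB// => x; rewrite fE opprB.
Qed.

Lemma rsumZ c f : asum f -> rsum (fun x => c * f x) = c * rsum f.
Proof.
wlog c0 : c / 0 <= c => [H sf|].
  have [|c0] := leP 0 c; first by move=> /H; exact.
  transitivity (rsum (fun x => - (- c * f x))).
    by congr rsum; apply/funext => x; rewrite mulNr opprK.
  by rewrite rsumN ?H ?mulNr ?opprK// ?oppr_ge0 ?ltW//; apply: asumZ.
move=> /rsum_decomp[[p q] /= [fE p0 q0 sp sq]].
rewrite (rsumE fE)// (@rsumE _ (fun x => c * p x) (fun x => c * q x)).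
- by rewrite !psumZ// mulrBr.
- by move=> x; rewrite fE mulrBr.
- by move=> x; rewrite mulr_ge0.
- by move=> x; rewrite mulr_ge0.
- exact: asumZ.
- exact: asumZ.
Qed.

Lemma rsum_ge0 p : (forall x, 0 <= p x) -> asum p -> rsum p = psum p.
Proof.
move=> p0 sp; rewrite (@rsumE _ p (fun=> 0))// => [|x|]; last 2 first.
- by rewrite subr0.
- by rewrite /asum esum1 ?ltry// => x _; rewrite normr0.
by rewrite [X in _ - X](_ : _ = 0) ?subr0// /psum esum1.
Qed.

Lemma esum_point (z : X) f : (forall x, x != z -> f x = 0) -> 0 <= f z ->
  (\esum_(x in [set: X]) (f x)%:E)%E = (f z)%:E.
Proof.
move=> fz z0; rewrite (esumID [set z]) => [|x _]; last first.
  by have [->|/fz ->] := eqVneq x z; rewrite lee_fin.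
rewrite setTI esum_set1 ?lee_fin// esum1 ?adde0// => x [_ xz].
by rewrite fz//; apply/eqP.
Qed.

Lemma rsum_point (z : X) f : (forall x, x != z -> f x = 0) -> rsum f = f z.
Proof.
move=> fz.
have pt (g : X -> R) : (forall x, x != z -> g x = 0) -> 0 <= g z -> asum g /\ psum g = g z.
  move=> gz z0; rewrite /asum /psum (@esum_point z g)// (@esum_point z (fun x => `|g x|))//.
    by rewrite ltry.
  by move=> x /gz ->; rewrite normr0.
have [||s1 e1] := pt (fun x => Num.max (f x) 0).
- by move=> x /fz ->; rewrite maxxx.
- by rewrite le_max lexx orbT.
have [||s2 e2] := pt (fun x => Num.max (- f x) 0).
- by move=> x /fz ->; rewrite oppr0 maxxx.
- by rewrite le_max lexx orbT.
rewrite (@rsumE _ _ _ _ _ _ s1 s2).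
- rewrite e1 e2; case: (leP (f z) 0) => h; first by rewrite max_l; lra.
  by rewrite max_r; lra.
- move=> x; case: (leP (f x) 0) => h; first by rewrite max_l; lra.
  by rewrite max_r; lra.
- by move=> x; rewrite le_max lexx orbT.
- by move=> x; rewrite le_max lexx orbT.
Qed.

Lemma rsum_reindex (s : X -> X) f : bijective s -> rsum (fun x => f (s x)) = rsum f.
Proof.
move=> bs; have H (g : X -> \bar R) : (forall x, 0 <= g x)%E ->
    (\esum_(x in [set: X]) g (s x) = \esum_(x in [set: X]) g x)%E.
  by move=> g0; rewrite [RHS](@reindex_esum R X X setT setT s)//; rewrite setTT_bijective.
rewrite /rsum; congr (fine (_ - _)%E); rewrite -[RHS]H.
- by apply: eq_esum => x _; rewrite !funeposE.
- exact: funepos_ge0.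
- by apply: eq_esum => x _; rewrite !funenegE.
- exact: funeneg_ge0.
Qed.

Lemma psum_uniq_le (s : seq X) p : uniq s -> (forall x, 0 <= p x) -> asum p ->
  \sum_(x <- s) p x <= psum p.
Proof.
move=> us p0 sp; rewrite -lee_fin psumE// -sumEFin; apply: esum_ge.
by exists [set` s]; [split; [exact: finite_seq|]|rewrite -fsbig_seq].
Qed.

Lemma psum_approx p (e : R) : (forall x, 0 <= p x) -> asum p -> 0 < e ->
  exists2 s : seq X, uniq s & psum p - e <= \sum_(x <- s) p x.
Proof.
move=> p0 sp e0.
have : ((psum p - e)%:E < \esum_(x in [set: X]) (p x)%:E)%E.
  by rewrite -psumE// lte_fin ltrBlDr ltrDl.
move=> /ereal_sup_gt[_ [A [finA _] <-]] /ltW.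
rewrite fsbig_finite// sumEFin lee_fin => h; exists (fset_set A) => //.
Qed.

End SignedSums.

Section ComplexFacts.
Variable R : rcfType.
Implicit Types a b z : R[i].

Lemma normc_sq z : normc z ^+ 2 = csq z.
Proof. by case: z => a b; rewrite /csq /= sqr_sqrtr ?addr_ge0 ?sqr_ge0. Qed.

Lemma csqM a b : csq (a * b) = csq a * csq b.
Proof. by case: a b => [a1 a2] [b1 b2]; rewrite /csq /=; ring. Qed.

Lemma csqJ a : csq (conjc a) = csq a.
Proof. by case: a => a1 a2; rewrite /csq /=; ring. Qed.

Lemma csqN a : csq (- a) = csq a.
Proof. by case: a => a1 a2; rewrite /csq /=; ring. Qed.

Lemma conjcD a b : conjc (a + b) = conjc a + conjc b. Proof. exact: rmorphD. Qed.
Lemma conjcB a b : conjc (a - b) = conjc a - conjc b. Proof. exact: rmorphB. Qed.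
Lemma conjcM a b : conjc (a * b) = conjc a * conjc b. Proof. exact: rmorphM. Qed.
Lemma conjc_sum (I : Type) (r : seq I) (P : pred I) (F : I -> R[i]) :
  conjc (\sum_(i <- r | P i) F i) = \sum_(i <- r | P i) conjc (F i).
Proof. exact: rmorph_sum. Qed.

Lemma csq0 : csq (0 : R[i]) = 0.
Proof. by rewrite /csq /= expr0n addr0. Qed.

Lemma csqD_le a b : csq (a + b) <= 2 * csq a + 2 * csq b.
Proof.
case: a b => [a1 a2] [b1 b2]; rewrite /csq /= -subr_ge0.
rewrite (_ : _ - _ = (a1 - b1) ^+ 2 + (a2 - b2) ^+ 2); last by ring.
by rewrite addr_ge0 ?sqr_ge0.
Qed.

Lemma csq_conjE z : (csq z)%:C = z * conjc z.
Proof. by case: z => a b; rewrite /csq /=; simpc; congr (_ +i* _); ring. Qed.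

Lemma csq_sum_le (I : Type) (r : seq I) (F : I -> R[i]) :
  csq (\sum_(i <- r) F i) <= (size r)%:R * \sum_(i <- r) csq (F i).
Proof.
elim: r => [|i r IHr]; first by rewrite !big_nil csq0 mulr0.
case: r IHr => [|j r] IHr; first by rewrite !big_cons !big_nil !addr0 mul1r.
rewrite big_cons [in leRHS]big_cons; move: IHr.
move: (\sum_(l <- _) F l) (\sum_(l <- _) csq _) => s q IHr.
have -> : size (i :: j :: r) = (size (j :: r)).+1 by [].
set n := size (j :: r) in IHr *; have n0 : 0 < n%:R :> R by rewrite ltr0n.
(* Weighted arithmetic-geometric inequality; with these weights the induction closes with the
   constant [size r]. *)
have key : csq (F i + s) <= (1 + n%:R) * csq (F i) + (1 + n%:R^-1) * csq s.
  rewrite -subr_ge0; case: (F i) s {IHr} => [a1 a2] [b1 b2]; rewrite /csq /=.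
  rewrite (_ : _ - _ = n%:R * (a1 - n%:R^-1 * b1) ^+ 2 + n%:R * (a2 - n%:R^-1 * b2) ^+ 2).
    by apply: addr_ge0; apply: mulr_ge0; rewrite ?sqr_ge0 ?ler0n.
  by field; rewrite gt_eqF.
apply: le_trans key _.
have -> : n.+1%:R * (csq (F i) + q) = (1 + n%:R) * csq (F i) + (1 + n%:R^-1) * (n%:R * q).
  by rewrite -natr1; field; rewrite gt_eqF.
by rewrite lerD2l ler_wpM2l// addr_ge0 ?invr_ge0 ?ler0n.
Qed.
End ComplexFacts.

(** * The Hilbert space of square-summable functions *)

Section L2Theory.
Variables (R : realType) (X : choiceType).
Local Notation H := (l2 R X).
Implicit Types (u v w : H) (f g : X -> R[i]).

Definition casum f := asum (fun x => complex.Re (f x)) /\ asum (fun x => complex.Im (f x)).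

Lemma csumD f g : casum f -> casum g -> csum (fun x => f x + g x) = csum f + csum g.
Proof.
move=> [f1 f2] [g1 g2]; rewrite /csum; simpc; congr (_ +i* _).
  by rewrite -rsumD//; congr rsum; apply/funext => x; rewrite raddfD.
by rewrite -rsumD//; congr rsum; apply/funext => x; rewrite raddfD.
Qed.

Lemma csumZ (c : R[i]) f : casum f -> csum (fun x => c * f x) = c * csum f.
Proof.
case: c => c1 c2 [f1 f2]; rewrite /csum; simpc; congr (_ +i* _).
  rewrite -!rsumZ// -rsumN; last exact: asumZ.
  rewrite -rsumD; [|exact: asumZ|].
    by congr rsum; apply/funext => x; case: (f x).
  by apply: eq_asum (asumZ c2 f2) => x; rewrite normrN.
rewrite -!rsumZ// -rsumD; [|exact: asumZ..].
by congr rsum; apply/funext => x; case: (f x).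
Qed.

Lemma csumJ f : casum f -> csum (fun x => conjc (f x)) = conjc (csum f).
Proof.
move=> [f1 f2]; rewrite /csum /=; congr (_ +i* _).
  by congr rsum; apply/funext => x; case: (f x).
by rewrite -rsumN//; congr rsum; apply/funext => x; case: (f x).
Qed.

Lemma l2D u v x : (u + v : H) x = u x + v x. Proof. by []. Qed.
Lemma l2N u x : (- u : H) x = - u x. Proof. by []. Qed.
Lemma l2Z a u x : (a *: u : H) x = a * u x. Proof. by []. Qed.
Lemma l2_0 x : (0 : H) x = 0. Proof. by []. Qed.
Lemma l2_sum (I : Type) (r : seq I) (P : pred I) (F : I -> H) x :
  (\sum_(i <- r | P i) F i) x = \sum_(i <- r | P i) F i x.
Proof. by elim/big_rec2: _ => // i a b _ <-. Qed.

Lemma l2_eq u v : (forall x, u x = v x) -> u = v.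
Proof. by move=> uv; apply: val_inj; apply/funext. Qed.

Definition nrm2 u : R := psum (fun x => csq (u x)).

Lemma asum_csq u : asum (fun x => csq (u x)).
Proof.
rewrite /asum; have := l2P u; rewrite inE /sqnorm; apply: le_lt_trans.
by apply: le_esum => x _; rewrite lee_fin ger0_norm ?csq_ge0// normc_sq.
Qed.

Lemma nrm2_ge0 u : 0 <= nrm2 u.
Proof. by apply: psum_ge0 => x; apply: csq_ge0. Qed.

Lemma casum_inner u v : casum (fun x => u x * conjc (v x)).
Proof.
have sD := asumD (asum_csq u) (asum_csq v).
split; apply: (asum_le (p := fun x => csq (u x) + csq (v x))).
- move=> x; case: (u x) (v x) => [a b] [c d]; rewrite /csq /=.
  have := (sqr_ge0 (a + c), sqr_ge0 (a - c), sqr_ge0 (b + d), sqr_ge0 (b - d)).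
  have := (sqr_ge0 (a + d), sqr_ge0 (a - d), sqr_ge0 (b + c), sqr_ge0 (b - c)).
  have := (sqr_ge0 a, sqr_ge0 b, sqr_ge0 c, sqr_ge0 d).
  by move=> [[[? ?] ?] ?] [[[? ?] ?] ?] [[[? ?] ?] ?]; rewrite ler_norml; apply/andP; split; lra.
- by rewrite -psumE ?ltry// => x; rewrite addr_ge0 ?csq_ge0.
- move=> x; case: (u x) (v x) => [a b] [c d]; rewrite /csq /=.
  have := (sqr_ge0 (a + c), sqr_ge0 (a - c), sqr_ge0 (b + d), sqr_ge0 (b - d)).
  have := (sqr_ge0 (a + d), sqr_ge0 (a - d), sqr_ge0 (b + c), sqr_ge0 (b - c)).
  have := (sqr_ge0 a, sqr_ge0 b, sqr_ge0 c, sqr_ge0 d).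
  by move=> [[[? ?] ?] ?] [[[? ?] ?] ?] [[[? ?] ?] ?]; rewrite ler_norml; apply/andP; split; lra.
- by rewrite -psumE ?ltry// => x; rewrite addr_ge0 ?csq_ge0.
Qed.

Lemma innerDl u v w : inner (u + v) w = inner u w + inner v w.
Proof.
rewrite /inner -csumD; [|exact: casum_inner..].
by congr csum; apply/funext => x; rewrite l2D mulrDl.
Qed.

Lemma innerZl (a : R[i]) u w : inner (a *: u) w = a * inner u w.
Proof.
rewrite /inner -csumZ; last exact: casum_inner.
by congr csum; apply/funext => x; rewrite l2Z mulrA.
Qed.

Lemma innerC u v : inner u v = conjc (inner v u).
Proof.
rewrite /inner -csumJ; last exact: casum_inner.
by congr csum; apply/funext => x; rewrite conjcM conjcK mulrC.
Qed.

Lemma innerNl u w : inner (- u) w = - inner u w.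
Proof. by rewrite -scaleN1r innerZl mulN1r. Qed.

Lemma innerBl u v w : inner (u - v) w = inner u w - inner v w.
Proof. by rewrite innerDl innerNl. Qed.

Lemma innerDr u v w : inner w (u + v) = inner w u + inner w v.
Proof. by rewrite innerC innerDl conjcD -!innerC. Qed.

Lemma innerBr u v w : inner w (u - v) = inner w u - inner w v.
Proof. by rewrite innerC innerBl conjcB -!innerC. Qed.

Lemma innerZr (a : R[i]) u w : inner w (a *: u) = conjc a * inner w u.
Proof. by rewrite innerC innerZl conjcM -!innerC. Qed.

Lemma inner0l w : inner 0 w = 0.
Proof. by rewrite -(scale0r w) innerZl mul0r. Qed.

Lemma inner_suml (I : Type) (r : seq I) (P : pred I) (F : I -> H) w :
  inner (\sum_(i <- r | P i) F i) w = \sum_(i <- r | P i) inner (F i) w.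
Proof.
elim/big_rec2: _ => [|i a b _ <-]; first exact: inner0l.
by rewrite innerDl.
Qed.

Lemma inner_self u : inner u u = (nrm2 u)%:C.
Proof.
rewrite /inner /csum /nrm2; congr (_ +i* _).
  rewrite -rsum_ge0; [|by move=> x; apply: csq_ge0|exact: asum_csq].
  by congr rsum; apply/funext => x; rewrite -csq_conjE.
rewrite (_ : (fun x => _) = fun=> 0); last by apply/funext => x; rewrite -csq_conjE.
rewrite rsum_ge0// /asum /psum; first by rewrite esum1.
by rewrite esum1 ?ltry// => x _; rewrite normr0.
Qed.

Lemma inner_delta u y : inner u (delta R y) = u y.
Proof.
have d x : delta R y x = (x == y)%:R :> R[i] by [].
rewrite /inner /csum (@rsum_point _ _ y); last first.
  by move=> x /negbTE xy; rewrite d xy conjc0 mulr0.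
rewrite (@rsum_point _ _ y); last first.
  by move=> x /negbTE xy; rewrite d xy conjc0 mulr0.
by rewrite d eqxx conjc1 mulr1; case: (u y).
Qed.

Lemma l2_fin u (s : seq X) : (forall x, x \notin s -> u x = 0) -> uniq s ->
  u = \sum_(y <- s) u y *: delta R y.
Proof.
move=> us0 us; apply: l2_eq => x; rewrite l2_sum.
have d y : delta R y x = (x == y)%:R :> R[i] by [].
case: (boolP (x \in s)) => xs.
  rewrite (bigD1_seq x)// l2Z d eqxx mulr1 big1; first by rewrite [RHS]addr0.
  by move=> y /negbTE yx; rewrite l2Z d eq_sym yx mulr0.
rewrite us0// big1_seq// => y /andP[_ ys].
by rewrite l2Z d; case: eqVneq xs => [->|_ _]; rewrite ?ys// mulr0.
Qed.

Lemma inner_fin u v (s : seq X) : (forall x, x \notin s -> v x = 0) -> uniq s ->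
  inner u v = \sum_(y <- s) u y * conjc (v y).
Proof.
move=> vs us; rewrite innerC {1}(l2_fin vs us) inner_suml conjc_sum.
by apply: eq_bigr => y _; rewrite -innerC innerZr inner_delta mulrC.
Qed.

Lemma nrm2_fin u (s : seq X) : (forall x, x \notin s -> u x = 0) -> uniq s ->
  nrm2 u = \sum_(y <- s) csq (u y).
Proof.
move=> us0 us; apply: complexI; rewrite -inner_self (inner_fin _ us0 us) rmorph_sum.
by apply: eq_bigr => y _; rewrite /= csq_conjE.
Qed.

Lemma nrm2_ge_sum u (s : seq X) : uniq s -> \sum_(x <- s) csq (u x) <= nrm2 u.
Proof. by move=> us; apply: psum_uniq_le => // [x|]; [exact: csq_ge0|exact: asum_csq]. Qed.

Definition trunc (s : seq X) u : H := \sum_(y <- undup s) u y *: delta R y.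

Lemma truncE s u x : trunc s u x = if x \in s then u x else 0.
Proof.
rewrite /trunc l2_sum; have d y : delta R y x = (x == y)%:R :> R[i] by [].
case: ifP => xs.
  rewrite (bigD1_seq x) ?undup_uniq ?mem_undup// l2Z d eqxx mulr1.
  rewrite big1; first by rewrite [LHS]addr0.
  by move=> y /negbTE yx; rewrite l2Z d eq_sym yx mulr0.
rewrite big1_seq// => y /andP[_]; rewrite mem_undup => ys.
by rewrite l2Z d; case: eqVneq ys xs => [-> ->|_ _ _]//; rewrite mulr0.
Qed.

Lemma nrm2_truncB s u : uniq s -> nrm2 (u - trunc s u) = nrm2 u - \sum_(x <- s) csq (u x).
Proof.
move=> us.
have ts x : x \notin s -> trunc s u x = 0 by move=> /negbTE xs; rewrite truncE xs.
have tE : \sum_(x <- s) csq (u x) = nrm2 (trunc s u).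
  by rewrite (nrm2_fin ts us); apply: eq_big_seq => x xs; rewrite truncE xs.
rewrite tE; apply: complexI; rewrite rmorphB /= -!inner_self.
have it w : inner u (trunc s u) = inner (trunc s u) (trunc s u).
  by rewrite !(inner_fin _ ts us); apply: eq_big_seq => x xs; rewrite truncE xs.
rewrite innerBl !innerBr it// [inner (trunc s u) u]innerC it// -innerC.
by rewrite subrr subr0.
Qed.

Lemma nrm2_trunc_le s u : nrm2 (trunc s u) <= nrm2 u.
Proof.
rewrite (@nrm2_fin _ (undup s)) ?undup_uniq//.
  rewrite (eq_big_seq (fun x => csq (u x))); first exact/nrm2_ge_sum/undup_uniq.
  by move=> x; rewrite mem_undup truncE => ->.
by move=> x; rewrite mem_undup truncE => /negbTE ->.
Qed.

Lemma trunc_approx u (e : R) : 0 < e -> exists2 s, uniq s &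
  forall s', uniq s' -> {subset s <= s'} -> nrm2 (u - trunc s' u) <= e.
Proof.
move=> e0; have [s us h] := psum_approx (fun x => csq_ge0 (u x)) (asum_csq u) e0.
exists s => // s' us' ss'; rewrite nrm2_truncB//.
rewrite lerBlDr addrC -lerBlDr; apply: le_trans h _.
rewrite [leRHS](bigID (mem s)) /= -[leLHS]addr0 lerD ?sumr_ge0//; last first.
  by move=> x _; apply: csq_ge0.
rewrite -[leRHS]big_filter (perm_big [seq x <- s' | x \in s])//.
apply: uniq_perm; rewrite ?filter_uniq// => x; rewrite mem_filter.
by case xs: (x \in s) => //=; rewrite (ss' x xs).
Qed.

End L2Theory.

(** * Positive contractions in the commutant *)

Section PositiveContractions.
Variables (R : realType) (Gam : groupType) (X : choiceType) (a : gaction Gam X).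
Local Notation H := (l2 R X).
Implicit Types (u v w : H) (T : H -> H).

Lemma inner_translate g u v : inner (translate a g u) (translate a g v) = inner u v.
Proof.
have b : bijective (a g^-1%g) by apply: gact_bij.
by rewrite /inner /csum; congr (_ +i* _); rewrite -[RHS](rsum_reindex _ b).
Qed.

Lemma nrm2_translate g u : nrm2 (translate a g u) = nrm2 u.
Proof. by apply: complexI; rewrite -!inner_self inner_translate. Qed.

Lemma translate_delta g y : translate a g (delta R y) = delta R (a g y).
Proof.
apply: l2_eq => x /=; congr (_ : bool)%:R; apply/eqP/eqP => [<-|->].
  by rewrite gactM mulgV gact1.
by rewrite gactM mulVg gact1.
Qed.

Lemma ge0_conjc (z : R[i]) : 0 <= z -> conjc z = z.
Proof. by move=> /ger0_Im; case: z => x y /= ->; rewrite oppr0. Qed.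

(** The class in which the recursion stays ([pcontr_defect]). In the order of [R[i]] the
    inequalities also say that the quadratic form is real, which yields self-adjointness ([pc_sym])
    and then contractivity ([pc_nrm2]). *)
Record pcontr T : Prop := PContr {
  pc_lin : forall (c : R[i]) u v, T (c *: u + v) = c *: T u + T v;
  pc_ge0 : forall u, 0 <= inner (T u) u;
  pc_le : forall u, inner (T u) u <= inner u u;
  pc_comm : forall g u, T (translate a g u) = translate a g (T u) }.

Section Facts.
Variable T : H -> H.
Hypothesis pT : pcontr T.

Lemma pcD u v : T (u + v) = T u + T v.
Proof. by have := pc_lin pT 1 u v; rewrite !scale1r. Qed.

Lemma pc0 : T 0 = 0.
Proof. by have := pcD 0 0; rewrite addr0 => /eqP; rewrite -subr_eq subrr eq_sym => /eqP. Qed.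

Lemma pcZ c u : T (c *: u) = c *: T u.
Proof. by have := pc_lin pT c u 0; rewrite pc0 !addr0. Qed.

Lemma pcB u v : T (u - v) = T u - T v.
Proof. by rewrite -scaleN1r pcD pcZ scaleN1r. Qed.

(* Polarization: the quadratic form of [T] is real. *)
Lemma pc_sym u v : inner (T u) v = inner u (T v).
Proof.
have re w : inner (T w) w = inner w (T w).
  by rewrite [RHS]innerC ge0_conjc// pc_ge0.
have h1 := re (u + v); have h2 := re ('i *: u + v).
move: h1 h2; rewrite !pcD pcZ !innerDl !innerDr !innerZl !innerZr (re u) (re v) => h1 h2.
have e1 : inner (T u) v + inner (T v) u = inner u (T v) + inner v (T u).
  by apply/eqP; rewrite -subr_eq0; move/eqP: h1; rewrite -subr_eq0 => /eqP <-; apply/eqP; ring.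
have e2 : 'i * inner (T u) v + conjc 'i * inner (T v) u =
    'i * inner u (T v) + conjc 'i * inner v (T u).
  by apply/eqP; rewrite -subr_eq0; move/eqP: h2; rewrite -subr_eq0 => /eqP <-; apply/eqP; ring.
have i1 : conjc 'i = - 'i :> R[i] by rewrite /=; simpc.
have i0 : 'i != 0 :> R[i] by rewrite eq_complex /= oner_eq0 andbF.
move: e2; rewrite i1 !mulNr -!mulrBr => /(mulfI i0) e2.
have /mulfI : 2 != 0 :> R[i] by rewrite pnatr_eq0.
apply.
transitivity ((inner (T u) v + inner (T v) u) + (inner (T u) v - inner (T v) u)); first by ring.
by rewrite e1 e2; ring.
Qed.

(** Positivity at u - Tu gives <Tu, u> - 2 <Tu, Tu> + <TTu, Tu> >= 0, and the last term is at most
    <Tu, Tu>. *)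
Lemma pc_contr_le u : inner (T u) (T u) <= inner (T u) u.
Proof.
have := pc_ge0 pT (u - T u); rewrite pcB !innerBl !innerBr (pc_sym (T u) u) => h.
have h' : 0 <= inner (T u) (T u) - inner (T (T u)) (T u).
  by rewrite subr_ge0; apply: pc_le.
rewrite -subr_ge0.
have -> : inner (T u) u - inner (T u) (T u) = inner (T u) u - inner (T u) (T u) -
  (inner (T u) (T u) - inner (T (T u)) (T u)) +
  (inner (T u) (T u) - inner (T (T u)) (T u)) by rewrite subrK.
exact: addr_ge0.
Qed.

Lemma pc_nrm2 u : nrm2 (T u) <= nrm2 u.
Proof. by rewrite -lecR -!inner_self; apply: le_trans (pc_contr_le u) (pc_le pT u). Qed.

End Facts.

Definition defect T u := T u - T (T u).

Lemma pcontr_defect T : pcontr T -> pcontr (defect T).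
Proof.
move=> pT; split=> [c u v|u|u|g u]; rewrite /defect.
- rewrite !(pc_lin pT) scalerBr opprD addrACA//.
- rewrite innerBl subr_ge0 pc_sym//; exact: pc_contr_le.
- rewrite innerBl (pc_sym pT (T u) u); apply: le_trans _ (pc_le pT u).
  by rewrite gerBl inner_self ler0c nrm2_ge0.
- by rewrite !(pc_comm pT); apply: l2_eq => x.
Qed.

Lemma pcontr_iter T n : pcontr T -> pcontr (iter n defect T).
Proof. by move=> pT; elim: n => //= n IHn; apply: pcontr_defect. Qed.

Lemma defect_telescope T n u :
  T u = \sum_(k < n) iter k defect T (iter k defect T u) + iter n defect T u.
Proof.
elim: n => [|n IHn]; first by rewrite big_ord0 add0r.
by rewrite big_ord_recr /= IHn -addrA; congr (_ + _); rewrite /defect addrC subrK.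
Qed.

(** Paired with [u], each square in the telescoping sum becomes a squared norm by self-adjointness,
    and the remainder is nonnegative. *)
Lemma sum_nrm2_defect T n u : pcontr T ->
  (\sum_(k < n) nrm2 (iter k defect T u))%:C <= inner (T u) u.
Proof.
move=> pT; rewrite (defect_telescope T n u) innerDl inner_suml rmorph_sum /=.
rewrite (eq_bigr (fun k : 'I_n => inner (iter k defect T (iter k defect T u)) u)).
  by rewrite lerDl; apply: pc_ge0; apply: pcontr_iter.
by move=> k _; rewrite -inner_self (pc_sym (pcontr_iter k pT) (iter k defect T u) u).
Qed.

(** The squared norms along the recursion have bounded sums. Adding up all operators and vectors
    before applying the pigeonhole principle gives one [m] for all of them. *)
Lemma defect_small (I : finType) (T : I -> H -> H) (J : finType) (e : J -> H) (eps : R) :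
  (forall i, pcontr (T i)) -> 0 < eps ->
  exists m, \sum_i \sum_j nrm2 (iter m defect (T i) (e j)) <= eps.
Proof.
move=> pT e0; apply: contrapT => /forallNP Hm.
pose B := \sum_(i : I) \sum_j nrm2 (e j).
pose n := (Num.truncn (B / eps)).+1.
have : \sum_(k < n) \sum_i \sum_j nrm2 (iter k defect (T i) (e j)) <= B.
  rewrite exchange_big; apply: ler_sum => i _; rewrite exchange_big; apply: ler_sum => j _ /=.
  rewrite -lecR; apply: le_trans (sum_nrm2_defect _ _ (pT i)) _.
  by rewrite -inner_self; apply: pc_le (pT i) _.
apply/negP; rewrite -ltNge; apply: (@lt_le_trans _ _ (\sum_(k < n) eps)).
  rewrite sumr_const card_ord -mulr_natl -ltr_pdivrMr//.
  exact: truncnS_gt.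
by apply: ler_sum => k _; rewrite ltW// ltNge; apply/negP/Hm.
Qed.

End PositiveContractions.

Section RealComplex.
Variable R : rcfType.
Implicit Types x y : R.
Lemma rcD x y : (x + y)%:C = x%:C + y%:C. Proof. exact: rmorphD. Qed.
Lemma rcB x y : (x - y)%:C = x%:C - y%:C. Proof. exact: rmorphB. Qed.
Lemma rcM x y : (x * y)%:C = x%:C * y%:C. Proof. exact: rmorphM. Qed.
Lemma rc_sum (I : Type) (r : seq I) (P : pred I) (F : I -> R) :
  (\sum_(i <- r | P i) F i)%:C = \sum_(i <- r | P i) (F i)%:C.
Proof. exact: rmorph_sum. Qed.
End RealComplex.

Section CauchySchwarz.
Variables (R : realType) (X : choiceType).
Local Notation H := (l2 R X).
Implicit Types u v : H.

Lemma nrm2_eq0 u : nrm2 u = 0 -> u = 0.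
Proof.
move=> u0; apply: l2_eq => x; rewrite l2_0; apply/eqP; rewrite -normr_eq0 -sqrf_eq0.
rewrite -csqE; apply/eqP; congr (_%:C); apply/eqP; rewrite eq_le csq_ge0 andbT -u0.
by have := @nrm2_ge_sum _ _ u [:: x] isT; rewrite big_seq1.
Qed.

Lemma cauchy_schwarz u v : csq (inner u v) <= nrm2 u * nrm2 v.
Proof.
have [v0|v0] := eqVneq (nrm2 v) 0.
  rewrite v0 (nrm2_eq0 v0) innerC inner0l mulr0.
  by rewrite conjc0 csq0.
have vpos : 0 < nrm2 v by rewrite lt_def v0 nrm2_ge0.
pose w := (nrm2 v)%:C *: u - inner u v *: v.
have : 0 <= nrm2 w by apply: nrm2_ge0.
have -> : nrm2 w = nrm2 v * (nrm2 u * nrm2 v - csq (inner u v)).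
  apply: complexI; rewrite -inner_self /w innerBl !innerBr !innerZl !innerZr.
  rewrite [inner v u]innerC !inner_self conjc_real rcM rcB rcM csq_conjE.
  by move: (inner u v) (conjc _) => p q; ring.
by rewrite pmulr_rge0// subr_ge0.
Qed.

Lemma common_trunc (I : finType) (F : I -> H) (eps : R) : 0 < eps ->
  exists2 s : seq X, uniq s & forall s', uniq s' -> {subset s <= s'} ->
    forall i, nrm2 (F i - trunc s' (F i)) <= eps.
Proof.
move=> e0; have ex i : exists s : seq X, forall s', uniq s' -> {subset s <= s'} ->
    nrm2 (F i - trunc s' (F i)) <= eps.
  by have [s _ hs] := trunc_approx (F i) e0; exists s.
have [f Hf] := choice ex.
exists (undup (flatten [seq f i | i <- enum I])); first exact: undup_uniq.
move=> s' us' sub i; apply: Hf => // x xi; apply: sub.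
by rewrite mem_undup; apply/flatten_mapP; exists i; rewrite ?mem_enum.
Qed.

End CauchySchwarz.

Lemma small_mul (R : realType) (e : R) (x y : nat) : 0 < e -> (x <= y)%N -> (0 < y)%N ->
  x%:R * (e / (100 * y%:R)) <= e / 100.
Proof.
move=> e0 xy y0; have yR : 0 < y%:R :> R by rewrite ltr0n.
have -> : x%:R * (e / (100 * y%:R)) = (e / 100) * (x%:R / y%:R) by field; rewrite gt_eqF.
apply: ler_piMr; first by apply: divr_ge0 => //; apply: ltW.
by rewrite ler_pdivrMr// mul1r ler_nat.
Qed.

Lemma sum_le_const (R : realType) (I : Type) (r : seq I) (F : I -> R) (c : R) :
  (forall i, F i <= c) -> \sum_(i <- r) F i <= (size r)%:R * c.
Proof.
move=> Fc; apply: le_trans (ler_sum _ (fun i _ => Fc i)) _.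
by rewrite big_const_seq count_predT iter_addr_0 mulr_natl.
Qed.

Lemma sum_constE (R : realType) (I : finType) (c : R) : \sum_(i : I) c = #|{: I}|%:R * c.
Proof. by rewrite sumr_const mulr_natl. Qed.

(* [X] is identified with [Gam * J] through [pos], [typ] and [mk]: [J] is a point
   for the vertices of the Cayley diagram and [S] for its edges. *)
Section ApproximateKernel.
Variables (R : realType) (Gam : groupType) (X : choiceType) (a : gaction Gam X).
Variables (J : finType) (pos : X -> Gam) (typ : X -> J) (mk : Gam -> J -> X).
Hypothesis posK : forall x, mk (pos x) (typ x) = x.
Hypothesis pos_mk : forall g j, pos (mk g j) = g.
Hypothesis typ_mk : forall g j, typ (mk g j) = j.
Hypothesis actE : forall g x, a g x = mk (g * pos x)%g (typ x).
Local Notation H := (l2 R X).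

(** The inner product of [f] with the translate of [f'] by [g], when [A] carries [f']: a finite sum,
    which can be copied to a finite graph. *)
Definition corr (A : seq X) (f f' : X -> R[i]) (g : Gam) : R[i] :=
  \sum_(z <- A) f (a g z) * conjc (f' z).

Lemma corr_inner A (u v : H) g h : uniq A -> (forall z, z \notin A -> v z = 0) ->
  corr A u v (g^-1 * h)%g = inner (translate a g u) (translate a h v).
Proof.
move=> uA vA; rewrite -(inner_translate a h^-1%g).
have -> : translate a h^-1%g (translate a h v) = v.
  by apply: l2_eq => x /=; rewrite gactM invgK mulVg gact1.
rewrite (inner_fin _ vA uA); apply: eq_bigr => z _; congr (_ * _) => /=.
by rewrite gactM invgK.
Qed.

Lemma corr_inner1 A (u v : H) h : uniq A -> (forall z, z \notin A -> v z = 0) ->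
  corr A u v h = inner u (translate a h v).
Proof.
move=> uA vA; rewrite -[h in LHS]mul1g -[1%g in LHS]invg1 corr_inner//.
have -> // : translate a 1%g u = u by apply: l2_eq => z /=; rewrite invg1 gact1.
Qed.

Lemma sum_shift_le (u : H) (i : J) (P : seq X) (f : X -> X) : uniq P ->
  {in [pred x | typ x == i] &, injective f} ->
  \sum_(x <- P | typ x == i) csq (u (f x)) <= nrm2 u.
Proof.
move=> uP injf; rewrite -big_filter -(big_map f predT (fun x => csq (u x))).
apply: nrm2_ge_sum; rewrite map_inj_in_uniq ?filter_uniq// => x y.
by rewrite !mem_filter => /andP[xi _] /andP[yi _]; apply: injf.
Qed.

Lemma sum_typ (P : seq X) (F : X -> R) :
  \sum_(x <- P) F x = \sum_i \sum_(x <- P | typ x == i) F x.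
Proof. by rewrite (partition_big typ predT). Qed.

(* With T_0 = T and T_(k+1) = T_k - T_k^2 one has T = sum_k T_k^2 strongly;
   [xi] and [eta] are two truncations of the vectors T_k delta, the second one
   being much finer. *)
Lemma approximate_kernel (T : 'I_3 -> H -> H) (eps : R) :
  (forall c, pcontr a (T c)) -> (forall u, \sum_c T c u = u) -> 0 < eps ->
  exists (K : finType) (cls : K -> 'I_3) (A1 A2 : seq X) (xi eta : K -> J -> X -> R[i]),
  [/\ [/\ uniq A1, uniq A2, {subset A1 <= A2},
        forall k j x, x \notin A1 -> xi k j x = 0 &
        forall k j x, x \notin A2 -> eta k j x = 0],
    forall j, \sum_k \sum_(x <- A1) csq (xi k j x) <= 1,
    forall j, \sum_k \sum_(x <- A2) csq (eta k j x - xi k j x) <= eps,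
    forall j P, uniq P -> \sum_(x <- P) csq ((x == mk 1%g j)%:R -
      \sum_k corr A1 (eta k j) (xi k (typ x)) (pos x)) <= eps &
    forall (C : pred 'I_3) x y,
      csq (\sum_(k | C (cls k)) corr A1 (xi k (typ y)) (xi k (typ x)) ((pos y)^-1 * pos x)%g -
           (\sum_(c | C c) T c (delta R y)) x) <= eps].
Proof.
move=> pT sT e0.
pose bd j : H := delta R (mk 1%g j).
have deltaE x : delta R x = translate a (pos x) (bd (typ x)).
  by rewrite translate_delta actE pos_mk typ_mk mulg1 posK.
have nbd j : nrm2 (bd j) = 1.
  rewrite (@nrm2_fin _ _ _ [:: mk 1%g j])//; last first.
    by move=> x; rewrite inE /= => /negbTE ->.
  by rewrite big_seq1 /= eqxx /csq /= expr1n expr0n addr0.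
have [m Hm] := defect_small bd pT (divr_gt0 e0 (ltr0n _ 100)).
pose K : finType := ('I_3 * 'I_m)%type.
pose S (k : K) : H -> H := iter k.2 (@defect R X) (T k.1).
have pS k : pcontr a (S k) by apply: pcontr_iter.
pose D c := iter m (@defect R X) (T c).
have pD c : pcontr a (D c) by apply: pcontr_iter.
have tel (C : pred 'I_3) u : \sum_(c | C c) T c u =
    \sum_(k : K | C k.1) S k (S k u) + \sum_(c | C c) D c u.
  under eq_bigr do rewrite (defect_telescope _ m).
  by rewrite big_split /= (pair_big_dep C (fun _ _ => true) (fun c k => S (c, k) (S (c, k) u))) /=; congr (_ + _); apply: eq_bigl => -[c k]; rewrite /= andbT.
(* [M] dominates both [N] and [#|J|], so that [M ^ 3] absorbs the factor [N * N * #|J|] of the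
   estimates below. *)
pose N := #|{: K}|; pose M := (N.+1 * #|J|.+1)%N.
pose e1 := eps / (100 * (M ^ 3)%:R).
have M0 : (0 < M)%N by rewrite muln_gt0.
have NM : (N <= M)%N by rewrite /M; nia.
have JM : (#|J| <= M)%N by rewrite /M; nia.
have e1_gt0 : 0 < e1 by rewrite divr_gt0// mulr_gt0 ?ltr0n// expn_gt0 M0.
pose U (kj : K * J) : H := S kj.1 (bd kj.2).
have nU kj : nrm2 (U kj) <= 1 by rewrite -(nbd kj.2); apply: pc_nrm2 (pS _) _.
have [A1 uA1 HA1] := common_trunc U e1_gt0.
(* Chosen after [A1], because a correlation over [A1] costs the factor [size A1] twice. A single
   truncation would make this choice circular. *)
pose e2 := eps / (100 * (M ^ 3 * (size A1).+1 ^ 2)%:R).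
have e2_gt0 : 0 < e2 by rewrite divr_gt0// mulr_gt0 ?ltr0n// muln_gt0 !expn_gt0 M0.
have [A2' uA2' HA2'] := common_trunc U e2_gt0.
pose A2 := undup (A1 ++ A2').
have uA2 : uniq A2 by apply: undup_uniq.
have A12 : {subset A1 <= A2} by move=> x xA; rewrite mem_undup mem_cat xA.
have HA2 kj : nrm2 (U kj - trunc A2 (U kj)) <= e2.
  by apply: HA2' => // x xA; rewrite mem_undup mem_cat xA orbT.
have {}HA1 kj : nrm2 (U kj - trunc A1 (U kj)) <= e1 by apply: HA1.
pose xi k j : H := trunc A1 (U (k, j)); pose eta k j : H := trunc A2 (U (k, j)).
exists K, (fun k => k.1), A1, A2, (fun k j => xi k j), (fun k j => eta k j).
have xi0 k j x : x \notin A1 -> xi k j x = 0 by move=> /negbTE h; rewrite truncE h.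
have eta0 k j x : x \notin A2 -> eta k j x = 0 by move=> /negbTE h; rewrite truncE h.
have nxi k j : nrm2 (xi k j) <= nrm2 (U (k, j)) by apply: nrm2_trunc_le.
pose th k j := U (k, j) - xi k j.
have nth_ k j : nrm2 (th k j) <= e1 by apply: HA1.
have N1 : N%:R * e1 <= eps / 100 by rewrite small_mul ?expn_gt0 ?M0//; apply: leq_trans NM _; rewrite -[leqLHS]expn1 leq_pexp2l.
have c3 (F : 'I_3 -> R[i]) : csq (\sum_c F c) <= 3 * \sum_c csq (F c).
  by apply: le_trans (csq_sum_le _ _) _; rewrite /index_enum -enumT -cardT card_ord.
have cN (F : K -> R[i]) : csq (\sum_k F k) <= N%:R * \sum_k csq (F k).
  by apply: le_trans (csq_sum_le _ _) _; rewrite /index_enum -enumT -cardT.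
(* Self-adjointness and equivariance turn the entries of the square of [S k] into correlations of
   translates of finitely many vectors. *)
have SSE k j x : S k (S k (bd j)) x = inner (U (k, j)) (translate a (pos x) (U (k, typ x))).
  by rewrite -inner_delta (pc_sym (pS k)) deltaE (pc_comm (pS k)).
split=> //.
- move=> j; apply: (@le_trans _ _ (\sum_k nrm2 (U (k, j)))).
    by apply: ler_sum => k _; rewrite -(nrm2_fin (xi0 k j))//.
  have E := tel predT (bd j); rewrite sT in E.
  have -> : 1 = nrm2 (bd j) by rewrite nbd.
  rewrite -lecR -inner_self.
  have -> : inner (bd j) (bd j) =
      \sum_k inner (S k (S k (bd j))) (bd j) + \sum_c inner (D c (bd j)) (bd j).
    by rewrite -!inner_suml -innerDl -E.
  rewrite rc_sum (eq_bigr (fun k => inner (S k (S k (bd j))) (bd j))); last first.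
    by move=> k _; rewrite -inner_self (pc_sym (pS k) (S k (bd j))).
  by rewrite lerDl sumr_ge0// => c _; apply: pc_ge0 (pD c) _.
- move=> j; apply: (@le_trans _ _ (\sum_(k : K) e1)).
    apply: ler_sum => k _; apply: le_trans (nth_ k j).
    apply: le_trans (nrm2_ge_sum _ uA2); rewrite big_seq [leRHS]big_seq.
    apply: ler_sum => x xA; rewrite /th l2D l2N /xi /eta !truncE xA.
    by case: ifP; rewrite ?subrr ?lexx.
  by rewrite sum_constE; apply: le_trans N1 _; lra.
- move=> j P uP.
  (* The error splits exactly into [At], the remainder of the telescoping sum, [Bt], the truncation
     in the second argument, and [Ct], the finer truncation in the first. *)
  pose At x := \sum_c D c (bd j) x.
  pose Bt x := \sum_k inner (U (k, j)) (translate a (pos x) (th k (typ x))).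
  pose Ct x := \sum_k inner (U (k, j) - eta k j) (translate a (pos x) (xi k (typ x))).
  have E x : (x == mk 1%g j)%:R - \sum_k corr A1 (eta k j) (xi k (typ x)) (pos x) =
      At x + (Bt x + Ct x).
    have -> : (x == mk 1%g j)%:R = bd j x by [].
    have {1}-> : bd j = \sum_k S k (S k (bd j)) + \sum_c D c (bd j) by rewrite -(tel predT) sT.
    rewrite l2D !l2_sum -/(At x) addrAC addrC; congr (_ + _).
    rewrite -sumrB -big_split; apply: eq_bigr => k _ /=.
    rewrite SSE (@corr_inner1 A1 (eta k j) (xi k (typ x)) _ uA1 (xi0 k _)).
    have tB u v : translate a (pos x) (u - v) = translate a (pos x) u - translate a (pos x) v.
      by apply: l2_eq.
    by rewrite innerBl tB innerBr addrA subrK.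
  under eq_bigr do rewrite E.
  have le3 x : csq (At x + (Bt x + Ct x)) <= 2 * csq (At x) + (4 * csq (Bt x) + 4 * csq (Ct x)).
    apply: le_trans (csqD_le _ _) _; rewrite lerD2l.
    by have := csqD_le (Bt x) (Ct x); lra.
  apply: le_trans (ler_sum _ (fun x _ => le3 x)) _.
  rewrite !big_split -!mulr_sumr /=.
  have bA : \sum_(x <- P) csq (At x) <= 3 * (eps / 100).
    apply: (@le_trans _ _ (\sum_(x <- P) 3 * \sum_c csq (D c (bd j) x))).
      by apply: ler_sum => x _; apply: c3.
    rewrite -mulr_sumr ler_pM2l// exchange_big; apply: le_trans Hm.
    apply: ler_sum => c _; rewrite (bigD1 j)//= -[leLHS]addr0 lerD//; last first.
      by apply: sumr_ge0 => j' _; apply: nrm2_ge0.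
    exact: nrm2_ge_sum.
  (* The bound does not depend on [P]: after moving [S k] to the other side, the terms with [x] of
     type [i] are values of [S k (th k i)] at distinct points. *)
  have bB : \sum_(x <- P) csq (Bt x) <= eps / 100.
    apply: (@le_trans _ _ (\sum_(x <- P) N%:R * \sum_k
        csq (S k (th k (typ x)) (a (pos x)^-1%g (mk 1%g j))))).
      apply: ler_sum => x _; apply: le_trans (cN _) _; rewrite ler_wpM2l//.
      apply: ler_sum => k _; rewrite le_eqVlt; apply/orP; left; apply/eqP.
      rewrite (pc_sym (pS k)) (pc_comm (pS k)) innerC csqJ.
      by rewrite /bd inner_delta.
    rewrite -mulr_sumr exchange_big.
    apply: (@le_trans _ _ (N%:R * \sum_(k : K) \sum_(i : J) e1)).
      rewrite ler_wpM2l//; apply: ler_sum => k _; rewrite sum_typ; apply: ler_sum => i _.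
      apply: (@le_trans _ _ (nrm2 (S k (th k i)))); last exact: le_trans (pc_nrm2 (pS k) _) (nth_ k i).
      under eq_bigr => x /eqP -> do idtac.
      apply: (@sum_shift_le (S k (th k i)) i P (fun x => a (pos x)^-1%g (mk 1%g j))) => // x y /eqP xi_ /eqP yi.
      move=> /(congr1 pos); rewrite !actE !pos_mk !mulg1 => /invg_inj pxy.
      by rewrite -[x]posK -[y]posK pxy xi_ yi.
    rewrite !sum_constE mulrA -natrM mulrA -natrM.
    by apply: small_mul; rewrite ?expn_gt0 ?M0// -/N !expnSr expn0 mul1n !leq_mul.
  have bC : \sum_(x <- P) csq (Ct x) <= eps / 100.
    pose n := size A1; pose r k := U (k, j) - eta k j.
    apply: (@le_trans _ _ (\sum_(x <- P) N%:R * \sum_k n%:R * \sum_(z <- A1) csq (r k (a (pos x) z)))).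
      apply: ler_sum => x _; apply: le_trans (cN _) _; rewrite ler_wpM2l//.
      apply: ler_sum => k _.
      rewrite -(@corr_inner1 A1 (r k) (xi k (typ x)) _ uA1 (xi0 k _)).
      apply: le_trans (csq_sum_le _ _) _; rewrite ler_wpM2l//.
      apply: ler_sum => z _; rewrite csqM csqJ ler_piMr ?csq_ge0//.
      apply: le_trans (le_trans (nxi k (typ x)) (nU _)).
      by have := @nrm2_ge_sum _ _ (xi k (typ x)) [:: z] isT; rewrite big_seq1.
    rewrite -mulr_sumr exchange_big.
    apply: (@le_trans _ _ (N%:R * \sum_(k : K) n%:R * (\sum_(i : J) n%:R * e2))).
      rewrite ler_wpM2l//; apply: ler_sum => k _; rewrite -[leLHS]mulr_sumr ler_wpM2l//.
      rewrite sum_typ; apply: ler_sum => i _; rewrite exchange_big.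
      apply: sum_le_const => z; apply: le_trans (HA2 (k, j)).
      apply: sum_shift_le => // x y /eqP xi_ /eqP yi.
      move=> /(congr1 pos); rewrite !actE !pos_mk => /mulIg pxy.
      by rewrite -[x]posK -[y]posK pxy xi_ yi.
    rewrite !sum_constE; do 4! rewrite mulrA -natrM.
    apply: small_mul; rewrite ?muln_gt0 ?expn_gt0 ?M0// -/N -/n.
    have -> : (N * N * n * #|J| * n = N * N * #|J| * (n * n))%N.
      by rewrite mulnA (mulnAC (N * N)%N n).
    by rewrite !expnSr !expn0 !mul1n !leq_mul.
  by lra.
- move=> C x y.
  pose E k := inner (translate a (pos y) (th k (typ y))) (translate a (pos x) (xi k (typ x))) +
              inner (translate a (pos y) (U (k, typ y))) (translate a (pos x) (th k (typ x))).
  have eqE : \sum_(k | C k.1) corr A1 (xi k (typ y)) (xi k (typ x)) ((pos y)^-1 * pos x)%g -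
      (\sum_(c | C c) T c (delta R y)) x =
      - (\sum_(k | C k.1) E k) - \sum_(c | C c) D c (delta R y) x.
    rewrite tel l2D !l2_sum opprD addrA; congr (_ - _).
    rewrite -sumrB -sumrN; apply: eq_bigr => k _.
    rewrite (@corr_inner A1 (xi k (typ y)) (xi k (typ x)) _ _ uA1 (xi0 k _)).
    rewrite -[S k (S k _) x]inner_delta (pc_sym (pS k)) (deltaE x) (deltaE y) !(pc_comm (pS k)).
    have tB g u v : translate a g (u - v) = translate a g u - translate a g v.
      by apply: l2_eq.
    rewrite /E /th !tB innerBl innerBr -/(U (k, typ x)) -/(U (k, typ y)) /U /=.
    by ring.
  rewrite eqE -opprD csqN; apply: le_trans (csqD_le _ _) _.
  have b1 : csq (\sum_(k | C k.1) E k) <= 4 * (eps / 100).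
    rewrite big_mkcond; apply: le_trans (cN _) _.
    apply: (@le_trans _ _ (N%:R * \sum_(k : K) 4 * e1)).
      rewrite ler_wpM2l//; apply: ler_sum => k _.
      have e4 : csq (E k) <= 4 * e1.
        apply: le_trans (csqD_le _ _) _.
        have := cauchy_schwarz (translate a (pos y) (th k (typ y))) (translate a (pos x) (xi k (typ x))).
        have := cauchy_schwarz (translate a (pos y) (U (k, typ y))) (translate a (pos x) (th k (typ x))).
        rewrite !nrm2_translate => c1 c2.
        have : nrm2 (th k (typ y)) * nrm2 (xi k (typ x)) <= e1.
          apply: le_trans (nth_ k (typ y)); rewrite ler_piMr ?nrm2_ge0//.
          exact: le_trans (nxi _ _) (nU _).
        have : nrm2 (U (k, typ y)) * nrm2 (th k (typ x)) <= e1.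
          by apply: le_trans (nth_ k (typ x)); rewrite ler_piMl ?nrm2_ge0.
        by lra.
      by case: ifP => // _; rewrite csq0 mulr_ge0// ltW.
    rewrite -mulr_sumr mulrCA ler_pM2l// sum_constE mulrA -natrM.
    apply: small_mul; rewrite ?expn_gt0 ?M0// -/N.
    by rewrite !expnSr expn0 mul1n -[leqLHS]muln1 !leq_mul.
  have b2 : csq (\sum_(c | C c) D c (delta R y) x) <= 3 * (eps / 100).
    rewrite big_mkcond; apply: le_trans (c3 _) _.
    rewrite ler_pM2l//; apply: le_trans Hm.
    apply: ler_sum => c _; rewrite (bigD1 (typ y))//= -[leLHS]addr0 lerD//; last first.
      by apply: sumr_ge0 => j' _; apply: nrm2_ge0.
    case: ifP => _; last by rewrite csq0 nrm2_ge0.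
    rewrite deltaE (pc_comm (pD c)) -(nrm2_translate a (pos y) (D c _)).
    by have := @nrm2_ge_sum _ _ (translate a (pos y) (D c (bd (typ y)))) [:: x] isT; rewrite big_seq1.
  by lra.
Qed.
End ApproximateKernel.

(** * Sofic approximations *)

Local Notation within := Defs.within.

Lemma sval_inj (T : Type) (P : T -> Prop) (x y : {t | P t}) : sval x = sval y -> x = y.
Proof. by case: x y => x px [y py] /= xy; subst y; congr exist; apply: Prop_irrelevance. Qed.

Section Balls.
Variables A B : Type.
Implicit Types N : rnet A B.

Lemma within_le N r r' (v : vert N) : (r <= r')%N -> within r v -> within r' v.
Proof.
move=> /subnKC <-; elim: (r' - r)%N => [|k IHk]; first by rewrite addn0.
by rewrite addnS => /IHk; left.
Qed.

Lemma within_tgt N r (e : edge N) : within r (src e) -> within r.+1 (tgt e).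
Proof. by right; exists e; left. Qed.

End Balls.

Section Words.
Variables (Gam : groupType) (S : {fset Gam}).
Implicit Types w : seq S.

Definition wprod w : Gam := (\prod_(s <- w) fsval s)%g.

Lemma wprod_cat w w' : wprod (w ++ w') = (wprod w * wprod w')%g.
Proof. by rewrite /wprod big_cat. Qed.

Lemma wprod_rcons w s : wprod (rcons w s) = (wprod w * fsval s)%g.
Proof. by rewrite -cats1 wprod_cat /wprod big_seq1. Qed.

Lemma within_wprod (A B : Type) (vm : Gam -> A) (em : Gam * S -> B) w :
  within (N := cayley vm em) (size w) (wprod w).
Proof.
elim/last_ind: w => [|w s IHw]; first by rewrite /wprod big_nil.
rewrite size_rcons wprod_rcons.
exact: (@within_tgt _ _ (cayley vm em) _ (wprod w, s)).
Qed.

(** The word of the identity is empty so that the identity fixes every vertex of a finite graph. *)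
Lemma generating_words : generating S ->
  exists word : Gam -> seq S, word 1%g = [::] /\ forall g, wprod (word g) = g.
Proof.
move=> genS.
have ex g : exists w : seq S, wprod w = g.
  have [w ws ->] := genS g; exists (pmap insub w).
  rewrite /wprod; elim: w ws => [|s w IHw] ws; first by rewrite !big_nil.
  have sS : s \in S by apply: ws; rewrite mem_head.
  rewrite big_cons -IHw => [|x xw]; last by apply: ws; rewrite inE xw orbT.
  by rewrite /= insubT big_cons.
have [f Hf] := choice ex.
exists (fun g => if g == 1%g then [::] else f g); rewrite eqxx; split=> // g.
by case: eqVneq => [->|_]; rewrite ?Hf// /wprod big_nil.
Qed.

End Words.

Section SoficModel.
Variables (R : realType) (Gam : groupType) (S : {fset Gam}).

Section Run.
Variable N : finnet unit S.

(** Takes any outgoing edge labelled [s], and stays at [v] if there is none. Inside a good ball such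
    an edge exists and its end is forced, so that the choice does not matter. *)
Definition step (v : fvert N) (s : S) : fvert N :=
  if [pick e : fedge N | (fsrc e == v) && (femark e == s)] is Some e then ftgt e else v.

Definition run (v : fvert N) (w : seq S) : fvert N := foldl step v w.

Variables (r : nat) (v : fvert N).
Hypothesis good_v : riso (nball (rooted_at v) r) (nball (cay S) r).

(** [f] is the vertex part of the isomorphism of balls; induction on the word keeps the run inside
    the ball, over the vertex [wprod w] of the Cayley diagram. *)
Lemma run_good : exists2 f : {u : fvert N | within (N := rooted_at v) r u} -> Gam,
  injective f & forall w, (size w <= r)%N ->
    exists p : within (N := rooted_at v) r (run v w), f (exist _ _ p) = wprod w.
Proof.
have [f [h [bf bh fbase fe [_ femk]]]] := good_v.
exists (fun u => sval (f u)); first by move=> x y /sval_inj/(bij_inj bf).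
suff key w : (size w <= r)%N -> within (N := rooted_at v) (size w) (run v w) /\ forall p : within (N := rooted_at v) r (run v w), sval (f (exist _ _ p)) = wprod w.
  move=> w wr; have [p1 p2] := key w wr; exists (within_le wr p1); exact: p2.
elim/last_ind: w => [_|w s IHw].
  split=> // p; rewrite /wprod big_nil.
  by rewrite -[RHS]/(sval (base (nball (cay S) r))) -fbase; congr (sval (f _)); apply: sval_inj.
rewrite size_rcons => wr; have [p1 p2] := IHw (ltnW wr).
have p' := within_le (ltnW wr) p1.
have := p2 p'; set u := exist _ _ p' => fu.
have wc : within (N := cay S) r (wprod w).
  by apply: within_le (ltnW wr) _; apply: within_wprod.
have wc' : within (N := cay S) r (wprod (rcons w s)).
  by apply: within_le wr _; rewrite -(size_rcons w s); apply: within_wprod.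
have edgeP (g : Gam * S) : within (N := cay S) r (g.1) -> within (N := cay S) r (g.1 * fsval g.2)%g ->
    within (N := cay S) r (src (r := cay S) g) /\ within (N := cay S) r (tgt (r := cay S) g) by [].
have we : within (N := cay S) r (wprod w * fsval s)%g by rewrite -wprod_rcons.
(* Pulling this Cayley edge back by the inverse of [h] shows that some edge labelled [s] leaves the
   current vertex. *)
pose e0 : edge (nball (cay S) r) := exist _ (wprod w, s) (edgeP (wprod w, s) wc we).
have [hi hK hiK] := bh.
have src_e : src (hi e0) = u :> vert (nball (rooted_at v) r).
  by apply: (bij_inj bf); rewrite -(fe _).1 hiK; apply: sval_inj; rewrite fu.
have mark_e : femark (sval (hi e0)) = s by rewrite -[LHS](femk (hi e0)) hiK.
have : exists e, step (run v w) s = ftgt e /\ fsrc e = run v w /\ femark e = s.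
  rewrite /step; case: pickP => [e /andP[/eqP es /eqP em]|/(_ (sval (hi e0)))].
    by exists e.
  by rewrite mark_e eqxx andbT -[fsrc _]/(sval (src (hi e0))) src_e /= eqxx.
move=> [e [te [se me]]].
have -> : run v (rcons w s) = ftgt e by rewrite /run foldl_rcons.
have wt : within (N := rooted_at v) (size w).+1 (ftgt e).
  by apply: (@within_tgt _ _ (rooted_at v) _ e); rewrite /= se.
split=> // p.
have pe : within (N := rooted_at v) r (fsrc e) by rewrite se.
(* The edge actually picked is sent forward by [h]; its source and label determine its image, hence
   its end. *)
pose e1 : edge (nball (rooted_at v) r) := exist _ e (conj pe p).
have s1 : src e1 = u by apply: sval_inj; rewrite /= se.
have he1 : sval (h e1) = (wprod w, s).
  rewrite [LHS]surjective_pairing; congr (_, _).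
    by rewrite -[LHS]/(sval (src (h e1))) (fe e1).1 s1.
  by rewrite -me; apply: (femk e1).
have -> : exist _ _ p = tgt e1 by apply: sval_inj.
by rewrite -(fe e1).2 /= he1 wprod_rcons.
Qed.

Lemma run_eq w w' : (size w <= r)%N -> (size w' <= r)%N ->
  (run v w == run v w') = (wprod w == wprod w').
Proof.
have [f fi H] := run_good.
move=> /H[p pE] /H[p' p'E]; apply/eqP/eqP => [E|E].
  by rewrite -pE -p'E; congr f; apply: sval_inj.
by have /fi/(congr1 sval) : f (exist _ _ p) = f (exist _ _ p') by rewrite pE p'E.
Qed.

Lemma run_cat w w' : run v (w ++ w') = run (run v w) w'.
Proof. by rewrite /run foldl_cat. Qed.

End Run.
End SoficModel.

(** Near [v], [act] looks like a free right action of the group, as far as products of two elements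
    of [L] can tell. *)
Definition sofic_window (Gam : groupType) (V : finType) (act : V -> Gam -> V) (L : seq Gam) (v : V) :=
  [/\ act v 1%g = v, {in L &, forall g h, act (act v g) h = act v (g * h)%g} &
     {in L &, injective (act v)}].

Lemma sofic_models (R : realType) (Gam : groupType) (L : seq Gam) (eps : R) :
  sofic R Gam -> 0 < eps ->
  exists (V : finType) (act : V -> Gam -> V) (G : {set V}),
    [/\ (0 < #|V|)%N, #|(~: G)%SET|%:R <= eps * #|V|%:R & forall v, v \in G -> sofic_window act L v].
Proof.
move=> [S [symS genS [Gn cvgG]]] e0.
have [word [word1 wordP]] := generating_words genS.
(* [m] bounds the words of elements of [L] and of their products; comparing the concatenation of two
   words with the word of the product takes the radius [m + m]. *)
pose LL := L ++ [seq (g * h)%g | g <- L, h <- L].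
pose m := \max_(g <- LL) size (word g).
have wm g : g \in LL -> (size (word g) <= m)%N.
  by move=> gL; apply: (@leq_bigmax_seq _ LL predT (fun g => size (word g)) g gL).
have /cvgrPdist_le /(_ eps e0)[n _ /(_ n (leqnn n)) Hn] := cvgG (m + m)%N.
pose V := fvert (Gn n); pose act (v : V) g := run v (word g).
pose G : {set V} := finset (fun v => `[< riso (nball (rooted_at v) (m + m)) (nball (cay S) (m + m)) >]).
exists V, act, G; split; first exact: fvert_gt0.
- have V0 : 0 < #|V|%:R :> R by rewrite ltr0n fvert_gt0.
  move: Hn; rewrite /ball_freq -/V => Hn.
  have GE : #|[pred v : V | `[< riso (nball (rooted_at v) (m + m)) (nball (cay S) (m + m)) >]]| = #|G|.
    by apply: eq_card => v; rewrite !inE.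
  have := le_trans (ler_norm _) Hn; rewrite GE lerBlDr -lerBlDl ler_pdivlMr// mulrBl mul1r.
  by have := cardsC G; move/(congr1 (fun k => k%:R : R)); rewrite natrD -/V => <-; lra.
move=> v; rewrite inE => /asboolP good.
have mL g : g \in L -> (size (word g) <= m)%N by move=> gL; apply: wm; rewrite mem_cat gL.
have mLL g h : g \in L -> h \in L -> (size (word (g * h)%g) <= m)%N.
  by move=> gL hL; apply: wm; rewrite mem_cat; apply/orP; right; apply/allpairsP; exists (g, h).
split.
- by rewrite /act word1.
- move=> g h gL hL; rewrite /act -run_cat; apply/eqP; rewrite (run_eq good).
  + by rewrite wprod_cat !wordP.
  + by rewrite size_cat leq_add ?mL.
  + by apply: leq_trans (mLL g h gL hL) _; rewrite leq_addr.
- move=> g h gL hL /eqP; rewrite /act (run_eq good) ?wordP => [/eqP//||].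
  + by apply: leq_trans (mL g gL) _; rewrite leq_addr.
  + by apply: leq_trans (mL h hL) _; rewrite leq_addr.
Qed.

(** * Finite models *)

Lemma finite_cauchy_schwarz (R : realType) (F : finType) (P : pred F) (p q : F -> R[i]) :
  csq (\sum_(l | P l) conjc (p l) * q l) <=
  (\sum_(l | P l) csq (p l)) * (\sum_(l | P l) csq (q l)).
Proof.
pose vec (f : F -> R[i]) : l2 R F := \sum_(y <- enum P) f y *: delta R y.
have vecE f x : vec f x = if P x then f x else 0.
  rewrite /vec l2_sum; have d y : delta R y x = (x == y)%:R :> R[i] by [].
  case: ifP => Px.
    rewrite (bigD1_seq x) ?enum_uniq ?mem_enum// l2Z d eqxx mulr1.
    rewrite big1; first by rewrite [LHS]addr0.
    by move=> y /negbTE yx; rewrite l2Z d eq_sym yx mulr0.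
  rewrite big1_seq// => y /andP[_]; rewrite mem_enum => yP.
  by rewrite l2Z d; case: eqVneq yP => [<-|_ _]; rewrite ?mulr0// [x \in P]Px.
have v0 f x : x \notin enum P -> vec f x = 0.
  by rewrite mem_enum vecE => /negbTE H; rewrite [P x]H.
have nE f : nrm2 (vec f) = \sum_(l | P l) csq (f l).
  rewrite (nrm2_fin (@v0 f)) ?enum_uniq// big_enum /=.
  by apply: eq_bigr => x Px; rewrite vecE [P x]Px.
have := cauchy_schwarz (vec q) (vec p); rewrite !nE mulrC.
rewrite (inner_fin _ (@v0 p)) ?enum_uniq// big_enum /=.
by under eq_bigr => x Px do rewrite !vecE [P x]Px mulrC.
Qed.

Section Push.
Variables (R : realType) (Gam : groupType) (X : choiceType) (J V : finType).
Variables (pos : X -> Gam) (typ : X -> J) (act : V -> Gam -> V) (G : {set V}).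
Implicit Types (A : seq X) (f : X -> R[i]) (w : V) (u : V * J).

Definition spot w (x : X) : V * J := (act w (pos x), typ x).

(** The function [f] carried to the finite graph with the identity placed at [w]; values that land
    on one spot add up. It is zero at bad [w], so that the error of such a column stays bounded. *)
Definition push A f w u : R[i] :=
  if w \in G then \sum_(x <- A | spot w x == u) f x else 0.

Lemma push_sum A f w (h : V * J -> R[i]) : w \in G ->
  \sum_u h u * push A f w u = \sum_(x <- A) h (spot w x) * f x.
Proof.
move=> wG; rewrite /push wG; under eq_bigr do rewrite mulr_sumr.
rewrite (exchange_big_dep predT)//=; apply: eq_bigr => x _.
by rewrite (big_pred1 (spot w x)).
Qed.

Lemma push_spot A f w x : w \in G -> uniq A ->
  (forall z, z \notin A -> f z = 0) -> {in A, forall y, spot w y = spot w x -> y = x} ->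
  push A f w (spot w x) = f x.
Proof.
move=> wG uA fA inj; rewrite /push wG; case: (boolP (x \in A)) => xA.
  rewrite -big_filter (_ : [seq _ <- _ | _] = [:: x]) ?big_seq1//.
  rewrite -(filter_pred1_uniq uA xA); apply: eq_in_filter => y yA /=.
  by apply/eqP/eqP => [/inj->|->].
rewrite fA// big1_seq// => y /andP[/eqP yx yA]; apply: contraTeq xA => _.
by rewrite negbK -(inj y yA yx).
Qed.

Lemma push_csq A f w : w \in G -> uniq A -> (forall z, z \notin A -> f z = 0) ->
  {in A &, injective (spot w)} ->
  \sum_u csq (push A f w u) = \sum_(x <- A) csq (f x).
Proof.
move=> wG uA fA inj; apply: complexI; rewrite !rc_sum.
under eq_bigr do rewrite csq_conjE mulrC.
rewrite (push_sum A f (fun u => conjc (push A f w u)) wG).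
rewrite big_seq [RHS]big_seq; apply: eq_bigr => x xA.
by rewrite push_spot// ?csq_conjE 1?mulrC// => y yA; apply: inj.
Qed.

Lemma pushN A f w u : w \notin G -> push A f w u = 0.
Proof. by move=> /negbTE wG; rewrite /push wG. Qed.

Lemma pushB A f f' w u : push A (fun x => f x - f' x) w u = push A f w u - push A f' w u.
Proof. by rewrite /push; case: ifP => _; rewrite ?subrr// sumrB. Qed.

Lemma push_sub A A' f w u : uniq A -> uniq A' -> {subset A <= A'} ->
  (forall z, z \notin A -> f z = 0) -> push A' f w u = push A f w u.
Proof.
move=> uA uA' AA' fA; rewrite /push; case: ifP => // _.
rewrite (bigID (mem A))/= [X in _ + X]big1 ?addr0 => [|x /andP[_ /fA]//].
rewrite -big_filter -[RHS]big_filter; apply: perm_big; apply: uniq_perm; rewrite ?filter_uniq//.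
by move=> x; rewrite !mem_filter; case xA: (x \in A); rewrite ?(AA' _ xA) ?andbT ?andbF.
Qed.

End Push.

Section FiniteModel.
Variables (R : realType) (Gam : groupType) (X : choiceType) (a : gaction Gam X).
Variables (J : finType) (pos : X -> Gam) (typ : X -> J) (mk : Gam -> J -> X).
Hypothesis posK : forall x, mk (pos x) (typ x) = x.
Hypothesis pos_mk : forall g j, pos (mk g j) = g.
Hypothesis typ_mk : forall g j, typ (mk g j) = j.
Hypothesis actE : forall g x, a g x = mk (g * pos x)%g (typ x).
Local Notation H := (l2 R X).

Lemma pos_act g x : pos (a g x) = (g * pos x)%g. Proof. by rewrite actE pos_mk. Qed.
Lemma typ_act g x : typ (a g x) = typ x. Proof. by rewrite actE typ_mk. Qed.

Lemma pos_typ_inj x y : pos x = pos y -> typ x = typ y -> x = y.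
Proof. by move=> pxy txy; rewrite -[x]posK pxy txy posK. Qed.

Section PushCorr.
Variables (V : finType) (act : V -> Gam -> V) (G : {set V}) (L : seq Gam).
Hypothesis windowG : forall v, v \in G -> sofic_window act L v.
Local Notation spot := (spot pos typ act).
Local Notation push := (push pos typ act G).

Lemma spot_inj w x y : w \in G -> pos x \in L -> pos y \in L -> spot w x = spot w y -> x = y.
Proof.
move=> /windowG[_ _ inj] xL yL [pxy txy]; apply: pos_typ_inj => //.
exact: inj.
Qed.

Lemma spot_act w g y : w \in G -> g \in L -> pos y \in L -> spot (act w g) y = spot w (a g y).
Proof.
by move=> /windowG[_ H _] gL yL; rewrite /spot typ_act pos_act H.
Qed.

(** Inside the window the second base point is reached from the first by [g], so the two transported
    vectors overlap exactly as [f] and the translate of [h] by [g] do in the group. *)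
Lemma push_corr (A A1 : seq X) (f h : X -> R[i]) w g :
  w \in G -> act w g \in G -> uniq A -> (forall z, z \notin A -> f z = 0) ->
  g \in L -> {in A, forall x, pos x \in L} ->
  {in A1, forall y, pos y \in L /\ (g * pos y)%g \in L} ->
  \sum_u conjc (push A1 h (act w g) u) * push A f w u = corr a A1 f h g.
Proof.
move=> wG vG uA fA gL AL A1L; rewrite -[LHS]conjcK conjc_sum.
under eq_bigr do rewrite conjcM conjcK mulrC.
rewrite (push_sum _ _ _ _ _ (fun u => conjc (push A f w u)) vG) conjc_sum.
rewrite /corr big_seq [RHS]big_seq; apply: eq_bigr => y yA.
have [yL gyL] := A1L y yA.
rewrite conjcM conjcK spot_act// push_spot// => x xA; apply: spot_inj => //.
- exact: AL.
- by rewrite pos_act.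
Qed.

End PushCorr.

Variable T : 'I_3 -> H -> H.
Hypothesis pT : forall i, pcontr a (T i).
Hypothesis sT : forall u, \sum_i T i u = u.

(* For T = (Q1, Q2 - Q1, 1 - Q2), [class_op false] is Q1 and [class_op true] is Q2. *)
Definition class_pred (c : bool) : pred 'I_3 := fun i => if c then i != ord_max else i == ord0.

Definition class_op c u : H := \sum_(i | class_pred c i) T i u.

(** A finite approximation with its coupling: [mact] acts on the vertices [mV], [mG] holds the good
    ones, [mOm] is a sample space with weights [mwt], [mA c om] is a random subset of [mV * J] and
    [mQ c] its kernel. The flag [c] is false for the smaller set and true for the larger one. *)
Record model := Model {
  mV : finType;
  mact : mV -> Gam -> mV;
  mG : {set mV};
  mOm : finType;
  mwt : mOm -> R;
  mA : bool -> mOm -> mV * J -> bool;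
  mQ : bool -> mV * J -> mV * J -> R[i] }.

Local Notation mspot := (fun M => spot pos typ (@mact M)).

(** The monotonicity and the determinantal formula are exact; only the kernel is approximate, in
    mean square over the good vertices. *)
Record good_model (L : seq Gam) (B : seq X) (eps : R) (M : model) : Prop := GoodModel {
  gm_card : (0 < #|mV M|)%N;
  gm_bad : #|(~: mG M)%SET|%:R <= eps * #|mV M|%:R;
  gm_window : forall v, v \in mG M -> sofic_window (@mact M) L v;
  gm_wt_ge0 : forall om, 0 <= mwt (m := M) om;
  gm_wt1 : \sum_om mwt (m := M) om = 1;
  gm_mono : forall om, mwt (m := M) om != 0 -> forall u, mA (m := M) false om u -> mA (m := M) true om u;
  gm_det : forall c m (g : 'I_m -> mV M * J), injective g ->
    (\sum_(om | [forall i, mA c om (g i)]) mwt om)%:C = \det (\matrix_(i, j) mQ c (g i) (g j));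
  gm_bound : forall c u u', csq (mQ (m := M) c u u') <= 1;
  gm_close : forall c, {in B &, forall x y,
    \sum_(v in mG M) csq (mQ c (mspot M v x) (mspot M v y) -
                          class_op c (delta R y) x) <= eps * #|mV M|%:R} }.

Lemma finite_model (L0 : seq Gam) (B : seq X) (eps : R) : sofic R Gam -> 0 < eps ->
  exists M, good_model L0 B eps M.
Proof.
move=> sofG e0.
(* The errors add up to at most [48 * #|J| * e1 + 2 * e1] per vertex, which this choice keeps below
   [eps / 2]. *)
pose e1 : R := eps / (100 * #|J|.+1%:R).
have e1_gt0 : 0 < e1 by rewrite divr_gt0// mulr_gt0.
have [K [cls [A1 [A2 [xi [eta [[uA1 uA2 A12 xi0 eta0] Hxi Heta Htau Hker]]]]]]] :=
  approximate_kernel posK pos_mk typ_mk actE pT sT e1_gt0.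
(* [M] contains the positions of the supports and their inverses, [P] the displacements between base
   points whose vectors can overlap, and [L] what is reached after such a displacement. *)
pose M0 := 1%g :: [seq pos x | x <- A2] ++ [seq pos x | x <- B] ++ L0.
pose M := M0 ++ [seq g^-1%g | g <- M0].
pose P := undup [seq (g * h)%g | g <- M, h <- M].
pose L := M ++ P ++ [seq (g * h)%g | g <- P, h <- M].
have M0M g : g \in M0 -> g \in M by move=> gM; rewrite mem_cat gM.
have M1 : 1%g \in M by apply: M0M; rewrite mem_head.
have MV g : g \in M0 -> g^-1%g \in M by move=> gM; rewrite mem_cat (map_f (fun g => g^-1%g))// orbT.
have MP g h : g \in M -> h \in M -> (g * h)%g \in P.
  by move=> gM hM; rewrite mem_undup; apply/allpairsP; exists (g, h).
have ML g : g \in M -> g \in L by move=> gM; rewrite mem_cat gM.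
have PL g : g \in P -> g \in L by move=> gP; rewrite !mem_cat gP orbT.
have PML g h : g \in P -> h \in M -> (g * h)%g \in L.
  by move=> gP hM; rewrite !mem_cat; apply/orP; right; apply/orP; right; apply/allpairsP; exists (g, h).
have A2M0 x : x \in A2 -> pos x \in M0.
  by move=> xA; rewrite inE !mem_cat (map_f pos xA) orbT.
have BM0 x : x \in B -> pos x \in M0.
  by move=> xB; rewrite inE !mem_cat (map_f pos xB) !orbT.
have L0M g : g \in L0 -> g \in M by move=> gL; apply: M0M; rewrite inE !mem_cat gL !orbT.
(* Prepares the passage from [G] to [G'], which removes up to [size B] further preimages of the bad
   set. *)
pose e2 : R := e1 / (size B).+1%:R.
have e2_gt0 : 0 < e2 by rewrite divr_gt0 ?ltr0n.
have [V [act [G [V0 HG windowG]]]] := sofic_models L sofG e2_gt0.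
pose pushG := @push R Gam X J V pos typ act G; pose sp := spot pos typ act.
have sp_inj w x y : w \in G -> pos x \in L -> pos y \in L -> sp w x = sp w y -> x = y.
  exact: (spot_inj windowG).
(* One copy of [V * J], marked [None], indexes the columns, and one copy for each [k] the rows. The
   matrix [y] has the transported [xi] in one off-diagonal block and minus their adjoint in the
   other, hence is skew by construction. *)
pose F : finType := ((V * J) * option K)%type.
pose yk (k : K) (u e : V * J) : R[i] := pushG A1 (xi k e.2) e.1 u.
pose y (p q : F) : R[i] := match p.2, q.2 with
  | Some k, None => yk k p.1 q.1
  | None, Some k => - conjc (yk k q.1 p.1)
  | _, _ => 0 end.
have conjcN (c : R[i]) : conjc (- c) = - conjc c by exact: rmorphN.
have skewy p q : y p q = - (y q p)^*%R.
  by rewrite conjcE /y; case: p.2 q.2 => [k|] [k'|]; rewrite ?conjcN ?conjcK ?opprK ?conjc0 ?oppr0.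
have [U [rowsU colsU approxU]] := cayley_transform skewy.
have sumF (W : nmodType) (f : F -> W) :
    \sum_p f p = \sum_u f (u, None) + \sum_k \sum_u f (u, Some k).
  have -> : \sum_p f p = \sum_u \sum_o f (u, o).
    by rewrite pair_bigA; apply: eq_bigr => -[].
  rewrite [X in _ = _ + X]exchange_big -big_split; apply: eq_bigr => u _ /=.
  rewrite (bigD1 None)//=; congr (_ + _).
  rewrite (reindex_omap Some id) => [|[k|]//].
  by apply: eq_bigl => k; rewrite /= eqxx.
pose N (u : V * J) : F := (u, None).
pose d (e : V * J) : R := \sum_p csq (U p (N e) - y p (N e)).
have d0 e : 0 <= d e by apply: sumr_ge0 => p _; apply: csq_ge0.
have two : (2 : R)%:C = 2 by exact: (rmorph_nat (real_complex R) 2).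
have dbound e (t z : F -> R[i]) :
    (forall p, (p == N e)%:R + \sum_q y p q * y q (N e) = t p - \sum_q y p q * z q) ->
    d e <= 2 * (\sum_p csq (t p)) + 2 * (\sum_p csq (z p)).
  by move=> /approxU H; rewrite -lecR rcD !rcM two !sum_csqE.
(* The residuals for [cayley_transform]: [z] is the difference of the two truncations, and [t]
   measures how far the [xi] and [eta] vectors are from being biorthonormal, the quantity that
   [Htau] bounds. *)
pose t (w : V) (j : J) (p : F) : R[i] := if p.2 is None then
    (p.1 == (w, j))%:R - \sum_k \sum_u conjc (pushG A1 (xi k p.1.2) p.1.1 u) * pushG A2 (eta k j) w u
  else 0.
pose z (w : V) (j : J) (p : F) : R[i] := if p.2 is Some k then
    pushG A2 (fun x => eta k j x - xi k j x) w p.1 else 0.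
have Z0 (I : finType) (f : I -> R[i]) : (forall i, f i = 0) -> \sum_i f i = 0.
  by move=> f0; apply: big1.
have zE w j k u : pushG A2 (fun x => eta k j x - xi k j x) w u =
    pushG A2 (eta k j) w u - pushG A1 (xi k j) w u.
  by rewrite /pushG pushB (push_sub _ _ _ _ _ _ uA1 uA2 A12 (xi0 k j)).
have eqn w j p : (p == N (w, j))%:R + \sum_q y p q * y q (N (w, j)) =
    t w j p - \sum_q y p q * z w j q.
  case: p => u [k|]; rewrite !sumF /y /t /z /N /=.
    rewrite [_ == _](_ : _ = false); last by apply/eqP => -[].
    rewrite !Z0 ?addr0 ?subr0// => *; rewrite ?Z0// => *; rewrite ?mulr0 ?mul0r//.
  rewrite [X in _ + (X + _)]Z0 ?add0r => [|?]; last by rewrite mul0r.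
  rewrite [X in _ = _ - (X + _)]Z0 ?add0r => [|?]; last by rewrite mul0r.
  rewrite -addrA; congr (_ + _).
    by congr (_ : bool)%:R; apply/eqP/eqP => [[]|->].
  rewrite -opprD -big_split -sumrN; apply: eq_bigr => k _ /=.
  rewrite -big_split -sumrN /=; apply: eq_bigr => u' _.
  by rewrite /yk zE /=; move: (conjc _) => c; ring.
have zbound w j : w \in G -> \sum_p csq (z w j p) <= e1.
  move=> wG; apply: le_trans (Heta j); rewrite sumF big1 ?add0r; last by move=> u _; rewrite csq0.
  apply: ler_sum => k _; rewrite /z /= push_csq// => [x xA|x x' xA xA'].
    by rewrite eta0// xi0 ?subrr//; apply: contra xA => /A12.
  by apply: sp_inj => //; apply/ML/M0M/A2M0.
have act1 w : w \in G -> act w 1%g = w by move=> /windowG[].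
have actM w g h : w \in G -> g \in L -> h \in L -> act (act w g) h = act w (g * h)%g.
  by move=> /windowG[_ + _] gL hL; apply.
have tbound w j : w \in G -> \sum_p csq (t w j p) <= e1.
  move=> wG; rewrite sumF [X in _ + X]big1 ?addr0; last first.
    by move=> k _; rewrite big1// => u _; rewrite csq0.
  pose Pm := [seq mk g i | i <- enum J, g <- P].
  have PmP x : (x \in Pm) = (pos x \in P).
    apply/allpairsP/idP => [[[i g] /= [_ gP ->]]|xP]; first by rewrite pos_mk.
    by exists (typ x, pos x) => /=; split; rewrite ?mem_enum ?posK.
  have uPm : uniq Pm.
    apply: allpairs_uniq; rewrite ?enum_uniq ?undup_uniq// => -[i g] [i' g'] _ _ /= E.
    by have := (congr1 pos E, congr1 typ E); rewrite !pos_mk !typ_mk => -[-> ->].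
  have inj : {in Pm &, injective (sp w)}.
    by move=> x x'; rewrite !PmP => xP xP'; apply: sp_inj => //; apply: PL.
  have w1E : (w, j) = sp w (mk 1%g j) by rewrite /sp /spot pos_mk typ_mk act1.
  have onePm : mk 1%g j \in Pm by rewrite PmP pos_mk -(mulg1 1%g) MP.
  (* A common spot of two supports forces the displacement between their base points to lie in [P],
     so nothing survives outside the spots of [Pm]. *)
  have out u : u \notin [seq sp w x | x <- Pm] -> csq (t w j (u, None)) = 0.
    move=> uP; rewrite /t /=.
    have -> : u == (w, j) = false.
      by apply: contraNF uP => /eqP ->; rewrite w1E map_f.
    rewrite sub0r csqN big1 ?csq0// => k _.
    case: (boolP (u.1 \in G)) => uG; last first.
      by apply: big1 => u' _; rewrite /pushG pushN// conjc0 mul0r.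
    rewrite -[LHS]conjcK conjc_sum; under eq_bigr do rewrite conjcM conjcK mulrC.
    rewrite (push_sum _ _ _ _ _ (fun u' => conjc (pushG A2 (eta k j) w u')) uG).
    rewrite big1_seq ?conjc0// => x /andP[_ xA1].
    rewrite [X in conjc X * _](_ : _ = 0) ?conjc0 ?mul0r//.
    rewrite /pushG /push wG big1_seq// => x' /andP[/eqP E xA2]; case/negP: uP.
    have [vE jE] : act w (pos x') = act u.1 (pos x) /\ typ x' = typ x by case: E.
    have xM := A2M0 _ (A12 _ xA1); have x'M := A2M0 _ xA2.
    have xL := ML _ (M0M _ xM); have x'L := ML _ (M0M _ x'M); have xVL := ML _ (MV _ xM).
    have gP : (pos x' * (pos x)^-1)%g \in P by apply: MP; [apply: M0M|apply: MV].
    apply/mapP; exists (mk (pos x' * (pos x)^-1)%g u.2); first by rewrite PmP pos_mk.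
    rewrite /sp /spot pos_mk typ_mk -actM// vE actM// mulgV act1//.
    by case: (u).
  have -> : \sum_u csq (t w j (u, None)) = \sum_(x <- Pm) csq (t w j (sp w x, None)).
    have us : uniq [seq sp w x | x <- Pm] by rewrite map_inj_in_uniq.
    rewrite (bigID (mem [seq sp w x | x <- Pm]))/= [X in _ + X]big1 ?addr0 => [|u /out//].
    by rewrite -(big_uniq _ us) /= big_map.
  apply: le_trans (Htau j Pm uPm); rewrite big_seq [leRHS]big_seq; apply: ler_sum => x xPm.
  rewrite /t /= w1E; have -> : (sp w x == sp w (mk 1%g j)) = (x == mk 1%g j).
    by apply/eqP/eqP => [/inj->//|->].
  move: (xPm); rewrite PmP => xP; case: (boolP (act w (pos x) \in G)) => vG.
    rewrite le_eqVlt; apply/orP; left; apply/eqP; congr (csq (_ - _)).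
    apply: eq_bigr => k _; apply: (push_corr windowG) => //.
    - exact: eta0.
    - exact: PL.
    - by move=> x' /A2M0/M0M/ML.
    - by move=> x' /A12/A2M0/M0M x'M; split; [apply: ML|apply: PML].
  rewrite Z0 ?subr0 => [|k]; last first.
    by apply: Z0 => u; rewrite /pushG pushN// conjc0 mul0r.
  have [xE|_] := eqVneq x (mk 1%g j); last by rewrite csq0 csq_ge0.
  by move: vG; rewrite xE pos_mk act1// wG.
have dgood w j : w \in G -> d (w, j) <= 4 * e1.
  move=> wG; apply: le_trans (dbound _ _ _ (eqn w j)) _.
  by have := tbound w j wG; have := zbound w j wG; lra.
have dbad w j : w \notin G -> d (w, j) <= 2.
  move=> wG; apply: le_trans (dbound _ _ _ (eqn w j)) _.
  rewrite [X in _ + _ * X]big1 ?mulr0 ?addr0; last first.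
    by move=> [u [k|]] _; rewrite /z /= ?csq0// /pushG pushN// csq0.
  rewrite sumF [X in _ + X]big1 ?addr0; last first.
    by move=> k _; rewrite big1// => u _; rewrite csq0.
  rewrite (bigD1 (w, j))//= big1 ?addr0 => [|u /negbTE uwj].
    rewrite /t /= eqxx Z0 ?subr0 => [|k]; last by apply: Z0 => u; rewrite /pushG pushN// conjc0 mul0r.
    by rewrite /csq /= expr1n expr0n addr0 mulr1.
  rewrite /t /= uwj Z0 ?subr0 ?csq0// => k.
  by apply: Z0 => u'; rewrite [X in _ * X]/pushG pushN// mulr0.
(* Good columns cost at most [4 * e1], bad ones at most 2, and at most [e1 * #|V|] vertices are
   bad. *)
have Dtot : \sum_u d u <= 6 * (e1 * #|J|%:R * #|V|%:R).
  apply: (@le_trans _ _ (\sum_(u : V * J) (4 * e1 + (u.1 \notin G)%:R * 2))).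
    apply: ler_sum => -[w j] _ /=; case: (boolP (w \in G)) => wG /=.
      by rewrite mul0r addr0 dgood.
    by rewrite mul1r ler_wpDl ?dbad// mulr_ge0// ltW.
  rewrite big_split /= sum_constE card_prod natrM.
  have -> : \sum_(u : V * J) (u.1 \notin G)%:R * 2 = 2 * #|J|%:R * #|(~: G)%SET|%:R :> R.
    rewrite -mulr_suml -(pair_bigA _ (fun w (j : J) => (w \notin G)%:R)) /=.
    under eq_bigr do rewrite sum_constE.
    have -> : #|(~: G)%SET|%:R = \sum_w (w \notin G)%:R :> R.
      rewrite -sum1_card natr_sum big_mkcond; apply: eq_bigr => w _.
      by rewrite inE; case: (w \notin G).
    by rewrite -mulr_sumr mulrC mulrA.
  have h1 : 0 <= #|J|%:R :> R by rewrite ler0n.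
  have h2 : #|(~: G)%SET|%:R <= e1 * #|V|%:R :> R.
    apply: le_trans HG _; rewrite ler_wpM2r ?ler0n// /e2.
    apply: ler_piMr; first exact: ltW.
    by rewrite invf_le1 ?ltr0n// ler1n.
  have := ler_wpM2l h1 h2; lra.
(* The vertices reached through points of [B] must be good as well, since the kernel entries compare
   columns based there. *)
pose G' : {set V} := finset (fun v => (v \in G) && all (fun x => act v (pos x) \in G) B).
have G'G v : v \in G' -> v \in G by rewrite inE => /andP[].
have G'B v x : v \in G' -> x \in B -> act v (pos x) \in G.
  by rewrite inE => /andP[_ /allP H] xB; apply: H.
have inj_B x : x \in B -> {in G &, injective (fun v => act v (pos x))}.
  move=> xB v v' vG v'G /= E; have xM := BM0 _ xB.
  have xL := ML _ (M0M _ xM); have xVL := ML _ (MV _ xM).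
  rewrite -(act1 _ vG) -(act1 _ v'G) -(mulgV (pos x)).
  by rewrite -(actM v)// -(actM v')// E.
have cardG' : #|(~: G')%SET|%:R <= e1 * #|V|%:R :> R.
  suff le_card : (#|(~: G')%SET| <= (size B).+1 * #|(~: G)%SET|)%N.
    apply: (@le_trans _ _ ((size B).+1 * #|(~: G)%SET|)%:R); first by rewrite ler_nat.
    rewrite natrM; apply: le_trans (ler_wpM2l _ HG) _; first by rewrite ler0n.
    by rewrite mulrA /e2 mulrCA divff ?mulr1// pnatr_eq0.
  have sub : {subset B <= B} by [].
  rewrite /G'; elim: {1 3 4}B sub => [|x s IHs] sub.
    rewrite mul1n; apply/subset_leq_card/fintype.subsetP => v; rewrite !inE /=.
    by rewrite andbT.
  have xB : x \in B by apply: sub; rewrite mem_head.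
  have {}IHs := IHs (fun z zs => sub z (@mem_behead _ (x :: s) z zs)).
  rewrite mulSn addnC.
  pose bad : {set V} := finset (fun v => (v \in G) && (act v (pos x) \notin G)).
  apply: (@leq_trans (#|(~: finset (fun v : V => (v \in G) && all (fun x => act v (pos x) \in G) s))%SET| + #|bad|)).
    apply: leq_trans (leq_card_setU _ _); apply/subset_leq_card/fintype.subsetP => v.
    rewrite !inE /=; case: (v \in G) => //=.
    by case: (act v (pos x) \in G); rewrite /= ?orbF ?orbT.
  apply: leq_add => //.
  rewrite -(card_in_imset (f := fun v => act v (pos x))); last first.
    by move=> v v'; rewrite !inE => /andP[vG _] /andP[v'G _]; apply: inj_B.
  apply/subset_leq_card/fintype.subsetP => v /imsetP[v']; rewrite !inE => /andP[_ nG] ->.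
  exact: nG.
pose Kc c (p : F) := if p.2 is Some k then class_pred c (cls k) else false.
have K12 p : Kc false p -> Kc true p.
  by rewrite /Kc; case: p.2 => [k|]//= /eqP ->.
have [p [p0 psub p1 pF pT_]] := determinantal_coupling rowsU K12.
pose Om : finType := ({set F} * {set F})%type.
pose Qn c u u' := \sum_(l | Kc c l) conjc (U l (N u)) * U l (N u').
have Ucol u : \sum_l csq (U l (N u)) = 1.
  apply: complexI; rewrite rc_sum; under eq_bigr do rewrite csq_conjE mulrC.
  by have := colsU (N u) (N u); rewrite eqxx.
have partial (P' : pred F) (f : F -> R[i]) : \sum_(l | P' l) csq (f l) <= \sum_l csq (f l).
  by rewrite [leRHS](bigID P')/= lerDl sumr_ge0// => l _; apply: csq_ge0.
pose A (c : bool) (om : Om) (u : V * J) : bool := N u \in (if c then om.2 else om.1 : {set F}).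
have S0 (P' : pred F) (f : F -> R[i]) : 0 <= \sum_(l | P' l) csq (f l).
  by apply: sumr_ge0 => l _; apply: csq_ge0.
exists (@Model V act G' Om (fun om : Om => p om.1 om.2) A Qn).
split; cbn [mV mact mG mOm mwt mA mQ].
- by [].
- apply: le_trans cardG' _; rewrite ler_wpM2r ?ler0n// /e1.
  apply: ler_piMr; first exact: ltW.
  rewrite invf_le1; last by rewrite mulr_gt0.
  by rewrite -natrM ler1n muln_gt0.
- move=> v /G'G/windowG[h1 h2 h3]; split=> //.
    by move=> g h gL hL; apply: h2; apply/ML/L0M.
  by move=> g h gL hL; apply: h3; apply/ML/L0M.
- by move=> om; apply: p0.
- by rewrite -p1 pair_bigA.
- by move=> om /psub/fintype.subsetP H u; apply: H.
- move=> c m g gi; have Ni : injective (fun i => N (g i)) by move=> i j [/gi].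
  case: c.
    rewrite -(pT_ m _ Ni) [in RHS]exchange_big (pair_big_dep xpredT (fun _ (T : {set F}) => [forall i, N (g i) \in T])) /=.
    by congr (_%:C); apply: eq_bigl => om.
  rewrite -(pF m _ Ni) (pair_big (fun S : {set F} => [forall i, N (g i) \in S]) xpredT) /=.
  by congr (_%:C); apply: eq_bigl => om; rewrite andbT.
- move=> c u u'; apply: le_trans (finite_cauchy_schwarz _ _ _) _.
  rewrite -[leRHS]mulr1; apply: ler_pM; rewrite ?S0//.
  + by apply: le_trans (partial _ _) _; rewrite Ucol.
  + by apply: le_trans (partial _ _) _; rewrite Ucol.
move=> c x z' xB zB; rewrite -/sp.
(* The kernel with [y] in place of [U]: on [G'] it is exactly a sum of group correlations, and [d]
   controls the replacement. *)
pose Mx v := \sum_(l | Kc c l) conjc (y l (N (sp v x))) * y l (N (sp v z')).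
have MxE v : v \in G' -> Mx v = \sum_(k | class_pred c (cls k))
    corr a A1 (xi k (typ z')) (xi k (typ x)) ((pos z')^-1 * pos x)%g.
  move=> vG'; rewrite /Mx big_mkcond sumF /= Z0// add0r [RHS]big_mkcond.
  apply: eq_bigr => k _; rewrite /Kc /=; case: ifP => _; last by apply: Z0.
  have xL := ML _ (M0M _ (BM0 _ xB)); have zL := ML _ (M0M _ (BM0 _ zB)).
  have gP : ((pos z')^-1 * pos x)%g \in P by apply: MP; [apply/MV/BM0|apply/M0M/BM0].
  have vxE : act v (pos x) = act (act v (pos z')) ((pos z')^-1 * pos x)%g.
    by rewrite actM ?G'G//; [rewrite mulgA mulgV mul1g|apply: PL].
  rewrite /y /yk /= vxE; apply: (push_corr windowG) => //.
  - exact: G'B.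
  - by rewrite -vxE; apply: G'B.
  - exact: xi0.
  - exact: PL.
  - by move=> x' /A12/A2M0/M0M/ML.
  - by move=> x' /A12/A2M0/M0M x'M; split; [apply: ML|apply: PML].
have ynorm u : u.1 \in G -> \sum_l csq (y l (N u)) <= 1.
  move=> uG; apply: le_trans (Hxi u.2); rewrite sumF /= big1 ?add0r; last by move=> *; rewrite csq0.
  apply: ler_sum => k _; rewrite /y /yk /= push_csq// => [x'|x' x'' /A12/A2M0/M0M/ML h1 /A12/A2M0/M0M/ML h2].
    exact: xi0.
  exact: sp_inj.
have err v : v \in G' -> csq (Qn c (sp v x) (sp v z') - class_op c (delta R z') x) <=
    4 * d (sp v x) + 4 * d (sp v z') + 2 * e1.
  move=> vG'; rewrite -(subrK (Mx v) (Qn c _ _)) -addrA.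
  apply: le_trans (csqD_le _ _) _.
  have h1 : csq (Mx v - class_op c (delta R z') x) <= e1 by rewrite MxE//; apply: Hker.
  suff : csq (Qn c (sp v x) (sp v z') - Mx v) <= 2 * d (sp v x) + 2 * d (sp v z') by lra.
  have -> : Qn c (sp v x) (sp v z') - Mx v =
      \sum_(l | Kc c l) conjc (U l (N (sp v x)) - y l (N (sp v x))) * U l (N (sp v z')) +
      \sum_(l | Kc c l) conjc (y l (N (sp v x))) * (U l (N (sp v z')) - y l (N (sp v z'))).
    rewrite /Qn /Mx -sumrB -big_split; apply: eq_bigr => l _ /=.
    by rewrite conjcB; ring.
  apply: le_trans (csqD_le _ _) _; apply: lerD; rewrite ler_pM2l//.
    apply: le_trans (finite_cauchy_schwarz _ _ _) _; rewrite -[leRHS]mulr1.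
    apply: ler_pM; rewrite ?S0//.
    by apply: le_trans (partial _ _) _; rewrite Ucol.
  apply: le_trans (finite_cauchy_schwarz _ _ _) _; rewrite -[leRHS]mul1r.
  apply: ler_pM; rewrite ?S0//.
    by apply: le_trans (partial _ _) (ynorm _ _); apply: G'B.
have sumd x' : x' \in B -> \sum_(v in G') d (sp v x') <= \sum_u d u.
  move=> x'B; have inj : {in G' &, injective (fun v => sp v x')}.
    by move=> v v' /G'G vG /G'G v'G [E]; apply: (inj_B x').
  rewrite -(big_imset d inj) /= [leRHS](bigID (mem [set sp v x' | v in G']%SET)) /=.
  by rewrite lerDl sumr_ge0.
have hc : \sum_(v in G') (2 * e1) = #|G'|%:R * (2 * e1) by rewrite sumr_const -[LHS]mulr_natl.
rewrite (le_trans (ler_sum _ err))// !big_split /= hc -!mulr_sumr.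
have h1 := sumd x xB; have h2 := sumd z' zB.
have h3 : #|G'|%:R <= #|V|%:R :> R by rewrite ler_nat max_card.
have h4 : #|G'|%:R * (2 * e1) <= #|V|%:R * (2 * e1).
  by rewrite ler_wpM2r// mulr_ge0// ltW.
have h5 : 50 * (e1 * #|J|.+1%:R) <= eps.
  rewrite (_ : 50 * _ = eps / 2); first by lra.
  by rewrite /e1; field; rewrite gt_eqF.
have h6 : 50 * (e1 * #|J|.+1%:R) * #|V|%:R <= eps * #|V|%:R by rewrite ler_wpM2r ?ler0n.
have h7 : 0 <= e1 * #|V|%:R by rewrite mulr_ge0 ?ler0n ?ltW.
have h8 : 50 * (e1 * #|J|.+1%:R) * #|V|%:R = 50 * (e1 * #|J|%:R * #|V|%:R) + 50 * (e1 * #|V|%:R).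
  by rewrite -natr1; ring.
have h9 : 0 <= e1 * #|J|%:R * #|V|%:R by rewrite !mulr_ge0 ?ler0n ?ltW.
rewrite h8 in h6; lra.
Qed.

End FiniteModel.

(** * Limits of finitely additive laws *)

Section UnitInterval.
Variable R : realType.

Lemma measurable_unit_itv : measurable (`[0%R, 1%R[%classic : set R).
Proof. exact: measurable_itv. Qed.

Definition unit_lebesgue : set (measurableTypeR R) -> \bar R :=
  mrestr (@lebesgue_measure R) measurable_unit_itv.

HB.instance Definition _ := Measure.on unit_lebesgue.

Lemma unit_lebesgueT : unit_lebesgue setT = 1%E.
Proof.
by rewrite /unit_lebesgue /mrestr setTI lebesgue_measure_itv /= lte_fin ltr01 oppr0 adde0.
Qed.

HB.instance Definition _ := Measure_isProbability.Build _ _ R unit_lebesgue unit_lebesgueT.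

End UnitInterval.

(* Nested intervals: a consistent family [p] of probabilities of finite words
   (listed with the latest bit first) cuts the unit interval into the intervals
   [left b, left b + p b[, and [word n t] is the word of length [n] whose
   interval contains [t]. *)
Section NestedIntervals.
Variables (R : realType) (p : seq bool -> R).
Hypothesis p_ge0 : forall b, 0 <= p b.
Hypothesis p_nil : p [::] = 1.
Hypothesis p_cons : forall b, p b = p (false :: b) + p (true :: b).

Fixpoint left (b : seq bool) : R :=
  if b is x :: b' then (if x then left b' + p (false :: b') else left b') else 0.

Fixpoint word (n : nat) (t : R) : seq bool :=
  if n is m.+1 then
    let b := word m t in ~~ (t < left b + p (false :: b)) :: b
  else [::].

Lemma size_word n t : size (word n t) = n.
Proof. by elim: n => //= n ->. Qed.

Lemma left_ge0 b : 0 <= left b.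
Proof. by elim: b => //= -[] b IHb; rewrite ?addr_ge0. Qed.

Lemma left_le1 b : left b + p b <= 1.
Proof.
elim: b => [|x b IHb]; first by rewrite add0r p_nil.
by move: IHb; rewrite p_cons; case: x => /=; have := p_ge0 (true :: b); lra.
Qed.

(** The half-open intervals of the words of one length partition the unit interval. Those of
    probability zero are empty, so a word that is read at some [t] has positive probability. *)
Lemma wordP b t : 0 <= t -> t < 1 ->
  (word (size b) t == b) = (left b <= t < left b + p b).
Proof.
move=> t0 t1; elim: b => [|x b IHb]; first by rewrite /= p_nil add0r t0 t1.
rewrite /= eqseq_cons; case: (eqVneq (word (size b) t) b) IHb => [->|_] /= IHb.
  have {IHb} : left b <= t < left b + p b by [].
  rewrite andbT (p_cons b); have := p_ge0 (true :: b); have := p_ge0 (false :: b).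
  case: x => /= h1 h2 /andP[h3 h4]; case: (ltP t (left b + p (false :: b))) => h5 /=.
  - by [].
  - by rewrite -addrA h4.
  - by rewrite h3.
  - by rewrite andbF.
rewrite andbF; apply/esym/negbTE/negP => /andP[h3 h4]; move: IHb.
have h1 := p_ge0 (true :: b); have h2 := p_ge0 (false :: b).
move/esym/negbT/negP; apply; rewrite (p_cons b).
by case: x h3 h4 => /= h3 h4; apply/andP; split; lra.
Qed.

Lemma measurable_word n b : measurable [set t : measurableTypeR R | word n t = b].
Proof.
elim: n b => [|n IHn] [|x b] /=.
- by rewrite (_ : [set _ | _] = setT)//; apply/seteqP; split.
- by rewrite (_ : [set _ | _] = set0)//; apply/seteqP; split.
- by rewrite (_ : [set _ | _] = set0)//; apply/seteqP; split.
pose c := left b + p (false :: b).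
rewrite (_ : [set _ | _] = [set t | word n t = b] `&`
    (if x then `[c, +oo[%classic else `]-oo, c[%classic)).
  apply: measurableI; first exact: IHn.
  by case: x; exact: measurable_itv.
apply/seteqP; split=> t /=.
  move=> [+ E]; rewrite E => <-; split=> //; rewrite -/c.
  by case: (ltP t c) => h /=; rewrite in_itv /= ?andbT.
move=> [E h]; rewrite E; congr (_ :: _).
case: x h => /=; rewrite in_itv /= ?andbT => h; first by rewrite -leNgt.
by rewrite (h : t < left b + p (false :: b)).
Qed.

Lemma unit_lebesgue_word b :
  unit_lebesgue [set t : R | word (size b) t = b] = (p b)%:E.
Proof.
rewrite /unit_lebesgue /mrestr.
rewrite (_ : _ `&` _ = `[left b, left b + p b[%classic).
  rewrite lebesgue_measure_itv /= lte_fin; case: ltP => h.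
    by rewrite -EFinB; congr EFin; ring.
  by congr EFin; have := p_ge0 b; lra.
apply/seteqP; split=> t /=.
  by move=> [/eqP + ]; rewrite !in_itv /= => + /andP[t0 t1]; rewrite wordP.
rewrite in_itv /= => /andP[h1 h2]; have t0 := le_trans (left_ge0 b) h1.
have t1 := lt_le_trans h2 (left_le1 b).
by split; [apply/eqP; rewrite wordP ?h1|rewrite in_itv /= t0].
Qed.

Definition bit n t := head false (word n.+1 t).

Lemma nth_word n k t : (k < n)%N -> nth false (rev (word n t)) k = bit k t.
Proof.
elim: n k => // n IHn k; rewrite ltnS leq_eqVlt => /predU1P[->|kn].
  by rewrite /= rev_cons nth_rcons size_rev size_word ltnn eqxx.
by rewrite [word _ _]/= rev_cons nth_rcons size_rev size_word kn IHn.
Qed.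

End NestedIntervals.

Record fin_additive (R : realType) (T : Type) (m : set T -> R) : Prop := FinAdditive {
  fa_ge0 : forall E, 0 <= m E;
  fa_T : m setT = 1;
  fa_U : forall E F, E `&` F = set0 -> m (E `|` F) = m E + m F }.

Section FinAdditive.
Variables (R : realType) (T : Type) (m : set T -> R).
Hypothesis fm : fin_additive m.

Lemma fa_set0 : m set0 = 0.
Proof. by have := fa_U fm (setI0 set0); rewrite setU0 => /eqP; rewrite -subr_eq subrr eq_sym => /eqP. Qed.

Lemma fa_le E F : E `<=` F -> m E <= m F.
Proof.
move=> EF; rewrite -(setDUK EF) (fa_U fm) ?lerDl ?(fa_ge0 fm)//.
by apply/seteqP; split=> // x [? []].
Qed.

Lemma fa_le1 E : m E <= 1.
Proof. by rewrite -(fa_T fm); apply: fa_le. Qed.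

Lemma fa_seq (W : eqType) (f : T -> W) (s : seq W) : uniq s ->
  m [set x | f x \in s] = \sum_(b <- s) m [set x | f x = b].
Proof.
elim: s => [|b s IHs] /=.
  by rewrite big_nil (_ : [set _ | _] = set0) ?fa_set0//; apply/seteqP; split.
move=> /andP[bs us]; rewrite big_cons -IHs// -(fa_U fm).
  congr m; apply/seteqP; split=> x /=; rewrite inE.
    by case/predU1P => ?; [left|right].
  by case=> [->|->]; rewrite ?eqxx ?orbT.
by apply/seteqP; split=> // x /= [->]; apply/negP.
Qed.

End FinAdditive.

Section UltraLimit.
Variables (R : realType) (T : Type) (Th : nat -> set T -> R).
Hypothesis faTh : forall k, fin_additive (Th k).

(** Bounded sequences converge along an ultrafilter, so all events get a limit at once: the supremum
    of the numbers that are lower bounds on a set of the ultrafilter. Additivity is read off at a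
    single index that is close to the limit for three events. *)
Lemma ultralimit : exists (U : set_system nat) (Lam : set T -> R),
  [/\ ProperFilter U, forall n, U [set k | (n <= k)%N], fin_additive Lam &
    forall E (eps : R), 0 < eps -> U [set k | `|Th k E - Lam E| <= eps]].
Proof.
have [U [UU sU]] := @ultraFilterLemma nat (\oo : set_system nat) _.
have tail n : U [set k | (n <= k)%N] by apply: sU; exists n.
have PU : ProperFilter U by apply: ultra_proper.
pose D E := [set r : R | U [set k | r <= Th k E]].
pose Lam E := sup (D E).
have D0 E : D E 0.
  by apply: filterS (filterT : U setT) => k _ /=; apply: fa_ge0.
have Dub E : ubound (D E) 1.
  move=> r /filter_ex[k /= h]; apply: le_trans h _; exact: fa_le1.
have supD E : has_sup (D E) by split; [exists 0|exists 1].
have close E (eps : R) : 0 < eps -> U [set k | `|Th k E - Lam E| <= eps].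
  move=> e0.
  have lo : U [set k | Lam E - eps <= Th k E].
    have [r Dr hr] := sup_adherent e0 (supD E).
    by apply: filterS Dr => k /= h; apply: le_trans (ltW hr) h.
  have hi : U [set k | Th k E < Lam E + eps].
    have [h|h] := @in_ultra_setVsetC _ U [set k | Lam E + eps <= Th k E] UU.
      have : Lam E + eps <= Lam E by apply: ub_le_sup; [exists 1|].
      by rewrite gerDl leNgt e0.
    by apply: filterS h => k /= /negP; rewrite -ltNge.
  apply: filterS (filterI lo hi) => k /= [h1 h2].
  by rewrite ler_distl h1 ltW.
exists U, Lam; split=> //; split=> [E||E F EF].
- by apply: ub_le_sup; [exists 1|].
- apply/eqP; rewrite eq_le ge_sup//=; last by exists 0; exact: D0.
  apply: ub_le_sup; first by exists 1.
  by apply: filterS (filterT : U setT) => k _ /=; rewrite (fa_T (faTh k)).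
apply/eqP; rewrite -subr_eq0 -normr_eq0 eq_le normr_ge0 andbT; apply/ler_addgt0Pr => e e0.
have e30 : 0 < e / 3 by rewrite divr_gt0.
have Uall : U ([set k | `|Th k E - Lam E| <= e / 3] `&` [set k | `|Th k F - Lam F| <= e / 3] `&`
    [set k | `|Th k (E `|` F) - Lam (E `|` F)| <= e / 3]).
  by apply: filterI; [apply: filterI|]; apply: close.
have [k /= [[h1 h2] h3]] := filter_ex Uall.
move: h3; rewrite (fa_U (faTh k) EF) add0r; move: h1 h2; rewrite !ler_norml.
by move=> /andP[? ?] /andP[? ?] /andP[? ?]; apply/andP; split; lra.
Qed.

End UltraLimit.

(** * Realisation of a finitely additive law on cylinders *)

Section LimitMeasure.
Variables (R : realType) (X : choiceType) (en : nat -> option X).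
Hypothesis en_surj : forall x, exists n, en n = Some x.
Local Notation Cfg := (config X * config X)%type.

(** Bits [2k] and [2k + 1] are the first and the second configuration at the [k]-th listed point;
    both are false when [en] lists nothing at [k]. *)
Definition coord (j : nat) (w : Cfg) : bool :=
  if en j./2 is Some x then (if odd j then w.2 x else w.1 x) else false.

Fixpoint code (n : nat) (w : Cfg) : seq bool :=
  if n is m.+1 then coord m w :: code m w else [::].

Lemma size_code n w : size (code n w) = n.
Proof. by elim: n => //= n ->. Qed.

Lemma nth_code n k w : (k < n)%N -> nth false (rev (code n w)) k = coord k w.
Proof.
elim: n k => // n IHn k; rewrite ltnS leq_eqVlt => /predU1P[->|kn].
  by rewrite /= rev_cons nth_rcons size_rev size_code ltnn eqxx.
by rewrite [code _ _]/= rev_cons nth_rcons size_rev size_code kn IHn.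
Qed.

Definition determined (m : nat) (E : set Cfg) :=
  forall w w' : Cfg, (forall k x, (k < m)%N -> en k = Some x -> w.1 x = w'.1 x /\ w.2 x = w'.2 x) ->
  E w -> E w'.

Lemma determined_code m E w w' : determined m E -> code m.*2 w = code m.*2 w' -> E w -> E w'.
Proof.
move=> dE cw; apply: dE => k x km ek.
have h (b : bool) : coord (b + k.*2) w = coord (b + k.*2) w'.
  by rewrite -!(@nth_code m.*2) ?cw//; case: b; lia.
have := h false; have := h true; rewrite /coord !half_bit_double ek !oddD !odd_double /=.
by [].
Qed.

Section Construction.
Variable Lam : set Cfg -> R.
Hypothesis faL : fin_additive Lam.

Let p (b : seq bool) := Lam [set w | code (size b) w = b].

Let p_ge0 b : 0 <= p b. Proof. exact: fa_ge0. Qed.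

Let p_nil : p [::] = 1.
Proof. by rewrite -(fa_T faL); congr Lam; apply/seteqP; split. Qed.

Let p_cons b : p b = p (false :: b) + p (true :: b).
Proof.
rewrite /p -(fa_U faL).
  congr Lam; apply/seteqP; split=> w /=; last by case=> -[].
  by move=> ->; case: (coord _ _); [right|left].
by apply/seteqP; split=> // w /= [[-> _] []].
Qed.

(** [en] may list a point several times; one occurrence is chosen, and [code_Phi] shows that the
    others carry the same bits. *)
Let idx (x : X) : nat := projT1 (cid (en_surj x)).

Let en_idx x : en (idx x) = Some x. Proof. exact: (projT2 (cid (en_surj x))). Qed.

Let Phi (t : measurableTypeR R) : Cfg :=
  ((fun x => bit p (idx x).*2 t), (fun x => bit p (idx x).*2.+1 t)).

Lemma code_Phi n t : 0 <= t -> t < 1 -> code n (Phi t) = word p n t.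
Proof.
move=> t0 t1.
(* A word read at [t] has positive probability, hence is the code of some configuration. The
   relations that hold among the bits of a code, such as those due to repetitions in [en], therefore
   hold for the bits of [t]. *)
have ex N : exists w, code N w = word p N t.
  apply: contrapT => /forallNP H.
  have := wordP p_ge0 p_nil p_cons (word p N t) t0 t1.
  rewrite size_word eqxx => /esym/andP[h1 h2].
  suff p0 : p (word p N t) = 0 by move: h2; rewrite p0 addr0 ltNge h1.
  rewrite /p size_word (_ : [set _ | _] = set0) ?(fa_set0 faL)//.
  by apply/seteqP; split=> // w /H.
have bitE N w k : code N w = word p N t -> (k < N)%N -> coord k w = bit p k t.
  by move=> E kN; rewrite -(nth_code w kN) E nth_word.
suff H k : coord k (Phi t) = bit p k t.
  by elim: n => //= n ->; rewrite H.
rewrite /coord; case ek: (en k./2) => [x|]; last first.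
  have [w /bitE/(_ (ltnSn k)) <-] := ex k.+1.
  by rewrite /coord ek.
pose k' := (odd k + (idx x).*2)%N.
have [w E] := ex (k + k').+1.
have h1 := bitE _ w k E _; have h2 := bitE _ w k' E _.
rewrite -h1 ?ltnS ?leq_addr//; transitivity (bit p k' t).
  by rewrite /Phi /k'; case: (odd k).
rewrite -h2 ?ltnS ?leq_addl// /coord /k' half_bit_double en_idx ek oddD odd_double addbF.
by case: (odd k).
Qed.

Lemma measurable_word_mem n (s : seq (seq bool)) :
  measurable [set t : measurableTypeR R | word p n t \in s].
Proof.
elim: s => [|b s IHs].
  by rewrite (_ : [set _ | _] = set0)//; apply/seteqP; split.
rewrite (_ : [set _ | _] = [set t | word p n t = b] `|` [set t | word p n t \in s]).
  by apply: measurableU => //; apply: measurable_word.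
apply/seteqP; split=> t /=; rewrite inE; first by case/predU1P; [left|right].
by case=> [->|->]; rewrite ?eqxx ?orbT.
Qed.

Lemma unit_lebesgue_word_mem n (s : seq (seq bool)) : uniq s -> all (fun b => size b == n) s ->
  unit_lebesgue [set t : measurableTypeR R | word p n t \in s] = (\sum_(b <- s) p b)%:E.
Proof.
elim: s => [_ _|b s IHs /andP[bs us] /andP[/eqP bn sn]].
  by rewrite big_nil (_ : [set _ | _] = set0) ?measure0//; apply/seteqP; split.
rewrite big_cons EFinD -IHs// -(unit_lebesgue_word p_ge0 p_nil p_cons) bn.
rewrite -measureU.
- congr unit_lebesgue; apply/seteqP; split=> t /=; rewrite inE; first by case/predU1P; [left|right].
  by case=> [->|->]; rewrite ?eqxx ?orbT.
- exact: measurable_word.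
- exact: measurable_word_mem.
- by apply/seteqP; split=> // t /= [->]; apply/negP.
Qed.

Lemma measurable_Phi : measurable_fun setT Phi.
Proof.
have mb k : measurable [set t : measurableTypeR R | bit p k t].
  rewrite (_ : [set _ | _] =
      [set t | word p k.+1 t \in [seq true :: val b | b <- enum {: k.-tuple bool}]]).
    exact: measurable_word_mem.
  apply/seteqP; split=> t /=; last by case/mapP => b _ [].
  rewrite /bit /= => bt; apply/mapP.
  have sw : size (word p k t) == k by rewrite size_word.
  by exists (Tuple sw); rewrite ?mem_enum//= bt.
have mc (g : X -> nat) : measurable_fun setT (fun t : measurableTypeR R => (fun x => bit p (g x) t) : config X).
  apply: (@measurability _ _ (measurableTypeR R) (config X) setT _ (cylinders X)) => // _ [_ [x _ <-] <-].
  by rewrite setTI; apply: mb.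
by apply: measurable_fun_pair; apply: mc.
Qed.

Let Phi_mfun : {mfun measurableTypeR R >-> Cfg} := mfun_Sub (mem_set measurable_Phi).

(** An event determined by finitely many points is a finite disjoint union of word events, on which
    the image of Lebesgue measure has the values of [Lam]; finite additivity of [Lam] is all that
    this takes. *)
Lemma limit_law : exists mu : probability Cfg R,
  forall m E, determined m E -> mu E = (Lam E)%:E.
Proof.
exists (distribution (@unit_lebesgue R) Phi_mfun) => m E dE.
pose n := m.*2.
pose s := [seq b <- [seq val b | b <- enum {: n.-tuple bool}] | `[< exists2 w, E w & code n w = b >]].
have us : uniq s by rewrite filter_uniq// map_inj_uniq ?enum_uniq//; apply: val_inj.
have sn : all (fun b => size b == n) s.
  by apply/allP => b; rewrite mem_filter => /andP[_ /mapP[c _ ->]]; rewrite size_tuple.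
have Es w : E w <-> code n w \in s.
  split=> [Ew|].
    rewrite mem_filter; apply/andP; split; first by apply/asboolP; exists w.
    by apply/mapP; exists (Tuple (introT eqP (size_code n w))); rewrite ?mem_enum.
  rewrite mem_filter => /andP[/asboolP[w' Ew' E'] _].
  by apply: determined_code dE E' Ew'.
have -> : Lam E = \sum_(b <- s) p b.
  rewrite (_ : E = [set w | code n w \in s]); last by apply/seteqP; split=> w /Es.
  rewrite (fa_seq faL)//; apply: eq_big_seq => b bs; rewrite /p.
  by have /eqP -> := allP sn b bs.
rewrite -(unit_lebesgue_word_mem us sn) /distribution /pushforward /unit_lebesgue /mrestr.
congr (lebesgue_measure _); apply/seteqP; split=> t /= [h]; rewrite in_itv /= => /andP[t0 t1].
  by split; rewrite ?in_itv /= ?t0//; rewrite -code_Phi//; apply/Es.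
by split; rewrite ?in_itv /= ?t0//; apply/Es; rewrite [code _ _]code_Phi.
Qed.

End Construction.

(** At stage [m] only finitely many words matter, so some index of the ultrafilter beyond [m] is
    close on all of them. This extracts an ordinary sequence. *)
Lemma limit_measure (Th : nat -> set Cfg -> R) : (forall k, fin_additive (Th k)) ->
  exists (mu : probability Cfg R) (phi : nat -> nat), forall m, (m <= phi m)%N /\
    forall E, determined m E -> `|Th (phi m) E - fine (mu E)| <= m.+1%:R^-1.
Proof.
move=> faTh; have [U [Lam [PU tailU faL close]]] := ultralimit faTh.
have [mu Hmu] := limit_law faL; exists mu.
suff H m : exists k, (m <= k)%N /\
    forall E, determined m E -> `|Th k E - Lam E| <= m.+1%:R^-1.
  have [phi Hphi] := choice H; exists phi => m; have [h1 h2] := Hphi m; split=> // E dE.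
  by rewrite (Hmu m)//=; apply: h2.
pose n := m.*2; pose ws := [seq val b | b <- enum {: n.-tuple bool}].
(* Divided by the number of words, to make the error uniform over all the events that they
   determine. *)
pose eps : R := (m.+1%:R * (size ws).+1%:R)^-1.
have eps0 : 0 < eps by rewrite invr_gt0 mulr_gt0 ?ltr0n.
have uws : uniq ws by rewrite map_inj_uniq ?enum_uniq//; apply: val_inj.
have Uall (s : seq (seq bool)) :
    U [set k | forall b, b \in s -> `|Th k [set w | code n w = b] - Lam [set w | code n w = b]| <= eps].
  elim: s => [|b s IHs]; first by apply: filterS (filterT : U setT) => k _ b.
  apply: filterS (filterI (close [set w | code n w = b] _ eps0) IHs) => k [h1 h2] b'.
  by rewrite inE => /predU1P[->//|]; apply: h2.
have /filter_ex[k [/= km Hk]] : U ([set k | (m <= k)%N] `&`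
   [set k | forall b, b \in ws -> `|Th k [set w | code n w = b] - Lam [set w | code n w = b]| <= eps]).
  by apply: filterI.
exists k; split=> // E dE.
pose s := [seq b <- ws | `[< exists2 w, E w & code n w = b >]].
have us : uniq s by rewrite filter_uniq.
have EE : E = [set w | code n w \in s].
  apply/seteqP; split=> w /= => [Ew|].
    rewrite mem_filter; apply/andP; split; first by apply/asboolP; exists w.
    by apply/mapP; exists (Tuple (introT eqP (size_code n w))); rewrite ?mem_enum.
  rewrite mem_filter => /andP[/asboolP[w' Ew' E'] _].
  by apply: determined_code dE E' Ew'.
rewrite EE !fa_seq// -sumrB; apply: le_trans (ler_norm_sum _ _ _) _.
apply: (@le_trans _ _ (\sum_(b <- s) eps)).
  by rewrite big_seq [leRHS]big_seq; apply: ler_sum => b; rewrite mem_filter => /andP[_ /Hk].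
rewrite big_const_seq count_predT iter_addr_0 -[leLHS]mulr_natl.
have ss : (size s <= size ws)%N by rewrite size_filter count_size.
rewrite /eps invfM mulrCA; apply: ler_piMr; first by rewrite invr_ge0 ler0n.
by rewrite ler_pdivrMr ?ltr0n// mul1r ler_nat leqW.
Qed.

End LimitMeasure.

(** * Finite networks *)

Lemma inj_surj_bijective (T T' : Type) (f : T -> T') :
  injective f -> (forall y, exists x, f x = y) -> bijective f.
Proof.
move=> fi fs; have [g gK] := choice fs.
by exists g => // x; apply: fi; rewrite gK.
Qed.

Section Riso.
Variables A B : Type.
Implicit Types N : rnet A B.

Lemma riso_sym N N' : riso N N' -> riso N' N.
Proof.
move=> [f [h [[f' fK f'K] [h' hK h'K] fb fe [fv fm]]]].
exists f', h'; split.
- by exists f.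
- by exists h.
- by rewrite -fb fK.
- by move=> e; have [h1 h2] := fe (h' e); rewrite -{2 4}(h'K e) h1 h2 !fK.
- by split=> [v|e]; [rewrite -[RHS](congr1 _ (f'K v)) fv|rewrite -[in RHS](h'K e) fm].
Qed.

Lemma riso_trans N1 N2 N3 : riso N1 N2 -> riso N2 N3 -> riso N1 N3.
Proof.
move=> [f [h [bf bh fb fe [fv fm]]]] [f' [h' [bf' bh' fb' fe' [fv' fm']]]].
exists (f' \o f), (h' \o h); split.
- exact: bij_comp.
- exact: bij_comp.
- by rewrite /= fb.
- by move=> e /=; have [-> ->] := fe' (h e); have [-> ->] := fe e.
- by split=> [v|e] /=; rewrite ?fv' ?fv ?fm' ?fm.
Qed.

Definition in_ball N r (e : edge N) := within r (src e) /\ within r (tgt e).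

(* [H] is the graph of the bijection between the edges of the two balls. *)
Lemma ball_riso N N' r (f : vert N -> vert N') (H : edge N -> edge N' -> Prop) :
  f (base N) = base N' ->
  (forall v, within r v -> within r (f v)) ->
  (forall v', within r v' -> exists2 v, within r v & f v = v') ->
  (forall v w, within r v -> within r w -> f v = f w -> v = w) ->
  (forall v, within r v -> vmark (f v) = vmark v) ->
  (forall e, in_ball r e -> exists e', H e e') ->
  (forall e', in_ball r e' -> exists2 e, in_ball r e & H e e') ->
  (forall e e', in_ball r e -> H e e' ->
     [/\ src e' = f (src e), tgt e' = f (tgt e) & emark e' = emark e]) ->
  (forall e e1 e2, H e e1 -> H e e2 -> e1 = e2) ->
  (forall e1 e2 e', in_ball r e1 -> in_ball r e2 -> H e1 e' -> H e2 e' -> e1 = e2) ->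
  riso (nball N r) (nball N' r).
Proof.
move=> fb fw fs fi fm Hex Hs Hc Hf Hi.
pose F (v : vert (nball N r)) : vert (nball N' r) := exist _ (f (sval v)) (fw _ (svalP v)).
have ex (e : edge (nball N r)) : exists e' : edge (nball N' r), H (sval e) (sval e').
  have [e' He'] := Hex _ (svalP e); have [s1 t1 _] := Hc _ _ (svalP e) He'.
  have be' : in_ball r e'.
    by rewrite /in_ball s1 t1; split; apply: (fw _); case: (svalP e).
  by exists (exist _ e' be').
have [h hH] := choice ex.
exists F, h; split.
- apply: inj_surj_bijective => [v1 v2 E|v'].
    by apply: sval_inj; exact: (fi _ _ (svalP v1) (svalP v2) (congr1 sval E)).
  by have [v wv E] := fs _ (svalP v'); exists (exist _ v wv); apply: sval_inj.
- apply: inj_surj_bijective => [e1 e2 E|e'].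
    apply: sval_inj; apply: (Hi _ _ (sval (h e1)) (svalP e1) (svalP e2) (hH e1)).
    by rewrite E; apply: hH.
  have [e be He] := Hs _ (svalP e'); exists (exist _ e be); apply: sval_inj.
  exact: (Hf _ _ _ (hH (exist _ e be)) He).
- exact: sval_inj.
- by move=> e; have [s1 t1 _] := Hc _ _ (svalP e) (hH e); split; apply: sval_inj.
- split=> [v|e]; first exact: (fm _ (svalP v)).
  by have [_ _ E] := Hc _ _ (svalP e) (hH e); exact: E.
Qed.

End Riso.

Section CayleyBalls.
Variables (Gam : groupType) (S : {fset Gam}) (A B : Type).
Variables (vm : Gam -> A) (em : Gam * S -> B).

Fixpoint cay_ball (r : nat) : seq Gam :=
  if r is r'.+1 then
    cay_ball r' ++ [seq (g * fsval s)%g | g <- cay_ball r', s <- enum {: S}] ++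
      [seq (g * (fsval s)^-1)%g | g <- cay_ball r', s <- enum {: S}]
  else [:: 1%g].

Lemma cay_ballP r g : within (N := cayley vm em) r g <-> g \in cay_ball r.
Proof.
elim: r g => [|r IHr] g /=; first by rewrite inE; split=> [->|/eqP].
rewrite !mem_cat; split=> [[/IHr ->//|[[h s] /= [[/IHr hr <-]|[/IHr hr <-]]]]|].
- by apply/orP; right; apply/orP; left; apply/allpairsP; exists (h, s); rewrite mem_enum.
- apply/orP; right; apply/orP; right; apply/allpairsP; exists ((h * fsval s)%g, s).
  by rewrite mem_enum mulgK.
case/or3P => [/IHr|/allpairsP[[h s] /= [/IHr hr _ ->]]|/allpairsP[[h s] /= [/IHr hr _ ->]]].
- by left.
- by right; exists (h, s); left.
by right; exists ((h * (fsval s)^-1)%g, s); right; rewrite /= -mulgA mulVg mulg1.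
Qed.

Lemma cay_ball_le r r' : (r <= r')%N -> {subset cay_ball r <= cay_ball r'}.
Proof.
move=> /subnKC <-; elim: (r' - r)%N => [|k IHk] g; first by rewrite addn0.
by move=> /IHk; rewrite addnS /= mem_cat => ->.
Qed.

Lemma cay_ballM r g (s : S) : g \in cay_ball r -> (g * fsval s)%g \in cay_ball r.+1.
Proof.
move=> gr; rewrite /= !mem_cat; apply/orP; right; apply/orP; left.
by apply/allpairsP; exists (g, s); rewrite mem_enum.
Qed.

Lemma cay_ballMV r g (s : S) : g \in cay_ball r -> (g * (fsval s)^-1)%g \in cay_ball r.+1.
Proof.
move=> gr; rewrite /= !mem_cat; apply/orP; right; apply/orP; right.
by apply/allpairsP; exists (g, s); rewrite mem_enum.
Qed.

Lemma cay_ball1 r : 1%g \in cay_ball r.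
Proof. by apply: (@cay_ball_le 0) => //; rewrite inE. Qed.

Lemma cay_ballS r (s : S) : fsval s \in cay_ball r.+1.
Proof. by rewrite -(mul1g (fsval s)); apply/cay_ballM/cay_ball1. Qed.

Lemma cay_ballSV r (s : S) : (fsval s)^-1%g \in cay_ball r.+1.
Proof. by rewrite -(mul1g (_^-1)%g); apply/cay_ballMV/cay_ball1. Qed.

End CayleyBalls.

Lemma cayley_ball_riso (Gam : groupType) (S : {fset Gam}) (A B : Type)
    (vm vm' : Gam -> A) (em em' : Gam * S -> B) r :
  (forall g, g \in cay_ball S r -> vm g = vm' g) ->
  (forall g s, g \in cay_ball S r -> em (g, s) = em' (g, s)) ->
  riso (nball (cayley vm em) r) (nball (cayley vm' em') r).
Proof.
move=> hv he.
apply: (@ball_riso _ _ (cayley vm em) (cayley vm' em') r id (fun e e' => e = e')) => //.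
- by move=> v /cay_ballP h; apply/cay_ballP.
- by move=> v /cay_ballP h; exists v => //; apply/cay_ballP.
- by move=> v /cay_ballP/hv E; exact: (esym E).
- by move=> e; exists e.
- by move=> e' [/cay_ballP h1 /cay_ballP h2]; exists e' => //; split; apply/cay_ballP.
- by move=> [g s] e' [/cay_ballP h _] <- /=; rewrite he.
- by move=> e e1 e2 <- <-.
- by move=> e1 e2 e' _ _ -> ->.
Qed.

Section SoficNet.
Variables (Gam : groupType) (S : {fset Gam}) (A B : Type).
Variables (V C : finType) (act : V -> Gam -> V).
Variables (vm : V * C -> A) (em : V * S * C -> B).
Hypothesis VC_gt0 : (0 < #|{: V * C}|)%N.

(** The condition rules out stray edges into the ball of a good [v]: an edge labelled [s] that ends
    at [act v g] must start at [act v (g * s^-1)]. The factor [C] indexes disjoint copies. *)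
Definition net_edge : finType :=
  {e : V * S * C | act (act e.1.1 (fsval e.1.2)) (fsval e.1.2)^-1%g == e.1.1}.

Definition sofic_net : finnet A B := @FinNet A B (V * C)%type net_edge
  (fun e => ((val e).1.1, (val e).2)) (fun e => (act (val e).1.1 (fsval (val e).1.2), (val e).2))
  vm (fun e => em (val e)) VC_gt0.

Variables (r : nat) (v : V) (c : C).
Hypothesis good : sofic_window act (cay_ball S r.+1) v.

Let net := rooted_at (G := sofic_net) (v, c).

Let act1 : act v 1%g = v. Proof. by case: good. Qed.

Let actM g h : g \in cay_ball S r.+1 -> h \in cay_ball S r.+1 -> act (act v g) h = act v (g * h)%g.
Proof. by case: good => _ H _; apply: H. Qed.

Let act_inj : {in cay_ball S r.+1 &, injective (act v)}.
Proof. by case: good. Qed.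

Let rball k : (k <= r)%N -> {subset cay_ball S k <= cay_ball S r.+1}.
Proof. by move=> kr; apply: cay_ball_le; apply: leqW. Qed.

Lemma net_edge_proof g (s : S) : g \in cay_ball S r.+1 -> (g * fsval s)%g \in cay_ball S r.+1 ->
  act (act (act v g) (fsval s)) (fsval s)^-1%g == act v g.
Proof.
by move=> gr gsr; rewrite actM ?cay_ballS// actM ?cay_ballSV// mulgK.
Qed.

Lemma net_within k (u : V * C) : (k <= r)%N ->
  within (N := net) k u <-> exists2 g, g \in cay_ball S k & u = (act v g, c).
Proof.
elim: k u => [|k IHk] u kr.
  rewrite /=; split=> [->|[g]]; first by exists 1%g; rewrite ?inE// act1.
  by rewrite inE => /eqP -> ->; rewrite act1.
have {}IHk := IHk _ (ltnW kr); have kr' := ltnW kr.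
split=> /=.
  case=> [/IHk[g gk ->]|[[[[x s] d] /= xe]]].
    by exists g => //; exact: (cay_ball_le (leqnSn k) gk).
  case=> -[/IHk[g gk]].
    move=> [-> ->] <-; exists (g * fsval s)%g; first exact: cay_ballM.
    by rewrite actM ?cay_ballS// (rball kr').
  move=> [E ->] <-; exists (g * (fsval s)^-1)%g; first exact: cay_ballMV.
  by rewrite -(eqP xe) E actM ?cay_ballSV// (rball kr').
move=> [g gk ->].
have : within (N := cayley (fun=> tt) (fun e : Gam * S => tt)) k.+1 g by apply/cay_ballP.
case=> [/cay_ballP gk'|[[h s] /= []]]; first by left; apply/IHk; exists g.
  move=> [/cay_ballP hk E]; right.
  have p : act (act (act v h) (fsval s)) (fsval s)^-1%g == act v h.
    by apply: net_edge_proof; [exact: (rball kr' hk)|rewrite E; exact: (rball kr gk)].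
  exists (exist _ (act v h, s, c) p : net_edge); left => /=; split; first by apply/IHk; exists h.
  by rewrite actM ?cay_ballS ?E// (rball kr').
move=> [/cay_ballP hk E]; right; rewrite E in hk *.
have p : act (act (act v g) (fsval s)) (fsval s)^-1%g == act v g.
  by apply: net_edge_proof; [exact: (rball kr gk)|exact: (rball kr' hk)].
exists (exist _ (act v g, s, c) p : net_edge); right => /=; split => //.
apply/IHk; exists (g * fsval s)%g => //.
by rewrite actM ?cay_ballS ?(rball kr gk).
Qed.

Lemma sofic_net_riso (vm0 : Gam -> A) (em0 : Gam * S -> B) :
  (forall g, g \in cay_ball S r -> vm (act v g, c) = vm0 g) ->
  (forall g s, g \in cay_ball S r -> em (act v g, s, c) = em0 (g, s)) ->
  riso (nball net r) (nball (cayley vm0 em0) r).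
Proof.
move=> hv he; apply: riso_sym.
have lift g : g \in cay_ball S r -> g \in cay_ball S r.+1 by apply: rball.
pose H (e : Gam * S) (e' : net_edge) := val e' = (act v e.1, e.2, c).
have inE_ e : in_ball (N := cayley vm0 em0) r e ->
    e.1 \in cay_ball S r /\ (e.1 * fsval e.2)%g \in cay_ball S r.
  by move=> [/cay_ballP h1 /cay_ballP h2].
apply: (@ball_riso _ _ (cayley vm0 em0) net r (fun g => (act v g, c)) H).
- by rewrite /= act1.
- by move=> g /cay_ballP gr; apply/net_within => //; exists g.
- by move=> u /(net_within _ (leqnn r))[g gr ->]; exists g => //; apply/cay_ballP.
- by move=> g h /cay_ballP/lift gr /cay_ballP/lift hr [/act_inj]; apply.
- by move=> g /cay_ballP; exact: hv.
- move=> [g s] /inE_ /= [gr gsr].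
  by exists (exist _ (act v g, s, c) (net_edge_proof (lift _ gr) (lift _ gsr)) : net_edge).
- move=> [[[x s] d] p] [].
  move=> /(net_within _ (leqnn r))[g gr] /= [xg dc].
  move=> /(net_within _ (leqnn r))[h hr] /= [xh _].
  have gsh : (g * fsval s)%g = h.
    apply: act_inj; rewrite ?cay_ballM ?lift//.
    by rewrite -actM ?cay_ballS ?lift// -xg.
  exists (g, s); last by rewrite /H /= xg dc.
  by split; apply/cay_ballP; rewrite //= gsh.
- move=> [g s] e' /inE_ /= [gr gsr] He; rewrite He /=; split=> //.
    by rewrite actM ?cay_ballS ?lift.
  exact: he.
- by move=> e e1 e2 h1 h2; apply: val_inj; rewrite h1 h2.
- move=> [g s] [g' s'] e' /inE_ /= [gr _] /inE_ /= [gr' _]; rewrite /H => -> /= [E ->].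
  by congr (_, _); apply: act_inj; rewrite ?lift.
Qed.

End SoficNet.

(** * Convergence *)

Section DetLipschitz.
Variable R : realType.

Lemma csq_prod_sub (I : Type) (r : seq I) (x y : I -> R[i]) (b : R) : 1 <= b ->
  (forall i, csq (x i) <= b) -> (forall i, csq (y i) <= b) ->
  csq (\prod_(i <- r) x i - \prod_(i <- r) y i) <=
  (2 * b) ^+ size r * \sum_(i <- r) csq (x i - y i).
Proof.
move=> b1 xb yb; have b0 : 0 <= b by apply: le_trans b1.
elim: r => [|i r IHr]; first by rewrite !big_nil subrr csq0 mulr0.
have Pb : csq (\prod_(i <- r) x i) <= b ^+ size r.
  elim: r {IHr} => [|j r IHr]; first by rewrite big_nil /csq /= expr1n expr0n addr0.
  by rewrite big_cons csqM exprS ler_pM ?csq_ge0.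
rewrite !big_cons; move: (\prod_(j <- r) x j) (\prod_(j <- r) y j) IHr Pb => P Q IHr Pb.
have -> : x i * P - y i * Q = (x i - y i) * P + y i * (P - Q) by ring.
set S := \sum_(j <- r) _ in IHr *; set n := size r in IHr Pb *.
have -> : size (i :: r) = n.+1 by [].
apply: le_trans (csqD_le _ _) _; rewrite !csqM [leRHS]mulrDr [(2 * b) ^+ n.+1]exprS; apply: lerD.
  have h : csq (x i - y i) * csq P <= csq (x i - y i) * b ^+ n by rewrite ler_wpM2l ?csq_ge0.
  have h2 : b ^+ n <= b * (2 * b) ^+ n.
    rewrite exprMn -[leLHS]mul1r; apply: ler_pM; rewrite ?exprn_ge0//.
    by rewrite ler_peMl ?exprn_ge0// exprn_ege1// ler1n.
  have h3 := ler_wpM2l (csq_ge0 (x i - y i)) h2.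
  have := le_trans h h3; rewrite [X in _ <= X -> _]mulrA; set z := csq (x i - y i).
  by move=> ?; rewrite (_ : 2 * b * (2 * b) ^+ n * z = 2 * (z * b * (2 * b) ^+ n)) ?ler_pM2l//; ring.
have h : csq (y i) * csq (P - Q) <= b * ((2 * b) ^+ n * S) by apply: ler_pM; rewrite ?csq_ge0.
by rewrite -!mulrA ler_pM2l.
Qed.

Lemma csq_det_sub n (A B : 'M[R[i]]_n) (b : R) : 1 <= b ->
  (forall i j, csq (A i j) <= b) -> (forall i j, csq (B i j) <= b) ->
  csq (\det A - \det B) <=
  (#|{perm 'I_n}|%:R * #|{perm 'I_n}|%:R * (2 * b) ^+ n) * \sum_i \sum_j csq (A i j - B i j).
Proof.
move=> b1 Ab Bb; have b0 : 0 <= b by apply: le_trans b1.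
rewrite /determinant -sumrB; apply: le_trans (csq_sum_le _ _) _.
rewrite {1}/index_enum -enumT -cardT -!mulrA ler_wpM2l ?ler0n//.
have -> : forall c : R, #|{perm 'I_n}|%:R * c = \sum_(s : {perm 'I_n}) c.
  by move=> c; rewrite sumr_const mulr_natl.
apply: ler_sum => s _; rewrite -mulrBr csqM.
have -> : csq ((-1) ^+ s : R[i]) = 1.
  by case: (odd_perm s); rewrite ?expr1 ?expr0 /csq /= ?oppr0 ?expr0n ?sqrrN expr1n addr0.
rewrite mul1r; apply: le_trans (csq_prod_sub _ b1 (fun i => Ab i (s i)) (fun i => Bb i (s i))) _.
rewrite {1}/index_enum -enumT -cardT card_ord ler_wpM2l ?exprn_ge0 ?mulr_ge0//.
apply: ler_sum => i _; rewrite (bigD1 (s i))//= lerDl sumr_ge0// => j _; exact: csq_ge0.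
Qed.

End DetLipschitz.

Lemma empirical_weights (R : realType) (Om : finType) (wt : Om -> R) (eps : R) :
  (forall om, 0 <= wt om) -> \sum_om wt om = 1 -> 0 < eps ->
  exists (n : nat) (kap : 'I_n.+1 -> Om),
    \sum_om `|#|[pred c | kap c == om]|%:R / n.+1%:R - wt om| <= eps.
Proof.
move=> w0 w1 e0.
have [om0 _] : exists om0 : Om, True.
  apply: contrapT => /forallNP H; move: w1; rewrite big1 => [/eqP|om]; last by case: (H om).
  by rewrite eq_sym oner_eq0.
(* Rounding down loses less than 1 per outcome, and the leftover goes to [om0]; the total deviation
   is thus at most [2 * N / (n + 1)]. *)
pose N := #|Om|; pose n := Num.truncn (2 * N%:R / eps).
have nR : 0 < n.+1%:R :> R by rewrite ltr0n.
have nN : 2 * N%:R <= eps * n.+1%:R.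
  by rewrite [leRHS]mulrC -ler_pdivrMr//; apply: ltW; apply: truncnS_gt.
pose f om := Num.truncn (n.+1%:R * wt om).
have fP om : (f om)%:R <= n.+1%:R * wt om < (f om).+1%:R.
  by apply: truncn_itv; rewrite mulr_ge0// ltW.
pose k := (\sum_om f om)%N.
have kn : (k <= n.+1)%N.
  rewrite -(ler_nat R) natr_sum; apply: (@le_trans _ _ (\sum_om n.+1%:R * wt om)).
    by apply: ler_sum => om _; case/andP: (fP om).
  by rewrite -mulr_sumr w1 mulr1.
pose s0 := flatten [seq nseq (f om) om | om <- enum Om].
have cs0 om : count_mem om s0 = f om.
  rewrite count_flatten -map_comp sumnE big_map big_enum /= (bigD1 om)//= count_nseq /= eqxx mul1n.
  by rewrite big1 ?addn0// => om' /negbTE om'om; rewrite count_nseq /= om'om mul0n.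
have ss0 : size s0 = k.
  rewrite size_flatten /shape -map_comp sumnE big_map big_enum /=.
  by apply: eq_bigr => om _; rewrite size_nseq.
pose s := s0 ++ nseq (n.+1 - k) om0.
have ss : size s = n.+1 by rewrite size_cat size_nseq ss0 subnKC.
pose kap (c : 'I_n.+1) := nth om0 s c.
have ckap om : #|[pred c | kap c == om]| = (f om + (om0 == om) * (n.+1 - k))%N.
  have smap : [seq kap c | c <- enum 'I_n.+1] = s.
    rewrite (map_comp (nth om0 s) val) val_enum_ord.
    by rewrite -[RHS](mkseq_nth om0) ss.
  rewrite -cs0 -(count_nseq (pred1 om)) -count_cat -/s -[in RHS]smap count_map.
  rewrite -sum1_card -sum1_count big_enum_cond /=; apply: eq_bigl => c; by rewrite inE.
exists n, kap.
have fle om : (f om)%:R <= n.+1%:R * wt om by case/andP: (fP om).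
have diff om : `|#|[pred c | kap c == om]|%:R / n.+1%:R - wt om| <=
    ((n.+1%:R * wt om - (f om)%:R) + (om0 == om)%:R * (n.+1 - k)%:R) / n.+1%:R.
  rewrite ckap natrD natrM ler_pdivlMr//.
  rewrite -[X in _ * X](ger0_norm (ltW nR)) -normrM mulrBl divfK ?gt_eqF//.
  have := fle om; move: (_ * (n.+1 - k)%:R) (mulr_ge0 (ler0n R (om0 == om)) (ler0n R (n.+1 - k))).
  move=> z z0 h; rewrite [wt om * _]mulrC; apply: (@le_trans _ _ (`|z| + `|(f om)%:R - n.+1%:R * wt om|)).
    by rewrite [_ + z]addrC -addrA ler_normD.
  by rewrite (ger0_norm z0) distrC ger0_norm ?subr_ge0// addrC.
apply: le_trans (ler_sum _ (fun om _ => diff om)) _.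
rewrite -mulr_suml big_split /= sumrB -mulr_sumr w1 mulr1 -natr_sum -/k -mulr_suml.
have -> : \sum_om (om0 == om)%:R = 1 :> R.
  by rewrite (bigD1 om0)//= eqxx big1 ?addr0// => om /negbTE; rewrite eq_sym => ->.
rewrite mul1r natrB// ler_pdivrMr//.
suff : n.+1%:R - k%:R <= N%:R :> R by lra.
have -> : n.+1%:R - k%:R = \sum_om (n.+1%:R * wt om - (f om)%:R).
  by rewrite sumrB -mulr_sumr w1 mulr1 /k natr_sum.
apply: (@le_trans _ _ (\sum_(om : Om) 1)); last by rewrite sumr_const.
apply: ler_sum => om _; have /andP[_ h] := fP om; rewrite -natr1 in h; lra.
Qed.

(** * Laws seen from a uniform vertex of a finite model *)

Section Frequencies.
Variables (R : realType) (Gam : groupType) (X : choiceType) (a : gaction Gam X).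
Variables (J : finType) (pos : X -> Gam) (typ : X -> J) (mk : Gam -> J -> X).
Hypothesis posK : forall x, mk (pos x) (typ x) = x.
Hypothesis pos_mk : forall g j, pos (mk g j) = g.
Hypothesis typ_mk : forall g j, typ (mk g j) = j.
Hypothesis actE : forall g x, a g x = mk (g * pos x)%g (typ x).
Local Notation H := (l2 R X).
Local Notation Cfg := (config X * config X)%type.
Variable T : 'I_3 -> H -> H.
Hypothesis pT : forall i, pcontr a (T i).
Hypothesis sT : forall u, \sum_i T i u = u.

Local Notation model := (model R Gam J).
Local Notation good_model := (good_model pos typ T).
Local Notation mspot := (fun M : model => spot pos typ (@mact _ _ _ M)).

Lemma good_model_sub L L' B B' eps eps' M : {subset L <= L'} -> {subset B <= B'} ->
  eps' <= eps -> good_model L' B' eps' M -> good_model L B eps M.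
Proof.
move=> sL sB le_e [h1 h2 h3 h4 h5 h6 h7 h8 h9].
have le_eV : eps' * #|mV M|%:R <= eps * #|mV M|%:R by rewrite ler_wpM2r.
split=> //.
- exact: le_trans le_eV.
- move=> v /h3[w1 w2 w3]; split=> // [g h /sL gL /sL hL|g h /sL gL /sL hL]; first exact: w2.
  exact: w3.
- by move=> c x y /sB xB /sB yB; apply: le_trans (h9 _ _ _ xB yB) le_eV.
Qed.

Definition conf (M : model) (v : mV M) (om : mOm M) : Cfg :=
  ((fun x => mA false om (mspot M v x)), (fun x => mA true om (mspot M v x))).

Definition vfreq (M : model) (E : set Cfg) (v : mV M) : R :=
  \sum_om mwt om * (`[< E (conf v om) >])%:R.

Definition freq (M : model) (E : set Cfg) : R := (\sum_(v : mV M) vfreq E v) / #|mV M|%:R.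

Definition depends (s : seq X) (E : set Cfg) :=
  forall w w' : Cfg, {in s, forall x, w.1 x = w'.1 x /\ w.2 x = w'.2 x} -> E w -> E w'.

Lemma dependsC s E : depends s E -> depends s (~` E).
Proof.
move=> dE w w' ww' /= nE Ew'; apply/nE/(dE w' w) => // x /ww'[-> ->].
by [].
Qed.

Section OneModel.
Variables (L : seq Gam) (B : seq X) (eps : R) (M : model).
Hypothesis gM : good_model L B eps M.

Let V0 : 0 < #|mV M|%:R :> R.
Proof. by rewrite ltr0n; exact: gm_card gM. Qed.

Lemma vfreq_ge0 E (v : mV M) : 0 <= vfreq E v.
Proof. by apply: sumr_ge0 => om _; rewrite mulr_ge0 ?ler0n// (gm_wt_ge0 gM). Qed.

Lemma vfreq_le1 E (v : mV M) : vfreq E v <= 1.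
Proof.
rewrite -(gm_wt1 gM); apply: ler_sum => om _; rewrite ler_piMr ?(gm_wt_ge0 gM)//.
by case: asboolP.
Qed.

Lemma freq_fin_additive : fin_additive (@freq M).
Proof.
split=> [E||E F EF].
- by rewrite divr_ge0// sumr_ge0// => v _; apply: vfreq_ge0.
- rewrite /freq (eq_bigr (fun=> 1)) => [|v _]; first by rewrite sumr_const divff ?gt_eqF.
  by rewrite -(gm_wt1 gM); apply: eq_bigr => om _; rewrite asboolT// mulr1.
rewrite /freq -mulrDl -big_split; congr (_ / _); apply: eq_bigr => v _.
rewrite /vfreq -big_split; apply: eq_bigr => om _ /=; rewrite -mulrDr; congr (_ * _).
case: (asboolP (E _)) => Ew; case: (asboolP (F _)) => Fw.
- by have : (E `&` F) (conf v om) by []; rewrite EF.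
- by rewrite asboolT ?addr0//; left.
- by rewrite asboolT ?add0r//; right.
- by rewrite asboolF ?addr0// => -[].
Qed.

Lemma freq_mono x : freq M [set w : Cfg | w.1 x /\ ~ w.2 x] = 0.
Proof.
rewrite /freq big1 ?mul0r// => v _; rewrite /vfreq big1// => om _.
case: (eqVneq (mwt om) 0) => [->|w0]; first by rewrite mul0r.
rewrite asboolF ?mulr0//= => -[h1]; apply.
exact: gm_mono gM _ w0 _ h1.
Qed.

Lemma average_le (h : mV M -> R) (b K : R) : 0 <= b ->
  (forall v, v \notin mG M -> h v <= b) -> \sum_(v in mG M) h v <= K * #|mV M|%:R ->
  (\sum_(v : mV M) h v) / #|mV M|%:R <= K + eps * b.
Proof.
move=> b0 hb hK; rewrite ler_pdivrMr// (bigID (mem (mG M)))/= mulrDl lerD//.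
apply: (@le_trans _ _ (\sum_(v | v \notin mG M) b)); first exact: ler_sum.
rewrite sumr_const -[leLHS]mulr_natl [leRHS]mulrAC ler_wpM2r//.
apply: le_trans (gm_bad gM); rewrite ler_nat subset_leq_card//.
by apply/fintype.subsetP => v; rewrite !inE.
Qed.

(** Shifting by [g] amounts to moving the root to [mact v g^-1], which is injective on the good
    vertices. This gives one inequality; the complement of [E] gives the other. *)
Lemma freq_shift g s E : depends s E ->
  g \in L -> g^-1%g \in L -> {in s, forall x, pos x \in L} ->
  `|freq M [set w | E (cshift a g w.1, cshift a g w.2)] - freq M E| <= eps.
Proof.
move=> dE gL gVL sL.
have half F : depends s F -> freq M [set w | F (cshift a g w.1, cshift a g w.2)] <= freq M F + eps.
  move=> dF; rewrite -[eps]mulr1; apply: (average_le ler01) => [v _|]; first exact: vfreq_le1.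
  rewrite mulfVK ?gt_eqF//.
  have inj : {in mG M &, injective (fun v => mact v g^-1%g)}.
    move=> v v' /(gm_window gM)[v1 vM _] /(gm_window gM)[v1' vM' _] E'.
    by rewrite -v1 -v1' -(mulVg g) -vM// -vM'// E'.
  apply: (@le_trans _ _ (\sum_(v in mG M) vfreq F (mact v g^-1%g))).
    apply: ler_sum => v vG; apply: ler_sum => om _; rewrite ler_wpM2l ?(gm_wt_ge0 gM)//.
    rewrite ler_nat; case: asboolP => //= Fw; rewrite asboolT//.
    apply: dF Fw => x xs; rewrite /cshift /=.
    by rewrite -(spot_act pos_mk typ_mk actE (gm_window gM) vG gVL (sL _ xs)).
  rewrite -(big_imset (vfreq F) inj) /= [leRHS](bigID (mem [set mact v g^-1%g | v in mG M]%SET)) /=.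
  by rewrite lerDl sumr_ge0// => v _; apply: vfreq_ge0.
have fC F : freq M (~` F) = 1 - freq M F.
  have fa := freq_fin_additive.
  by rewrite -(fa_T fa) -(setUv F) (fa_U fa) ?setICr// addrAC subrr add0r.
have h1 := half E dE; have h2 := half (~` E) (dependsC dE).
rewrite (_ : [set w | _] = ~` [set w | E (cshift a g w.1, cshift a g w.2)]) // in h2.
by rewrite !fC in h2; rewrite ler_norml; apply/andP; split; lra.
Qed.

Definition incl c (A : {fset X}) : set Cfg :=
  [set w : Cfg | forall x, x \in A -> (if c then w.2 else w.1) x].

Lemma vfreq_incl c (A : {fset X}) (v : mV M) :
  vfreq (incl c A) v =
  \sum_(om | [forall i : 'I_#|{: A}|, mA c om (mspot M v (fsval (enum_val i)))]) mwt om.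
Proof.
rewrite /vfreq [RHS]big_mkcond; apply: eq_bigr => om _.
case: asboolP => [h|h]; case: ifP => //; rewrite ?mulr1 ?mulr0//.
  move=> /negP; case; apply/forallP => i; have := h (fsval (enum_val i)) (fsvalP _).
  by case: c {h}.
move=> /forallP H; case: h => x xA; have := H (enum_rank [` xA]%fset).
by rewrite enum_rankK /=; case: c {H}.
Qed.

Lemma csq_class_op c x y : csq (class_op T c (delta R y) x) <= 9.
Proof.
rewrite /class_op l2_sum big_mkcond; apply: le_trans (csq_sum_le _ _) _.
rewrite {1}/index_enum -enumT size_enum_ord.
suff h i : csq (if class_pred c i then T i (delta R y) x else 0) <= 1.
  by rewrite !big_ord_recl big_ord0 addr0; have := h ord0;
     have := h (lift ord0 ord0); have := h (lift ord0 (lift ord0 ord0)); lra.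
case: ifP => _; last by rewrite csq0.
have := nrm2_ge_sum (T i (delta R y)) (s := [:: x]) isT; rewrite big_seq1 => h.
apply: le_trans h _; apply: le_trans (pc_nrm2 (pT i) _) _.
by rewrite -lecR -inner_self inner_delta /= eqxx.
Qed.

(** The first term is the Lipschitz constant of the determinant for entries with [csq] at most 9,
    times the number of entries; the second is the crude bound used at a bad vertex. *)
Definition det_const c (A : {fset X}) : R :=
  let n := #|{: A}| in
  #|{perm 'I_n}|%:R * #|{perm 'I_n}|%:R * (2 * 9) ^+ n * (n%:R * n%:R) +
  (2 + 2 * csq (\det (op_submx (class_op T c) A))).

(** At a good vertex the inclusion probability is exactly a determinant of [mQ], compared entrywise
    with that of the operator; the square of the mean error is at most the mean of the squared
    errors. *)
Lemma freq_det c (A : {fset X}) : {subset A <= B} -> {in A, forall x, pos x \in L} ->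
  csq ((freq M (incl c A))%:C - \det (op_submx (class_op T c) A)) <= det_const c A * eps.
Proof.
move=> AB AL; set D := \det _; rewrite /det_const -/D.
set n := #|{: A}| in D *; set K : R := #|{perm 'I_n}|%:R * _ * _.
have D0 := csq_ge0 D.
have K0 : 0 <= K by rewrite !mulr_ge0 ?ler0n ?exprn_ge0.
have -> : (freq M (incl c A))%:C - D =
    (\sum_(v : mV M) ((vfreq (incl c A) v)%:C - D)) * (#|mV M|%:R^-1)%:C.
  rewrite sumrB sumr_const mulrBl -rc_sum -rcM; congr (_ - _).
  have nC : #|mV M|%:R = #|mV M|%:R%:C :> R[i] by rewrite (rmorph_nat (real_complex R)).
  by rewrite -[D *+ _]mulr_natr -mulrA nC -rcM mulfV ?gt_eqF// mulr1.
rewrite csqM; apply: le_trans (ler_wpM2r (csq_ge0 _) (csq_sum_le _ _)) _.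
rewrite {1}/index_enum -enumT -cardT.
have -> : csq ((#|mV M|%:R^-1)%:C : R[i]) = #|mV M|%:R^-1 ^+ 2.
  by rewrite /csq /= expr0n addr0.
set z := \sum_(v : mV M) _.
have -> : #|mV M|%:R * z * #|mV M|%:R^-1 ^+ 2 = z / #|mV M|%:R.
  by field; rewrite gt_eqF.
rewrite mulrDl [X in _ + X]mulrC; apply: average_le; first by lra.
  move=> v _; apply: le_trans (csqD_le _ _) _; rewrite csqN.
  have : csq ((vfreq (incl c A) v)%:C) <= 1.
    by rewrite /csq /= expr0n addr0 expr_le1// ?vfreq_ge0// vfreq_le1.
  by lra.
pose x i := fsval (enum_val (i : 'I_n)).
have xA i : x i \in A by apply: fsvalP.
have xi : injective x by move=> i j /val_inj/enum_val_inj.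
have err v : v \in mG M -> csq ((vfreq (incl c A) v)%:C - D) <=
    K * \sum_i \sum_j csq (mQ c (mspot M v (x i)) (mspot M v (x j)) - class_op T c (delta R (x j)) (x i)).
  move=> vG; rewrite vfreq_incl (gm_det gM); last first.
    by move=> i j /(spot_inj posK (gm_window gM) vG (AL _ (xA i)) (AL _ (xA j)))/xi.
  have b1 : 1 <= 9 :> R by lra.
  apply: le_trans (csq_det_sub b1 _ _) _.
  - by move=> i j; rewrite mxE; apply: le_trans (gm_bound gM _ _ _) b1.
  - by move=> i j; rewrite mxE; apply: csq_class_op.
  rewrite le_eqVlt; apply/orP; left; apply/eqP; congr (_ * _).
  by apply: eq_bigr => i _; apply: eq_bigr => j _; rewrite !mxE.
clearbody K; apply: le_trans (ler_sum _ err) _; rewrite -mulr_sumr -!mulrA ler_wpM2l//.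
rewrite exchange_big; under eq_bigr do rewrite exchange_big.
apply: (@le_trans _ _ (\sum_(i < n) \sum_(j < n) eps * #|mV M|%:R)).
  by apply: ler_sum => i _; apply: ler_sum => j _; apply: (gm_close gM); apply/AB/xA.
by rewrite !sumr_const !card_ord -!mulrnA -[leLHS]mulr_natl natrM !mulrA.
Qed.

End OneModel.
End Frequencies.

(** * Finite networks built from the models *)

Section Nets.
Variables (R : realType) (Gam : groupType) (X : choiceType).
Variables (J : finType) (pos : X -> Gam) (typ : X -> J) (mk : Gam -> J -> X).
Hypothesis pos_mk : forall g j, pos (mk g j) = g.
Hypothesis typ_mk : forall g j, typ (mk g j) = j.
Local Notation Cfg := (config X * config X)%type.
Variable T : 'I_3 -> l2 R X -> l2 R X.
Variables (S : {fset Gam}) (A B : Type).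
Variables (Fv : (J -> bool * bool) -> A) (Fe : S -> (J -> bool * bool) -> B).

(* The marks of the Cayley diagram are computed from the configurations on the
   fibre of [pos] over each vertex: [Fv] and [Fe] cover both marked vertices and
   marked edges. *)
Definition marked_cayley (w : Cfg) : rnet A B := cayley
  (fun g => Fv (fun j => (w.1 (mk g j), w.2 (mk g j))))
  (fun e : Gam * S => Fe e.2 (fun j => (w.1 (mk e.1 j), w.2 (mk e.1 j)))).

Section ModelNet.
Variables (M : model R Gam J) (n : nat) (kap : 'I_n.+1 -> mOm M).
Hypothesis V_gt0 : (0 < #|mV M|)%N.

Lemma model_net_gt0 : (0 < #|{: mV M * 'I_n.+1}|)%N.
Proof. by rewrite card_prod card_ord muln_gt0 V_gt0. Qed.

Definition model_net : finnet A B := sofic_net (S := S) (@mact _ _ _ M)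
  (fun u => Fv (fun j => (mA false (kap u.2) (u.1, j), mA true (kap u.2) (u.1, j))))
  (fun e => Fe e.1.2 (fun j => (mA false (kap e.2) (e.1.1, j), mA true (kap e.2) (e.1.1, j))))
  model_net_gt0.

Lemma model_net_riso r (v : mV M) c : sofic_window (@mact _ _ _ M) (cay_ball S r.+1) v ->
  riso (nball (rooted_at (G := model_net) (v, c)) r)
       (nball (marked_cayley (conf pos typ v (kap c))) r).
Proof.
move=> wv; apply: sofic_net_riso => // [g|g s] _ /=.
- by congr Fv; apply: funext => j; rewrite /spot pos_mk typ_mk.
- by congr Fe; apply: funext => j; rewrite /spot pos_mk typ_mk.
Qed.

End ModelNet.

Variables (r : nat) (K : finnet A B) (k : fvert K).

Definition ball_event : set Cfg := [set w | riso (nball (marked_cayley w) r) (rooted_at k)].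

Definition ball_support : seq X := [seq mk g j | g <- cay_ball S r, j <- enum J].

Lemma depends_ball : depends ball_support ball_event.
Proof.
move=> w w' ww'; apply: riso_trans; apply: cayley_ball_riso => [g gr|g s gr] /=.
- congr Fv; apply: funext => j; have [|-> ->//] := ww' (mk g j).
  by apply/allpairsP; exists (g, j); rewrite mem_enum.
- congr Fe; apply: funext => j; have [|-> ->//] := ww' (mk g j).
  by apply/allpairsP; exists (g, j); rewrite mem_enum.
Qed.

(** At a good vertex the ball in copy [c] is the Cayley ball marked by the sample [kap c], so that
    the proportion of copies with a given ball misses its probability by the weight error only; bad
    vertices account for [eps]. *)
Lemma ball_freq_close L D eps delta (M : model R Gam J) (V_gt0 : (0 < #|mV M|)%N)
    (gM : good_model pos typ T L D eps M) n (kap : 'I_n.+1 -> mOm M) :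
  {subset cay_ball S r.+1 <= L} ->
  \sum_om `|#|[pred c | kap c == om]|%:R / n.+1%:R - mwt om| <= delta ->
  `|ball_freq R (model_net kap V_gt0) r (rooted_at k) - freq pos typ M ball_event| <= delta + eps.
Proof.
move=> rL hkap; set N := model_net _ _.
pose P (u : mV M * 'I_n.+1) := `[< riso (nball (rooted_at (G := N) u) r) (rooted_at k) >].
pose kv v := (\sum_c (P (v, c))%:R) / n.+1%:R : R.
have VR : 0 < #|mV M|%:R :> R by rewrite ltr0n.
have -> : ball_freq R N r (rooted_at k) = (\sum_(v : mV M) kv v) / #|mV M|%:R.
  rewrite /ball_freq -mulr_suml -mulrA; congr (_ * _); last first.
    by rewrite card_prod card_ord natrM mulrC invfM.
  rewrite pair_bigA -natr_sum; congr (_%:R); rewrite -sum1_card big_mkcond.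
  by apply: eq_bigr => -[v c] _; rewrite inE /P; case: asbool.
rewrite /freq -mulrBl -sumrB normrM [X in _ * X]ger0_norm ?invr_ge0 ?ler0n//.
apply: (@le_trans _ _ ((\sum_(v : mV M) `|kv v - vfreq pos typ ball_event v|) / #|mV M|%:R)).
  by rewrite ler_wpM2r ?invr_ge0 ?ler0n// ler_norm_sum.
rewrite -[eps]mulr1; apply: (average_le gM) => // [v _|].
  have kv0 : 0 <= kv v by rewrite divr_ge0 ?ler0n// sumr_ge0.
  have kv1 : kv v <= 1.
    rewrite ler_pdivrMr// mul1r -[n.+1 in leRHS]card_ord -sumr_const ler_sum// => c _.
    by case: (P _).
  have := vfreq_ge0 gM ball_event v; have := vfreq_le1 gM ball_event v.
  by rewrite ler_norml => ? ?; apply/andP; split; lra.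
apply: (@le_trans _ _ (\sum_(v in mG M) delta)); last first.
  rewrite sumr_const -[leLHS]mulr_natr ler_wpM2l//; last by rewrite ler_nat max_card.
  by apply: le_trans hkap; apply: sumr_ge0.
apply: ler_sum => v vG; apply: le_trans hkap.
have PE c : P (v, c) = `[< ball_event (conf pos typ v (kap c)) >].
  have wv : sofic_window (@mact _ _ _ M) (cay_ball S r.+1) v.
    have [h1 h2 h3] := gm_window gM vG; split=> // [g h /rL gL /rL hL|g h /rL gL /rL hL]; first exact: h2.
    exact: h3.
  have iso := model_net_riso kap V_gt0 c wv.
  apply: asbool_equiv_eq; split; first exact: (riso_trans (riso_sym iso)).
  exact: riso_trans iso.
have -> : kv v = \sum_om #|[pred c | kap c == om]|%:R / n.+1%:R * (`[< ball_event (conf pos typ v om) >])%:R.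
  rewrite /kv (partition_big kap predT)//= mulr_suml; apply: eq_bigr => om _.
  rewrite [RHS]mulrAC; congr (_ / _); rewrite (eq_bigr (fun=> (`[< ball_event (conf pos typ v om) >])%:R)).
    by rewrite sumr_const mulr_natl.
  by move=> c /eqP <-; rewrite PE.
rewrite /vfreq -sumrB; apply: le_trans (ler_norm_sum _ _ _) _; apply: ler_sum => om _.
by rewrite -mulrBl normrM ler_piMr//; case: asbool; rewrite ?normr1 ?normr0.
Qed.

End Nets.

(** * Local events generate the sigma-algebra *)

Section Measurability.
Variables (X : choiceType).
Local Notation Cfg := (config X * config X)%type.

Lemma measurable_coord (x : X) : measurable [set w : config X | w x].
Proof. by apply: sub_sigma_algebra; exists x. Qed.

Lemma measurable_to_config d (Y : measurableType d) (f : Y -> config X) :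
  (forall x, measurable [set y | f y x]) -> measurable_fun setT f.
Proof.
move=> mf; apply: (@measurability _ _ Y (config X) setT f (cylinders X)) => // _ [_ [x _ <-] <-].
by rewrite setTI; apply: mf.
Qed.

Lemma measurable_coord1 (x : X) : measurable [set w : Cfg | w.1 x].
Proof. by have := @measurable_fst _ _ (config X) (config X) measurableT _ (measurable_coord x); rewrite setTI. Qed.

Lemma measurable_coord2 (x : X) : measurable [set w : Cfg | w.2 x].
Proof. by have := @measurable_snd _ _ (config X) (config X) measurableT _ (measurable_coord x); rewrite setTI. Qed.

Definition local_event : set (set Cfg) := [set E | measurable E /\ exists s, depends s E].

Lemma local_setI : setI_closed local_event.
Proof.
move=> E F [mE [s dE]] [mF [t dF]]; split; first exact: measurableI.
exists (s ++ t) => w w' ww' [Ew Fw]; split.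
  by apply: dE Ew => x xs; apply: ww'; rewrite mem_cat xs.
by apply: dF Fw => x xt; apply: ww'; rewrite mem_cat xt orbT.
Qed.

Lemma local_eventT : local_event setT.
Proof. by split=> //; exists [::]. Qed.

Lemma local_generate : (@measurable _ Cfg) = <<s local_event >>.
Proof.
apply/seteqP; split=> [E mE|]; last first.
  by apply: smallest_sub; [exact: sigma_algebra_measurable|move=> E []].
have mid : measurable_fun setT (idfun : g_sigma_algebraType local_event -> Cfg).
  have -> : idfun = (fun w : g_sigma_algebraType local_event => ((w : Cfg).1, (w : Cfg).2)).
    by apply: funext => -[].
  apply: measurable_fun_pair; apply: measurable_to_config => x; apply: sub_sigma_algebra; split.
  - exact: measurable_coord1.
  - by exists [:: x] => w w' /(_ x (mem_head _ _))[e _] /=; rewrite e.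
  - exact: measurable_coord2.
  - by exists [:: x] => w w' /(_ x (mem_head _ _))[_ e] /=; rewrite e.
by have := mid measurableT _ mE; rewrite setTI.
Qed.

Lemma measurable_shift (Gam : groupType) (a : gaction Gam X) g :
  measurable_fun setT (fun w : Cfg => (cshift a g w.1, cshift a g w.2)).
Proof.
apply: measurable_fun_pair; apply: measurable_to_config => x.
- exact: measurable_coord1.
- exact: measurable_coord2.
Qed.

End Measurability.

Lemma exhaust (T : eqType) (en : nat -> option T) (s : seq T) :
  (forall x, exists n, en n = Some x) ->
  exists k0, forall k, (k0 <= k)%N -> {subset s <= pmap en (iota 0 k)}.
Proof.
move=> en_surj; elim: s => [|x s [k0 IHs]]; first by exists 0%N.
have [n nx] := en_surj x; exists (maxn n.+1 k0) => k.
rewrite geq_max => /andP[nk /IHs sk] y; rewrite inE => /predU1P[->|/sk//].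
by rewrite mem_pmap -nx map_f// mem_iota.
Qed.

Lemma cvg_eq (R : realType) (u v : nat -> R) (l m : R) :
  u n @[n --> \oo] --> l -> v n @[n --> \oo] --> m ->
  (forall e, 0 < e -> \forall n \near \oo, `|u n - v n| <= e) -> l = m.
Proof.
move=> ul vm uv; apply/eqP; rewrite -subr_eq0 -normr_eq0 eq_le normr_ge0 andbT.
apply/ler_addgt0Pr => e e0; rewrite add0r.
have e30 : 0 < e / 3 by rewrite divr_gt0.
have /cvgrPdist_le/(_ _ e30) ul' := ul; have /cvgrPdist_le/(_ _ e30) vm' := vm.
have [n /= [[h1 h2] h3]] := filter_ex (filterI (filterI ul' vm') (uv _ e30)).
have -> : l - m = (l - u n) + (u n - v n) - (m - v n) by ring.
apply: le_trans (ler_normB _ _) _; apply: le_trans (lerD (ler_normD _ _) (lexx _)) _; lra.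
Qed.

Lemma csq_eq0 (R : realType) (z : R[i]) : (csq z == 0) = (z == 0).
Proof. by rewrite eq_complex /csq paddr_eq0 ?sqr_ge0// !sqrf_eq0. Qed.

Lemma depends_incl (X : choiceType) c (A : {fset X}) : depends A (incl c A).
Proof. by move=> w w' ww' h x xA; have [e1 e2] := ww' x xA; have := h x xA; case: c {h}; rewrite ?e1 ?e2. Qed.

(** * Passage to the limit *)

Section Limit.
Variables (R : realType) (Gam : groupType) (X : choiceType) (a : gaction Gam X).
Variables (J : finType) (pos : X -> Gam) (typ : X -> J) (mk : Gam -> J -> X).
Hypothesis posK : forall x, mk (pos x) (typ x) = x.
Hypothesis pos_mk : forall g j, pos (mk g j) = g.
Hypothesis typ_mk : forall g j, typ (mk g j) = j.
Hypothesis actE : forall g x, a g x = mk (g * pos x)%g (typ x).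
Local Notation H := (l2 R X).
Local Notation Cfg := (config X * config X)%type.
Variable T : 'I_3 -> H -> H.
Hypothesis pT : forall i, pcontr a (T i).
Hypothesis sT : forall u, \sum_i T i u = u.
Variable S : {fset Gam}.
Hypothesis genS : generating S.
Hypothesis sofG : sofic R Gam.
Local Notation freq := (freq pos typ).
Local Notation good_model := (good_model pos typ T).

Lemma enum_group : exists en : nat -> option Gam, forall g, exists n, en n = Some g.
Proof.
have [word [_ wordP]] := generating_words genS.
exists (fun n => omap (@wprod Gam S) (choice.unpickle n)) => g.
by exists (choice.pickle (word g)); rewrite choice.pickleK /= wordP.
Qed.

Lemma enum_points : exists en : nat -> option X, forall x, exists n, en n = Some x.
Proof.
have [word [_ wordP]] := generating_words genS.
exists (fun n => omap (fun p : seq S * J => mk (wprod p.1) p.2) (choice.unpickle n)) => x.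
by exists (choice.pickle (word (pos x), typ x)); rewrite choice.pickleK /= wordP posK.
Qed.

(** The windows exhaust the group and the points, so every fixed window and tolerance is eventually
    met. The clause with empty windows and tolerance 1 holds for every [n] and carries the exact
    properties of the models. *)
Lemma model_sequence : exists (mu : probability Cfg R) (N : nat -> model R Gam J),
  (forall s E, depends s E -> freq (N n) E @[n --> \oo] --> fine (mu E)) /\
  (forall n, good_model [::] [::] 1 (N n)) /\
  (forall L B eps, 0 < eps -> \forall n \near \oo, good_model L B eps (N n)).
Proof.
have [enG enG_surj] := enum_group; have [en en_surj] := enum_points.
have inv0 k : 0 < k.+1%:R^-1 :> R by rewrite invr_gt0 ltr0n.
have [M HM] := choice (fun k => finite_model posK pos_mk typ_mk actE pT sT
  (pmap enG (iota 0 k)) (pmap en (iota 0 k)) sofG (inv0 k)).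
have [mu [phi Hphi]] := limit_measure en_surj (fun k => freq_fin_additive (HM k)).
exists mu, (M \o phi); split=> [s E dE|]; last split=> [n|L B eps e0].
  have [k0 sk] := exhaust s en_surj.
  apply/cvgrPdist_le => e e0; near=> n.
  have [_ close] := Hphi n; rewrite distrC; apply: le_trans (close E _) _.
    move=> w w' ww'; apply: dE => x /(sk n).
    have kn : (k0 <= n)%N by near: n; exists k0.
    rewrite mem_pmap => /(_ kn)/mapP[l]; rewrite mem_iota add0n => /andP[_ iN] ei.
    exact: ww' iN (esym ei).
  by near: n; apply: filterS (near_infty_natSinv_lt (PosNum e0)) => n /ltW.
  apply: good_model_sub (HM (phi n)) => //.
  by rewrite invf_le1 ?ltr0n// ler1n.
have [k0 Lk] := exhaust L enG_surj; have [k1 Bk] := exhaust B en_surj.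
near=> n; have [nphi _] := Hphi n.
apply: good_model_sub (HM (phi n)).
- by apply: Lk; apply: leq_trans nphi; near: n; exists k0.
- by apply: Bk; apply: leq_trans nphi; near: n; exists k1.
apply: (@le_trans _ _ n.+1%:R^-1); first by rewrite lef_pV2 ?posrE ?ltr0n// ler_nat.
by near: n; apply: filterS (near_infty_natSinv_lt (PosNum e0)) => n /ltW.
Unshelve. all: by end_near.
Qed.

Section LimitFacts.
Variables (mu : probability Cfg R) (N : nat -> model R Gam J).
Hypothesis cvgN : forall s E, depends s E -> freq (N n) E @[n --> \oo] --> fine (mu E).
Hypothesis goodN : forall n, good_model [::] [::] 1 (N n).
Hypothesis near_good : forall L B eps, 0 < eps -> \forall n \near \oo, good_model L B eps (N n).

Lemma fine_mu_eq (E F : set Cfg) : measurable E -> measurable F -> fine (mu E) = fine (mu F) -> mu E = mu F.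
Proof.
by move=> mE mF h; rewrite -(fineK (fin_num_measure mu E mE)) h fineK// fin_num_measure.
Qed.

Lemma limit_det c (A : {fset X}) :
  (fine (mu (incl c A)))%:C = \det (op_submx (class_op T c) A).
Proof.
set D := \det _; set F := incl c A.
have dF : depends A F by apply: depends_incl.
apply/eqP; rewrite -subr_eq0 -csq_eq0 eq_le csq_ge0 andbT; apply/ler_addgt0Pr => e e0; rewrite add0r.
pose C := `|det_const T c A| + 1.
have C0 : 0 < C by rewrite ltr_wpDl.
have d0 : 0 < Num.min 1 (e / 4) by rewrite lt_min ltr01 divr_gt0.
have e4C : 0 < e / (4 * C) by rewrite divr_gt0// mulr_gt0.
have /cvgrPdist_le/(_ _ d0) cF := cvgN dF.
have [n /= [h1 h2]] := filter_ex (filterI cF (near_good [seq pos x | x <- A] A e4C)).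
have h3 := freq_det posK pT h2 c (A := A) (fun x xA => xA) (fun x xA => map_f pos xA).
have -> : (fine (mu F))%:C - D = (fine (mu F) - freq (N n) F)%:C + ((freq (N n) F)%:C - D).
  by rewrite rcB addrA subrK.
apply: le_trans (csqD_le _ _) _.
have k1 : csq ((fine (mu F) - freq (N n) F)%:C) <= e / 4.
  rewrite /csq /= expr0n addr0 -real_normK ?num_real//.
  move: h1; rewrite le_min => /andP[h11 h12]; rewrite expr2; apply: le_trans h12.
  by rewrite ler_piMl.
have k2 : csq ((freq (N n) F)%:C - D) <= e / 4.
  apply: le_trans h3 _; apply: (@le_trans _ _ (C * (e / (4 * C)))).
    apply: ler_wpM2r; first exact: ltW.
    by apply: le_trans (ler_norm _) _; rewrite lerDl.
  by rewrite le_eqVlt; apply/orP; left; apply/eqP; field; rewrite gt_eqF.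
lra.
Qed.

(** A violation at a given point has frequency zero in every model, and there are countably many
    points. *)
Lemma limit_monotone : monotone_coupling mu.
Proof.
have [en en_surj] := enum_points.
pose F n : set Cfg := if en n is Some x then [set w : Cfg | w.1 x /\ ~ w.2 x] else set0.
have mF n : measurable (F n).
  rewrite /F; case: (en n) => // x.
  exact: measurableI (measurable_coord1 x) (measurableC (measurable_coord2 x)).
have F0 n : mu (F n) = 0%E.
  rewrite -(measure0 mu); apply: fine_mu_eq => //; rewrite measure0 /=.
  rewrite /F; case: (en n) => [x|]; last by rewrite measure0.
  have dx : depends [:: x] ([set w : Cfg | w.1 x /\ ~ w.2 x] : set Cfg).
    by move=> w w' /(_ x (mem_head _ _))[e1 e2] /=; rewrite e1 e2.
  apply: (@cvg_eq R _ (fun=> 0) _ _ (cvgN dx)) => [|e e0]; first exact: cvg_cst.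
  by near=> n'; rewrite (freq_mono (goodN n')) subrr normr0 ltW.
pose E := [set w : Cfg | forall x, w.1 x -> w.2 x].
have EF : ~` E = \bigcup_n F n.
  apply/seteqP; split=> [w /existsNP[x /not_implyP[h1 h2]]|w [n _]].
    by have [n nx] := en_surj x; exists n => //; rewrite /F nx.
  by rewrite /F; case: (en n) => // x [h1 h2] /(_ x h1).
have mE : measurable E by rewrite -[E]setCK EF; apply: measurableC; apply: bigcupT_measurable.
have : mu (~` E) = 0%E.
  have mU : measurable (\bigcup_n F n) by apply: bigcupT_measurable.
  rewrite EF; apply: (negligibleP mu mU).1; apply: negligible_bigcup => n.
  exact: (negligibleP mu (mF n)).2 (F0 n).
rewrite probability_setC// /monotone_coupling -/E => /eqP.
by rewrite sube_eq ?fin_num_measure// add0e => /eqP.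
Unshelve. all: by end_near.
Qed.

Lemma limit_shift (g : Gam) s (E : set Cfg) : depends s E ->
  fine (mu [set w | E (cshift a g w.1, cshift a g w.2)]) = fine (mu E).
Proof.
move=> dE.
have dE' : depends [seq a g^-1%g x | x <- s] ([set w | E (cshift a g w.1, cshift a g w.2)] : set Cfg).
  by move=> w w' ww'; apply: dE => x xs; rewrite /cshift /=; apply: ww'; apply: map_f.
apply: (cvg_eq (cvgN dE') (cvgN dE)) => e e0.
near=> n; have gM : good_model (g :: g^-1%g :: [seq pos x | x <- s]) [::] e (N n).
  by near: n; apply: near_good.
by apply: (freq_shift pos_mk typ_mk actE gM dE) => [||x xs]; rewrite !inE ?eqxx ?orbT// map_f ?orbT.
Unshelve. all: by end_near.
Qed.

(** Shift invariance on local events extends to all of them, since local events are stable under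
    intersection and generate the sigma-algebra. *)
Lemma limit_invariant : diag_invariant a mu.
Proof.
move=> g B mB.
pose sh : {mfun Cfg >-> Cfg} := mfun_Sub (mem_set (measurable_shift (X := X) a g)).
have -> : mu [set w : Cfg | B (cshift a g w.1, cshift a g w.2)] = distribution mu sh B by [].
apply: (@measure_unique _ R Cfg (@local_event X) (fun=> setT) _ _ _ _ (distribution mu sh) mu) => //.
- exact: local_generate.
- exact: local_setI.
- by move=> _; exact: local_eventT.
- by rewrite bigcup_const.
- move=> E [mE [s dE]]; apply: fine_mu_eq => //; last exact: limit_shift dE.
  by rewrite -[X in measurable X]setTI; apply: (measurable_shift a g).
- by move=> _; apply: le_lt_trans (probability_le1 _ _) (ltry _).
Qed.

(** The networks are deterministic: enough copies carry each sample in the right proportion up to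
    [1 / (n + 1)]. *)
Lemma limit_weak (A B : Type) (Fv : (J -> bool * bool) -> A) (Fe : S -> (J -> bool * bool) -> B) :
  is_random_weak_limit mu (marked_cayley mk Fv Fe).
Proof.
have V_gt0 n := gm_card (goodN n).
have weights n : exists net : finnet A B, exists q, exists kap : 'I_q.+1 -> mOm (N n),
    net = model_net Fv Fe kap (V_gt0 n) /\
    \sum_om `|#|[pred c | kap c == om]|%:R / q.+1%:R - mwt om| <= n.+1%:R^-1 :> R.
  have [|q [kap hkap]] := @empirical_weights R _ _ n.+1%:R^-1 (gm_wt_ge0 (goodN n)) (gm_wt1 (goodN n)).
    by rewrite invr_gt0 ltr0n.
  by exists (model_net Fv Fe kap (V_gt0 n)), q, kap.
have [net Hnet] := choice weights.
exists net => r K k; set E := (X in mu X).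
have dE : depends (ball_support mk S r) E by apply: depends_ball.
apply/cvgrPdist_le => e e0.
have e30 : 0 < e / 3 by rewrite divr_gt0.
have /cvgrPdist_le/(_ _ e30) cE := cvgN dE.
near=> n.
have gM : good_model (cay_ball S r.+1) [::] (e / 3) (N n) by near: n; apply: near_good.
have h1 : `|fine (mu E) - freq (N n) E| <= e / 3.
  by near: n; exact: cE.
have h2 : n.+1%:R^-1 <= e / 3.
  by near: n; apply: filterS (near_infty_natSinv_lt (PosNum e30)) => n /ltW.
have [q [kap [-> hkap]]] := Hnet n.
have h3 := ball_freq_close pos_mk typ_mk Fv Fe k (V_gt0 n) gM (fun x h => h) hkap.
have -> : fine (mu E) - ball_freq R (model_net Fv Fe kap (V_gt0 n)) r (rooted_at k) =
  (fine (mu E) - freq (N n) E) - (ball_freq R (model_net Fv Fe kap (V_gt0 n)) r (rooted_at k) - freq (N n) E) by ring.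
apply: le_trans (ler_normB _ _) _; apply: le_trans (lerD h1 (le_trans h3 (lerD h2 (lexx _)))) _; lra.
Unshelve. all: by end_near.
Qed.

End LimitFacts.

Theorem invariant_coupling : exists mu : probability Cfg R,
  [/\ forall c (A : {fset X}), (fine (mu (incl c A)))%:C = \det (op_submx (class_op T c) A),
      monotone_coupling mu, diag_invariant a mu &
      forall (A B : Type) (Fv : (J -> bool * bool) -> A) (Fe : S -> (J -> bool * bool) -> B),
        is_random_weak_limit mu (marked_cayley mk Fv Fe)].
Proof.
have [mu [N [h1 [h2 h3]]]] := model_sequence.
exists mu; split.
- by move=> c A; exact: (limit_det h1 h3).
- exact: limit_monotone h1 h2.
- exact: limit_invariant h1 h3.
- by move=> A B Fv Fe; apply: limit_weak h1 h2 h3 _ _ _ _.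
Qed.

End Limit.

(** * From the two operators to the coupling *)

Section MonotoneCoupling.
Variables (R : realType) (Gam : groupType) (X : choiceType) (a : gaction Gam X).
Variables (J : finType) (pos : X -> Gam) (typ : X -> J) (mk : Gam -> J -> X).
Hypothesis posK : forall x, mk (pos x) (typ x) = x.
Hypothesis pos_mk : forall g j, pos (mk g j) = g.
Hypothesis typ_mk : forall g j, typ (mk g j) = j.
Hypothesis actE : forall g x, a g x = mk (g * pos x)%g (typ x).
Local Notation H := (l2 R X).
Local Notation Cfg := (config X * config X)%type.
Variable S : {fset Gam}.
Hypothesis genS : generating S.
Hypothesis sofG : sofic R Gam.
Variables Q1 Q2 : {linear H -> H}.
Hypothesis cQ1 : in_commutant a Q1.
Hypothesis cQ2 : in_commutant a Q2.
Hypothesis ge0Q1 : ople (fun=> 0%R) Q1.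
Hypothesis leQ12 : ople Q1 Q2.
Hypothesis leQ2 : ople Q2 id.

Definition increment (i : 'I_3) (u : H) : H :=
  match val i with 0 => Q1 u | 1 => Q2 u - Q1 u | _ => u - Q2 u end.

Lemma sum_increment u : \sum_i increment i u = u.
Proof.
rewrite !big_ord_recl big_ord0 addr0 /increment /=.
by rewrite addrA [Q1 u + _]addrC subrK addrC subrK.
Qed.

Lemma class_op_increment c u : class_op increment c u = (if c then Q2 else Q1) u.
Proof.
rewrite /class_op big_mkcond !big_ord_recl big_ord0 /class_pred.
by case: c => /=; rewrite /increment /= !addr0// [Q1 u + _]addrC subrK.
Qed.

Lemma pcontr_increment i : pcontr a (increment i).
Proof.
have ge0 u : 0 <= inner (Q1 u) u by have := ge0Q1 u; rewrite inner0l.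
have trB g (u v : H) : translate a g (u - v) = translate a g u - translate a g v by apply: l2_eq.
have linB c (u v u' v' : H) : (c *: u + v) - (c *: u' + v') = c *: (u - u') + (v - v').
  by rewrite opprD addrACA scalerBr.
case: i => -[|[|[|//]]] i3; split=> [c u v|u|u|g u]; rewrite /increment /=.
- by rewrite linearP.
- exact: ge0.
- exact: le_trans (leQ12 u) (leQ2 u).
- exact: cQ1.2.
- by rewrite (linearP Q1) (linearP Q2) linB.
- by rewrite innerBl subr_ge0; apply: leQ12.
- by rewrite innerBl lerBlDr (le_trans (leQ2 u))// lerDl.
- by rewrite trB cQ1.2 cQ2.2.
- by rewrite (linearP Q2) linB.
- by rewrite innerBl subr_ge0; apply: leQ2.
- by rewrite innerBl lerBlDr lerDl (le_trans (ge0 u))//; apply: leQ12.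
- by rewrite trB cQ2.2.
Qed.

(** The determinantal measures are produced together with the coupling, as the marginals of the
    limit law. *)
Lemma monotone_determinantal_coupling : exists P1 P2 : probability (config X) R,
  [/\ is_determinantal Q1 P1, is_determinantal Q2 P2 &
    exists mu : probability Cfg R,
      [/\ is_coupling P1 P2 mu, monotone_coupling mu, diag_invariant a mu &
          forall (A B : Type) (Fv : (J -> bool * bool) -> A) (Fe : S -> (J -> bool * bool) -> B),
            is_random_weak_limit mu (marked_cayley mk Fv Fe)]].
Proof.
have [mu [dmu mmu imu wmu]] := invariant_coupling posK pos_mk typ_mk actE
  pcontr_increment sum_increment genS sofG.
pose p1 : {mfun Cfg >-> config X} := mfun_Sub (mem_set (@measurable_fst _ _ (config X) (config X))).
pose p2 : {mfun Cfg >-> config X} := mfun_Sub (mem_set (@measurable_snd _ _ (config X) (config X))).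
have sub c (A : {fset X}) : op_submx (class_op increment c) A = op_submx (if c then Q2 else Q1) A.
  by apply/matrixP => i j; rewrite !mxE class_op_increment; case: c.
exists (distribution mu p1), (distribution mu p2); split.
- by move=> A; rewrite -(sub false) -dmu.
- by move=> A; rewrite -(sub true) -dmu.
exists mu; split=> // B mB; split.
  by congr (mu _); apply/seteqP; split=> [w []|].
by congr (mu _); apply/seteqP; split=> [w []|].
Qed.

End MonotoneCoupling.

Theorem theorem5p1 (R : realType) (Gam : groupType) (S : {fset Gam})
    (sofGam : sofic R Gam) (symS : symmetric_set S) (genS : generating S) :
  (forall Q1 Q2 : {linear l2 R Gam -> l2 R Gam},
     in_commutant (vact Gam) Q1 -> in_commutant (vact Gam) Q2 ->
     ople (fun=> 0%R) Q1 -> ople Q1 Q2 -> ople Q2 id ->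
     exists P1 P2 : probability (config Gam) R,
       [/\ is_determinantal Q1 P1, is_determinantal Q2 P2 &
         exists mu : probability (config Gam * config Gam)%type R,
           [/\ is_coupling P1 P2 mu, monotone_coupling mu,
               diag_invariant (vact Gam) mu &
               is_random_weak_limit mu (@cay_vmarked Gam S)]]) /\
  (forall Q1 Q2 : {linear l2 R (Gam * S)%type -> l2 R (Gam * S)%type},
     in_commutant (eact S) Q1 -> in_commutant (eact S) Q2 ->
     ople (fun=> 0%R) Q1 -> ople Q1 Q2 -> ople Q2 id ->
     exists P1 P2 : probability (config (Gam * S)%type) R,
       [/\ is_determinantal Q1 P1, is_determinantal Q2 P2 &
         exists mu : probability
             (config (Gam * S)%type * config (Gam * S)%type)%type R,
           [/\ is_coupling P1 P2 mu, monotone_coupling mu,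
               diag_invariant (eact S) mu &
               is_random_weak_limit mu (@cay_emarked Gam S)]]).
Proof.
split=> Q1 Q2 cQ1 cQ2 Q1ge0 Q12 Q2le.
  have [||||P1 [P2 [d1 d2 [mu [m1 m2 m3 m4]]]]] := @monotone_determinantal_coupling R Gam Gam (vact Gam) unit
    id (fun=> tt) (fun g _ => g) _ _ _ _ S genS sofGam Q1 Q2 cQ1 cQ2 Q1ge0 Q12 Q2le => //.
    by move=> g [].
  exists P1, P2; split=> //; exists mu; split=> //.
  exact: (m4 _ _ (fun p => p tt) (fun s _ => s)).
have [||||P1 [P2 [d1 d2 [mu [m1 m2 m3 m4]]]]] := @monotone_determinantal_coupling R Gam _ (eact S) S
  fst snd pair _ _ _ _ S genS sofGam Q1 Q2 cQ1 cQ2 Q1ge0 Q12 Q2le => //.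
  by case.
exists P1, P2; split=> //; exists mu; split=> //.
have -> : @cay_emarked Gam S = marked_cayley pair (fun=> tt) (fun s p => (s, p s)).
  by apply: funext => w; congr cayley; apply: funext => -[g s].
exact: m4.
Qed.
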